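(* The following hold for the class $\mathcal{S}^*_{sin}$: (i) $R_{\mathcal{S}_{sin}^*}(\mathcal{T}_1)= \dfrac{5+2\sin 1-\sqrt{25-12\sin 1+4(\sin 1)^2}}{8}$ $(\approx 0.308961)$; (ii) $R_{\mathcal{S}_{sin}^*}(\mathcal{T}_2)= \dfrac{2+\sin 1-\sqrt{4+(\sin 1)^2}}{2}$ $(\approx 0.335831)$; (iii) $R_{\mathcal{S}_{sin}^*}(\mathcal{T}_3)=\dfrac{\sin 1}{\sqrt{9-(\sin 1)^2}}$ $(\approx 0.292221)$.
   Context: Let $\mathbb{D}=\{z\in\mathbb{C}:|z|<1\}$ and let $\mathcal{A}$ be the class of analytic functions $f:\mathbb{D}\to\mathbb{C}$ with $f(0)=0$, $f'(0)=1$. For analytic $f,g$ on $\mathbb{D}$, $f\prec g$ ($f$ is subordinate to $g$) means $f=g\circ w$ for some analytic $w:\mathbb{D}\to\mathbb{D}$ with $w(0)=0$. Square roots are principal branches, and quotients such as $f/g$, $g/(zp)$, $zf'/f$ are understood with removable singularities at $0$ filled in. Define $\mathcal{T}_1$: all $f\in\mathcal{A}$ such that $f/g\prec e^z$ and $g/(zp)\prec e^z$ for some $g\in\mathcal{A}$ and some $p\prec\sqrt{1+z}$; $\mathcal{T}_2$: all $f\in\mathcal{A}$ such that $f/g\prec \sqrt{1+z}$ and $g/(zp)\prec \sqrt{1+z}$ for some $g\in\mathcal{A}$ and some $p\prec e^z$; $\mathcal{T}_3$: all $f\in\mathcal{A}$ such that $f/g\prec z+\sqrt{1+z^2}$ and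 $g/(zp)\prec z+\sqrt{1+z^2}$ for some $g\in\mathcal{A}$ and some $p\prec z+\sqrt{1+z^2}$. $\mathcal{S}^*_{sin}$ is the class of $f\in\mathcal{A}$ with $zf'(z)/f(z)\prec 1+\sin z$. For classes $\mathcal{G},\mathcal{M}\subset\mathcal{A}$, the $\mathcal{G}$-radius $R_{\mathcal{G}}(\mathcal{M})$ is $\inf\{\rho_f: f\in\mathcal{M}\}$, where $\rho_f$ is the largest number in $(0,1]$ such that for every $0<r\le\rho_f$ the function $f$ has the property defining $\mathcal{G}$ in the disk $|z|<r$, i.e. $z\mapsto f(rz)/r$ belongs to $\mathcal{G}$. *)

(* Defs.v *)
From Stdlib Require Import Reals Lra.
From Coquelicot Require Import Coquelicot.

Open Scope R_scope.

(* Functions on the unit disc are represented by total functions C -> C; every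
   definition below only looks at their values on the disc (or a smaller disc). *)

Definition in_disc (z : C) : Prop := Cmod z < 1.

Definition analytic (f : C -> C) : Prop :=
  forall z, in_disc z -> ex_derive (K := C_AbsRing) (V := C_NormedModule) f z.

Definition classA (f : C -> C) : Prop :=
  analytic f /\ f (RtoC 0) = RtoC 0 /\ C_derive f (RtoC 0) = RtoC 1.

Definition Cexp (z : C) : C := (exp (Re z) * cos (Im z), exp (Re z) * sin (Im z)).

Definition Csin (z : C) : C :=
  ((Cexp (Ci * z) - Cexp (- (Ci * z))) / (2 * Ci))%C.

(* Principal square root, cut along the negative real axis; [Csqrt_sqr] and
   [Re_Csqrt_gt0] below characterize it off the cut. *)
Definition Csqrt (z : C) : C :=
  (sqrt ((Cmod z + Re z) / 2),
   if Rle_dec 0 (Im z) then sqrt ((Cmod z - Re z) / 2)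
   else - sqrt ((Cmod z - Re z) / 2)).

Lemma Csqrt_sqr (z : C) : (Csqrt z * Csqrt z)%C = z.
Proof.
destruct z as [x y]; unfold Csqrt; simpl.
assert (Hm : Cmod (x, y) * Cmod (x, y) = x * x + y * y).
{ unfold Cmod; simpl; rewrite sqrt_sqrt; nra. }
assert (H0 := Cmod_ge_0 (x, y)).
set (m := Cmod (x, y)) in *.
assert (Hp : 0 <= (m + x) / 2) by nra.
assert (Hn : 0 <= (m - x) / 2) by nra.
assert (Sp := sqrt_sqrt _ Hp); assert (Sn := sqrt_sqrt _ Hn).
assert (Spn : sqrt ((m + x) / 2) * sqrt ((m - x) / 2) = Rabs y / 2).
{ rewrite <- sqrt_mult by assumption.
  replace ((m + x) / 2 * ((m - x) / 2)) with (Rsqr (y / 2)) by (unfold Rsqr; nra).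
  rewrite sqrt_Rsqr_abs; unfold Rdiv; rewrite Rabs_mult, (Rabs_pos_eq (/ 2)); lra. }
destruct (Rle_dec 0 y) as [Hy | Hy]; unfold Cmult; simpl; f_equal; try nra.
- rewrite Rabs_pos_eq in Spn; lra.
- rewrite Rabs_left in Spn; lra.
Qed.

Lemma Re_Csqrt_gt0 (z : C) : 0 < Re z \/ Im z <> 0 -> 0 < Re (Csqrt z).
Proof.
destruct z as [x y]; simpl; intros H.
apply sqrt_lt_R0.
assert (Hm : Cmod (x, y) * Cmod (x, y) = x * x + y * y).
{ unfold Cmod; simpl; rewrite sqrt_sqrt; nra. }
assert (H0 := Cmod_ge_0 (x, y)).
destruct H as [H | H]; [lra |].
assert (0 < y * y) by (destruct (Rdichotomy _ _ H); nra).
nra.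
Qed.

Definition subord (f g : C -> C) : Prop :=
  analytic f /\
  exists w : C -> C,
    analytic w /\ (forall z, in_disc z -> in_disc (w z)) /\ w (RtoC 0) = RtoC 0 /\
    forall z, in_disc z -> f z = g (w z).

(* [num / den] is subordinate to [phi], the quotient being understood with its
   removable singularity at 0 filled in: that filled-in quotient is the function
   [h], which is analytic on the whole disc by definition of [subord]. *)
Definition quot_subord (num den phi : C -> C) : Prop :=
  exists h : C -> C,
    (forall z, in_disc z -> z <> RtoC 0 ->
       den z <> RtoC 0 /\ h z = (num z / den z)%C) /\
    subord h phi.

Definition phi_sqrt (z : C) : C := Csqrt (1 + z).
Definition phi_lune (z : C) : C := (z + Csqrt (1 + z * z))%C.
Definition phi_sin (z : C) : C := (1 + Csin z)%C.

Definition classT (phi psi f : C -> C) : Prop :=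
  classA f /\
  exists g p : C -> C,
    classA g /\ subord p psi /\
    quot_subord f g phi /\ quot_subord g (fun z => (z * p z)%C) phi.

Definition classT1 : (C -> C) -> Prop := classT Cexp phi_sqrt.
Definition classT2 : (C -> C) -> Prop := classT phi_sqrt Cexp.
Definition classT3 : (C -> C) -> Prop := classT phi_lune phi_lune.

Definition starlike_sin (f : C -> C) : Prop :=
  classA f /\ quot_subord (fun z => (z * C_derive f z)%C) f phi_sin.

Definition dilate (r : R) (f : C -> C) : C -> C := fun z => (f (r * z) / r)%C.

Definition admissible (G : (C -> C) -> Prop) (f : C -> C) (rho : R) : Prop :=
  0 < rho <= 1 /\ forall r, 0 < r <= rho -> G (dilate r f).

Definition is_rho (G : (C -> C) -> Prop) (f : C -> C) (rho : R) : Prop :=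
  admissible G f rho /\ forall rho', admissible G f rho' -> rho' <= rho.

(* The first conjunct says that rho_f is well defined for every f in M, so that
   no member of M is silently left out of the infimum. *)
Definition is_radius (G M : (C -> C) -> Prop) (R0 : R) : Prop :=
  (forall f, M f -> exists rho, is_rho G f rho) /\
  is_glb_Rbar (fun rho => exists f, M f /\ is_rho G f rho) (Finite R0).

(* Main.v *)
(* Write f = z h1 h2 p with h1, h2 subordinate to phi and p to psi.  Then z f'/f = 1 + u, where u is
   a sum of three terms z w' L(w), with w a Schwarz function and L the logarithmic derivative of phi
   or psi.  Dieudonne's lemma |z w' - w| <= (r^2 - |w|^2) / (1 - r^2), for |z| = r, bounds each term
   by its value for w = z; for the lune it is the real part that is bounded this way.  The image of
   the disc under sin contains the part of the strip |Re| < sin 1 that lies in a slightly larger disc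
   than |u| < sin 1, and an explicit holomorphic inverse of sin turns u into a Schwarz function.
   Taking w = z in all three terms and evaluating at -r makes u real and at most -sin 1 past the
   radius, so the radius is sharp.

   Analyticity is mere complex differentiability, so Goursat's theorem for triangles comes first: it
   gives primitives.  If F' = f, then f is differentiable, so F has second-order Taylor expansions and
   the difference quotient (F(y) - F(z)) / (y - z) is analytic in y even at z.  Hence its integral
   over a circle vanishes, which is Cauchy's formula for F, and f = F' is smooth. *)

Require Import Defs.
From Stdlib Require Import Reals Lra Psatz ClassicalEpsilon.
From Coquelicot Require Import Coquelicot.
Open Scope R_scope.

(** * Complex derivatives *)

(** For the exponential and the square root the modulus of each term is bounded, and the disc of
    radius sin 1 would suffice. The lune shapes the rest: 1 / sqrt(1 + y^2) is largest at imaginary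
    y, so near the third radius the sum [u] can reach modulus about 0.917, above sin 1, and only its
    real part stays below sin 1. Hence the strip |Re u| < sin 1 is needed up to |u|^2 < 0.9. This
    constant leaves room on both sides: the three lune terms give at most 0.945^2, while |sin|^2
    stays above 0.9 on the part of the unit circle with |Re| <= 0.8.

    Having an inverse of sin makes membership a pointwise condition: every value [u z] on the disc
    is a value of sin on the unit disc. Such a condition passes to unions of discs, so the supremum
    defining rho_f is attained.

    The radii solve 2 r + r / (2 (1 - r)) = sin 1, r / (1 - r) + r = sin 1 and 3 r / sqrt(1 + r^2) =
    sin 1. All three lie below sqrt 2 - 1, up to which |z w'| <= |z| holds for Schwarz functions. *)

Definition Cd (f : C -> C) (z l : C) : Prop :=
  is_derive (K := C_AbsRing) (V := C_NormedModule) f z l.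

(** In this form the estimates made by hand need neither filters nor the operations of the normed
    module. *)
Lemma Cd_iff (f : C -> C) (z l : C) :
  Cd f z l <->
  forall eps, 0 < eps -> exists d, 0 < d /\ forall h, Cmod h < d ->
    Cmod (f (z + h) - f z - l * h)%C <= eps * Cmod h.
Proof.
split.
- intros [_ H] eps He.
  destruct (H z (fun P H => H) (mkposreal eps He)) as [d Hd].
  exists d; split; [apply cond_pos|]; intros h Hh.
  assert (B : @ball (AbsRing_UniformSpace C_AbsRing) z d (z + h)%C).
  { change (Cmod (minus (z + h) z)%C < d).
    replace (minus (z + h) z)%C with h; [exact Hh|].
    unfold minus, plus, opp; simpl; ring. }
  specialize (Hd _ B).
  change (Cmod (((f (z + h) - f z) - ((z + h) - z) * l)%C) <= eps * Cmod ((z + h) - z)%C) in Hd.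
  replace (f (z + h) - f z - l * h)%C with ((f (z + h) - f z) - ((z + h) - z) * l)%C by ring.
  replace (Cmod h) with (Cmod ((z + h) - z)%C) by (f_equal; ring).
  exact Hd.
- intros H; split; [apply is_linear_scal_l|].
  intros x Hx.
  apply (@is_filter_lim_locally_unique C_AbsRing (AbsRing_NormedModule C_AbsRing)) in Hx; subst x.
  intros eps; destruct (H eps (cond_pos eps)) as [d [Hd0 Hd]].
  exists (mkposreal d Hd0).
  change (forall y : C, Cmod (y - z)%C < d ->
    Cmod (((f y - f z) - (y - z) * l)%C) <= eps * Cmod (y - z)%C).
  intros y Hy.
  specialize (Hd _ Hy).
  replace (z + (y - z))%C with y in Hd by ring.
  replace ((f y - f z) - (y - z) * l)%C with (f y - f z - l * (y - z))%C by ring.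
  exact Hd.
Qed.

Lemma Cd_ext_loc (f g : C -> C) (z l : C) :
  (exists d, 0 < d /\ forall y, Cmod (y - z)%C < d -> f y = g y) -> Cd f z l -> Cd g z l.
Proof.
intros [d [Hd E]] H; apply (is_derive_ext_loc f); [|exact H].
exists (mkposreal d Hd); intros y Hy; apply E; exact Hy.
Qed.

Lemma Cd_ext (f g : C -> C) (z l : C) : (forall y, f y = g y) -> Cd f z l -> Cd g z l.
Proof. intros E; apply is_derive_ext; exact E. Qed.

Lemma Cd_eq (f : C -> C) (z l l' : C) : Cd f z l -> l = l' -> Cd f z l'.
Proof. intros H <-; exact H. Qed.

Lemma Cd_const (a z : C) : Cd (fun _ => a) z 0%C.
Proof. exact (is_derive_const (K := C_AbsRing) (V := C_NormedModule) a z). Qed.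

(* Coquelicot puts two non-convertible normed module structures on [C], and its product and
   composition rules are stated for the one below. *)
Lemma Cd_AbsRing (f : C -> C) (z l : C) :
  Cd f z l <-> is_derive (K := C_AbsRing) (V := AbsRing_NormedModule C_AbsRing) f z l.
Proof.
split; intros [_ H]; (split; [apply is_linear_scal_l | exact H]).
Qed.

Lemma Cd_id (z : C) : Cd (fun y => y) z 1%C.
Proof. apply Cd_AbsRing; exact (is_derive_id (K := C_AbsRing) z). Qed.

Lemma Cd_plus (f g : C -> C) (z a b : C) :
  Cd f z a -> Cd g z b -> Cd (fun y => f y + g y)%C z (a + b)%C.
Proof. exact (is_derive_plus (K := C_AbsRing) (V := C_NormedModule) f g z a b). Qed.

Lemma Cd_minus (f g : C -> C) (z a b : C) :
  Cd f z a -> Cd g z b -> Cd (fun y => f y - g y)%C z (a - b)%C.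
Proof. exact (is_derive_minus (K := C_AbsRing) (V := C_NormedModule) f g z a b). Qed.

Lemma Cd_mult (f g : C -> C) (z a b : C) :
  Cd f z a -> Cd g z b -> Cd (fun y => f y * g y)%C z (a * g z + f z * b)%C.
Proof.
rewrite !Cd_AbsRing; intros H1 H2.
exact (is_derive_mult (K := C_AbsRing) f g z a b H1 H2 Cmult_comm).
Qed.

Lemma Cd_comp (f g : C -> C) (z a b : C) :
  Cd f (g z) a -> Cd g z b -> Cd (fun y => f (g y)) z (a * b)%C.
Proof.
intros H1 H2; apply Cd_eq with (b * a)%C; [|ring].
rewrite Cd_AbsRing in H2.
exact (is_derive_comp (K := C_AbsRing) (V := C_NormedModule) f g z a b H1 H2).
Qed.

Lemma Cd_scal (f : C -> C) (c z a : C) : Cd f z a -> Cd (fun y => c * f y)%C z (c * a)%C.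
Proof.
intros H; eapply Cd_eq; [apply (Cd_mult (fun _ => c)); [apply Cd_const|exact H]|]; cbv beta; ring.
Qed.

Lemma Cd_cont (f : C -> C) (z l : C) : Cd f z l ->
  forall eps, 0 < eps -> exists d, 0 < d /\ forall h, Cmod h < d ->
    Cmod (f (z + h) - f z)%C < eps.
Proof.
intros H eps He; rewrite Cd_iff in H.
destruct (H 1 Rlt_0_1) as [d [Hd K]].
assert (Hl := Cmod_ge_0 l).
exists (Rmin d (eps / (2 + Cmod l))); split.
{ apply Rmin_glb_lt; [exact Hd|]; apply Rdiv_lt_0_compat; lra. }
intros h Hh.
assert (H1 := Rlt_le_trans _ _ _ Hh (Rmin_l _ _)).
assert (H2 := Rlt_le_trans _ _ _ Hh (Rmin_r _ _)).
specialize (K _ H1).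
replace (f (z + h) - f z)%C with ((f (z + h) - f z - l * h) + l * h)%C by ring.
eapply Rle_lt_trans; [apply Cmod_triangle|].
rewrite Cmod_mult.
assert (Cmod h * (2 + Cmod l) < eps).
{ apply (Rmult_lt_compat_r (2 + Cmod l)) in H2; [|lra].
  unfold Rdiv in H2; rewrite Rmult_assoc, Rinv_l, Rmult_1_r in H2; lra. }
assert (0 <= Cmod h) by apply Cmod_ge_0.
nra.
Qed.

Lemma Cmod_minus_sym (a b : C) : Cmod (a - b)%C = Cmod (b - a)%C.
Proof. rewrite <- Cmod_opp; f_equal; ring. Qed.

Lemma Cmod_triangle' (a b : C) : Cmod a - Cmod b <= Cmod (a - b)%C.
Proof.
assert (H := Cmod_triangle (a - b)%C b).
replace (a - b + b)%C with a in H by ring; lra.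
Qed.

(** A continuous right inverse of a function with nonzero derivative is differentiable, without any
    inverse function theorem: with k = g (u + h) - g u, differentiability of [s] makes h - d k small
    against k, and k - h / d = - (h - d k) / d. It serves for the square root and for the inverse of
    sin. *)
Lemma Cd_local_inverse (s g : C -> C) (u d : C) :
  (forall eps, 0 < eps -> exists r, 0 < r /\ forall h, Cmod h < r -> Cmod (g (u + h) - g u)%C < eps) ->
  (exists r, 0 < r /\ forall h, Cmod h < r -> s (g (u + h)%C) = (u + h)%C) ->
  Cd s (g u) d -> d <> 0%C -> Cd g u (/ d)%C.
Proof.
intros Hc [r0 [Hr0 Hs]] Hd Hd0.
rewrite Cd_iff in *; intros eps He.
assert (Hdp : 0 < Cmod d) by (apply Cmod_gt_0; exact Hd0).
(* The first bound gives |k| |d| <= 2 |h|; the second then turns the error e1 |k| into eps |d|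
   |h|. *)
set (e1 := Rmin (Cmod d / 2) (eps * (Cmod d * Cmod d) / 2)).
assert (He1 : 0 < e1).
{ apply Rmin_glb_lt; [lra|]. assert (0 < Cmod d * Cmod d) by nra. nra. }
destruct (Hd e1 He1) as [d1 [Hd1 K]].
destruct (Hc d1 Hd1) as [r1 [Hr1 Kc]].
exists (Rmin r0 r1); split; [apply Rmin_glb_lt; assumption|].
intros h Hh.
assert (H1 := Rlt_le_trans _ _ _ Hh (Rmin_l _ _)).
assert (H2 := Rlt_le_trans _ _ _ Hh (Rmin_r _ _)).
assert (E0 : s (g u) = u).
{ replace u with (u + 0)%C by ring. apply Hs; rewrite Cmod_0; exact Hr0. }
specialize (K _ (Kc _ H2)).
set (k := (g (u + h) - g u)%C) in *.
replace (g u + k)%C with (g (u + h)%C) in K by (unfold k; ring).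
rewrite (Hs h H1), E0 in K.
replace (u + h - u - d * k)%C with (h - d * k)%C in K by ring.
assert (Q1 : e1 <= Cmod d / 2) by apply Rmin_l.
assert (Q2 : e1 <= eps * (Cmod d * Cmod d) / 2) by apply Rmin_r.
assert (Hk := Cmod_ge_0 k).
assert (T : Cmod d * Cmod k <= Cmod h + Cmod (h - d * k)%C).
{ rewrite <- Cmod_mult. assert (T := Cmod_triangle h (- (h - d * k))%C).
  rewrite Cmod_opp in T. replace (h + - (h - d * k))%C with (d * k)%C in T by ring. exact T. }
assert (T2 : Cmod k * Cmod d <= 2 * Cmod h) by nra.
replace (k - / d * h)%C with (- / d * (h - d * k))%C by (field; exact Hd0).
rewrite Cmod_mult, Cmod_opp, Cmod_inv by exact Hd0.
apply Rmult_le_reg_l with (Cmod d); [exact Hdp|].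
rewrite <- Rmult_assoc, Rinv_r, Rmult_1_l by lra.
eapply Rle_trans; [exact K|].
apply Rle_trans with (eps * (Cmod d * Cmod d) / 2 * Cmod k); [nra|].
nra.
Qed.

Lemma Cd_Cinv (z : C) : z <> 0%C -> Cd Cinv z (- / (z * z))%C.
Proof.
intros Hz; rewrite Cd_iff; intros eps He.
assert (Hp : 0 < Cmod z) by (apply Cmod_gt_0; exact Hz).
set (m := Cmod z) in *.
exists (Rmin (m / 2) (eps * (m * m * m) / 2)); split.
{ apply Rmin_glb_lt; [lra|]. assert (0 < m * m * m) by (assert (0 < m * m) by nra; nra). nra. }
intros h Hh.
assert (H1 := Rlt_le_trans _ _ _ Hh (Rmin_l _ _)).
assert (H2 := Rlt_le_trans _ _ _ Hh (Rmin_r _ _)).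
assert (Hb : m / 2 <= Cmod (z + h)%C).
{ assert (T := Cmod_triangle' z (- h)%C). rewrite Cmod_opp in T.
  replace (z - - h)%C with (z + h)%C in T by ring. fold m in T. lra. }
assert (Hzh : (z + h)%C <> 0%C) by (apply Cmod_gt_0; lra).
(* The remainder is computed exactly; it is quadratic in [h] because |z + h| >= m / 2. *)
replace (/ (z + h) - / z - - / (z * z) * h)%C with (h * h / (z * z * (z + h)))%C
  by (field; split; assumption).
rewrite Cmod_div by (repeat apply Cmult_neq_0; assumption).
rewrite !Cmod_mult; fold m.
assert (Hh0 := Cmod_ge_0 h).
assert (0 < m * m) by nra.
apply Rmult_le_reg_r with (m * m * Cmod (z + h)%C); [nra|].
unfold Rdiv; rewrite Rmult_assoc, Rinv_l by nra.
rewrite Rmult_1_r.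
assert (eps * (m * m * m) / 2 <= eps * (m * m * Cmod (z + h)%C)).
{ replace (eps * (m * m * m) / 2) with (eps * (m * m) * (m / 2)) by lra.
  replace (eps * (m * m * Cmod (z + h)%C)) with (eps * (m * m) * Cmod (z + h)%C) by ring.
  apply Rmult_le_compat_l; [nra|exact Hb]. }
nra.
Qed.

Lemma Cd_inv (f : C -> C) (z a : C) :
  Cd f z a -> f z <> 0%C -> Cd (fun y => / f y)%C z (- a / (f z * f z))%C.
Proof.
intros H H0; eapply Cd_eq; [apply (Cd_comp Cinv f); [apply Cd_Cinv; exact H0|exact H]|].
field; exact H0.
Qed.

Lemma Cd_div (f g : C -> C) (z a b : C) :
  Cd f z a -> Cd g z b -> g z <> 0%C ->
  Cd (fun y => f y / g y)%C z ((a * g z - f z * b) / (g z * g z))%C.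
Proof.
intros Hf Hg H0; eapply Cd_eq; [apply (Cd_mult f (fun y => / g y)%C); [exact Hf|apply Cd_inv;
  [exact Hg|exact H0]]|].
field; exact H0.
Qed.

Lemma Cd_unique (f : C -> C) (z a b : C) : Cd f z a -> Cd f z b -> a = b.
Proof.
intros Ha Hb; rewrite <- (is_C_derive_unique f z a Ha); exact (is_C_derive_unique f z b Hb).
Qed.

Lemma Cd_C_derive (f : C -> C) (z : C) :
  ex_derive (K := C_AbsRing) (V := C_NormedModule) f z -> Cd f z (C_derive f z).
Proof. intros H; exact (C_derive_correct f z z H). Qed.

Lemma Cd_ex (f : C -> C) (z l : C) :
  Cd f z l -> ex_derive (K := C_AbsRing) (V := C_NormedModule) f z.
Proof. intros H; exists l; exact H. Qed.

(** * The complex exponential *)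

Lemma Cexp_plus (a b : C) : Cexp (a + b)%C = (Cexp a * Cexp b)%C.
Proof.
destruct a as [a1 a2], b as [b1 b2]; unfold Cexp, Cmult, Re, Im; simpl.
rewrite exp_plus, cos_plus, sin_plus; f_equal; ring.
Qed.

Lemma Cexp_0 : Cexp 0%C = 1%C.
Proof. unfold Cexp; simpl; rewrite exp_0, cos_0, sin_0; unfold RtoC; f_equal; ring. Qed.

Lemma Cexp_neq_0 (z : C) : Cexp z <> 0%C.
Proof.
intros H; assert (E := Cexp_plus z (- z)%C).
replace (z + - z)%C with (RtoC 0) in E by ring.
rewrite Cexp_0, H, Cmult_0_l in E. injection E as E; lra.
Qed.


Lemma Cmod_le_Re_Im (z : C) : Cmod z <= Rabs (Re z) + Rabs (Im z).
Proof.
assert (H1 := Rabs_pos (Re z)); assert (H2 := Rabs_pos (Im z)).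
apply Rsqr_incr_0_var; [|lra]; unfold Rsqr.
assert (E := Cmod2_alt z).
assert (E1 : Rabs (Re z) * Rabs (Re z) = Re z ^ 2) by (rewrite <- Rabs_mult, Rabs_pos_eq; nra).
assert (E2 : Rabs (Im z) * Rabs (Im z) = Im z ^ 2) by (rewrite <- Rabs_mult, Rabs_pos_eq; nra).
nra.
Qed.

Lemma derivable_pt_lim_0_small (f : R -> R) (l : R) : derivable_pt_lim f 0 l ->
  forall eps, 0 < eps -> exists d, 0 < d /\ forall x, Rabs x < d ->
    Rabs (f x - f 0 - l * x) <= eps * Rabs x.
Proof.
intros H eps He; destruct (H eps He) as [d Hd].
exists d; split; [apply cond_pos|]; intros x Hx.
destruct (Req_dec x 0) as [->|Hx0].
- replace (f 0 - f 0 - l * 0) with 0 by ring; rewrite Rabs_R0; lra.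
- specialize (Hd x Hx0 Hx); rewrite Rplus_0_l in Hd.
  replace (f x - f 0 - l * x) with (((f x - f 0) / x - l) * x) by (field; exact Hx0).
  rewrite Rabs_mult; apply Rmult_le_compat_r; [apply Rabs_pos|lra].
Qed.

Lemma Cd_Cexp_0 : Cd Cexp 0%C 1%C.
Proof.
rewrite Cd_iff; intros eps He.
(* The remainder splits into five pieces, bounded below by 1, 2, 1, 2 and 1 times e |h|. *)
set (e := Rmin 1 (eps / 7)).
assert (He0 : 0 < e) by (apply Rmin_glb_lt; lra).
assert (He1 : e <= 1) by apply Rmin_l.
assert (He2 : e <= eps / 7) by apply Rmin_r.
destruct (derivable_pt_lim_0_small exp (exp 0) (derivable_pt_lim_exp 0) e He0) as [d1 [Hd1 K1]].
destruct (derivable_pt_lim_0_small sin (cos 0) (derivable_pt_lim_sin 0) e He0) as [d2 [Hd2 K2]].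
destruct (derivable_pt_lim_0_small cos (- sin 0) (derivable_pt_lim_cos 0) e He0) as [d3 [Hd3 K3]].
rewrite exp_0 in K1; rewrite sin_0, cos_0 in K2; rewrite sin_0, cos_0 in K3.
exists (Rmin e (Rmin d1 (Rmin d2 d3))); split; [apply Rmin_glb_lt; [exact He0|repeat apply Rmin_glb_lt;
  assumption]|].
intros [x y] Hh.
assert (Hx : Rabs x <= Cmod (x, y)) by (eapply Rle_trans; [|apply Rmax_Cmod]; apply Rmax_l).
assert (Hy : Rabs y <= Cmod (x, y)) by (eapply Rle_trans; [|apply Rmax_Cmod]; apply Rmax_r).
assert (Q := Rlt_le_trans _ _ _ Hh (Rmin_l _ _)).
assert (Q' := Rlt_le_trans _ _ _ Hh (Rmin_r _ _)).
assert (Q1 := Rlt_le_trans _ _ _ Q' (Rmin_l _ _)).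
assert (Q'' := Rlt_le_trans _ _ _ Q' (Rmin_r _ _)).
assert (Q2 := Rlt_le_trans _ _ _ Q'' (Rmin_l _ _)).
assert (Q3 := Rlt_le_trans _ _ _ Q'' (Rmin_r _ _)).
specialize (K1 x ltac:(lra)); specialize (K2 y ltac:(lra)); specialize (K3 y ltac:(lra)).
rewrite Rmult_1_l in K1, K2.
replace (cos y - 1 - - 0 * y) with (cos y - 1) in K3 by ring. rewrite Rminus_0_r in K2.
set (m := Cmod (x, y)) in *.
replace (Cexp (0 + (x, y)) - Cexp 0 - 1 * (x, y))%C with
  ((exp x - 1 - x) * cos y + (1 + x) * (cos y - 1), (exp x - 1 - x) * sin y + x * sin y + (sin y - y)).
2:{ unfold Cexp, Cminus, Cplus, Cmult, Copp, Re, Im; simpl.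
    rewrite !Rplus_0_l, exp_0, cos_0, sin_0; f_equal; ring. }
eapply Rle_trans; [apply Cmod_le_Re_Im|]; unfold Re, Im; simpl fst; simpl snd.
assert (C1 := COS_bound y); assert (S1 := SIN_bound y).
assert (Hm : 0 <= m) by (eapply Rle_trans; [apply Rabs_pos|exact Hx]).
assert (Ec : Rabs (cos y) <= 1) by (apply Rabs_le; lra).
assert (Es : Rabs (sin y) <= 1) by (apply Rabs_le; lra).
assert (Es2 : Rabs (sin y) <= 2 * m).
{ replace (sin y) with ((sin y - y) + y) by ring. eapply Rle_trans; [apply Rabs_triang|]. nra. }
assert (A1 : Rabs ((exp x - 1 - x) * cos y) <= e * m).
{ rewrite Rabs_mult. apply Rle_trans with ((e * Rabs x) * 1).
  - apply Rmult_le_compat; try apply Rabs_pos; assumption.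
  - nra. }
assert (A2 : Rabs ((1 + x) * (cos y - 1)) <= 2 * (e * m)).
{ rewrite Rabs_mult. apply Rmult_le_compat; try apply Rabs_pos.
  - eapply Rle_trans; [apply Rabs_triang|]; rewrite Rabs_R1; lra.
  - nra. }
assert (A3 : Rabs ((exp x - 1 - x) * sin y) <= e * m).
{ rewrite Rabs_mult. apply Rle_trans with ((e * Rabs x) * 1).
  - apply Rmult_le_compat; try apply Rabs_pos; assumption.
  - nra. }
assert (A4 : Rabs (x * sin y) <= e * (2 * m)).
{ rewrite Rabs_mult. apply Rmult_le_compat; try apply Rabs_pos; lra. }
assert (A5 : Rabs (sin y - y) <= e * m) by nra.
assert (T1 := Rabs_triang ((exp x - 1 - x) * cos y) ((1 + x) * (cos y - 1))).
assert (T2 := Rabs_triang ((exp x - 1 - x) * sin y + x * sin y) (sin y - y)).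
assert (T3 := Rabs_triang ((exp x - 1 - x) * sin y) (x * sin y)).
apply Rle_trans with (7 * (e * m)); [lra|nra].
Qed.

Lemma Cd_Cexp (z : C) : Cd Cexp z (Cexp z).
Proof.
apply Cd_ext with (fun y => Cexp z * Cexp (y - z))%C.
{ intros y; rewrite <- Cexp_plus; f_equal; ring. }
eapply Cd_eq.
- apply Cd_scal, (Cd_comp Cexp (fun y => y - z)%C).
  + replace (z - z)%C with (RtoC 0) by ring; apply Cd_Cexp_0.
  + apply (Cd_minus (fun y => y) (fun _ => z)); [apply Cd_id|apply Cd_const].
- ring.
Qed.

(** * Integrals along segments *)

Notation CR := C_R_CompleteNormedModule.

Lemma RtoC_scal (r : R) (z : C) : @scal R_AbsRing CR r z = (RtoC r * z)%C.
Proof.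
destruct z as [a b]. unfold RtoC, Cmult; simpl.
apply injective_projections; simpl; unfold scal; simpl; unfold mult; simpl; ring.
Qed.

Ltac eqC := match goal with |- @eq _ ?x ?y => change (@eq C x y) end.

Lemma RtoC_m1 : RtoC (-1) = (- (1))%C.
Proof. apply injective_projections; simpl; ring. Qed.

Lemma norm_CR (z : C) : @norm R_AbsRing CR z = Cmod z.
Proof. symmetry; exact (Cmod_norm z). Qed.

(** Integrands over real intervals are written throughout as restrictions of functions of a complex
    variable. The complex rules of differentiation then supply both their continuity and their
    primitives. *)
Lemma Cd_curve (F : C -> C) (t : R) (l : C) :
  Cd F (RtoC t) l -> is_derive (K := R_AbsRing) (V := CR) (fun s : R => F (RtoC s)) t l.
Proof.
intros H; rewrite Cd_iff in H.
split; [apply (is_linear_scal_l (K := R_AbsRing) (V := CR))|].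
intros x Hx.
apply (@is_filter_lim_locally_unique R_AbsRing (AbsRing_NormedModule R_AbsRing)) in Hx; subst x.
intros eps; destruct (H eps (cond_pos eps)) as [d [Hd0 Hd]].
exists (mkposreal d Hd0).
change (forall y : R, Rabs (y - t) < d ->
    @norm R_AbsRing CR (((F (RtoC y) - F (RtoC t)) - @scal R_AbsRing CR (y - t)%R l)%C) <= eps * Rabs (y
      - t)).
intros y Hy; rewrite norm_CR, RtoC_scal.
specialize (Hd (RtoC (y - t))); rewrite Cmod_R in Hd; specialize (Hd Hy).
replace (RtoC t + RtoC (y - t))%C with (RtoC y) in Hd by (rewrite <- RtoC_plus; f_equal; ring).
replace ((F (RtoC y) - F (RtoC t)) - RtoC (y - t) * l)%C with (F (RtoC y) - F (RtoC t) - l * RtoC (y -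
  t))%C by ring.
exact Hd.
Qed.

Lemma Cd_curve_cont (F : C -> C) (t : R) (l : C) :
  Cd F (RtoC t) l -> continuous (U := CR) (fun s : R => F (RtoC s)) t.
Proof.
intros H; apply (ex_derive_continuous (K := R_AbsRing) (V := CR)).
exists l; apply Cd_curve; exact H.
Qed.

Lemma Cint_ex (g : C -> C) (a b : R) : a <= b ->
  (forall t, a <= t <= b -> exists l, Cd g (RtoC t) l) ->
  ex_RInt (V := CR) (fun t : R => g (RtoC t)) a b.
Proof.
intros Hab H; apply (ex_RInt_continuous (V := CR)); intros t Ht.
rewrite Rmin_left, Rmax_right in Ht by exact Hab.
destruct (H t Ht) as [l Hl]; exact (Cd_curve_cont g t l Hl).
Qed.

Lemma Cint_FTC (F g : C -> C) (a b : R) : a <= b ->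
  (forall t, a <= t <= b -> Cd F (RtoC t) (g (RtoC t))) ->
  (forall t, a <= t <= b -> exists l, Cd g (RtoC t) l) ->
  is_RInt (V := CR) (fun t : R => g (RtoC t)) a b (F (RtoC b) - F (RtoC a))%C.
Proof.
intros Hab HF Hg.
apply (is_RInt_derive (V := CR) (fun t => F (RtoC t))); rewrite Rmin_left, Rmax_right by exact Hab;
  intros t Ht.
- apply Cd_curve, HF, Ht.
- destruct (Hg t Ht) as [l Hl]; exact (Cd_curve_cont g t l Hl).
Qed.

Lemma Cint_bound (f : R -> C) (a b M : R) (l : C) : a <= b ->
  (forall t, a <= t <= b -> Cmod (f t) <= M) ->
  is_RInt (V := CR) f a b l -> Cmod l <= (b - a) * M.
Proof.
intros Hab HM Hl; rewrite <- norm_CR; apply (norm_RInt_le_const (V := CR) f a b l M Hab); [|exact Hl].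
intros t Ht; rewrite norm_CR; exact (HM t Ht).
Qed.

Lemma Cint_minus (f g : R -> C) (a b : R) (lf lg : C) :
  is_RInt (V := CR) f a b lf -> is_RInt (V := CR) g a b lg ->
  is_RInt (V := CR) (fun t => f t - g t)%C a b (lf - lg)%C.
Proof. exact (is_RInt_minus (V := CR) f g a b lf lg). Qed.

(** The factor is complex while the integral is linear over the reals, so the product is integrated
    componentwise. *)
Lemma Cint_scal (f : R -> C) (a b : R) (c l : C) :
  is_RInt (V := CR) f a b l -> is_RInt (V := CR) (fun t => c * f t)%C a b (c * l)%C.
Proof.
intros H.
assert (H1 := is_RInt_fct_extend_fst (U := R_NormedModule) (V := R_NormedModule) f a b l H).
assert (H2 := is_RInt_fct_extend_snd (U := R_NormedModule) (V := R_NormedModule) f a b l H).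
apply (is_RInt_fct_extend_pair (U := R_NormedModule) (V := R_NormedModule)).
- exact (is_RInt_minus (V := R_NormedModule) _ _ a b _ _ (is_RInt_scal (V := R_NormedModule) _ a b (fst
    c) _ H1)
    (is_RInt_scal (V := R_NormedModule) _ a b (snd c) _ H2)).
- exact (is_RInt_plus (V := R_NormedModule) _ _ a b _ _ (is_RInt_scal (V := R_NormedModule) _ a b (fst c)
    _ H2)
    (is_RInt_scal (V := R_NormedModule) _ a b (snd c) _ H1)).
Qed.

Definition seg (p q s : C) : C := (p + s * (q - p))%C.

Definition seg_int (f : C -> C) (p q : C) : C :=
  RInt (V := CR) (fun t : R => f (seg p q (RtoC t)) * (q - p))%C 0 1.

Lemma Cd_seg (p q s : C) : Cd (seg p q) s (q - p)%C.
Proof.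
eapply Cd_eq; [apply (Cd_plus (fun _ => p)); [apply Cd_const|]|].
- apply (Cd_mult (fun s => s) (fun _ => (q - p)%C)); [apply Cd_id|apply Cd_const].
- cbv beta; ring.
Qed.

Lemma seg_Cmod_le (p q : C) (t m : R) :
  0 <= t <= 1 -> Cmod p <= m -> Cmod q <= m -> Cmod (seg p q (RtoC t)) <= m.
Proof.
intros Ht Hp Hq; unfold seg.
replace (p + t * (q - p))%C with (RtoC (1 - t) * p + RtoC t * q)%C
  by (rewrite RtoC_minus; ring).
eapply Rle_trans; [apply Cmod_triangle|].
rewrite !Cmod_mult, !Cmod_R, !Rabs_pos_eq by lra; nra.
Qed.

Lemma seg_in_disc (p q : C) (t : R) :
  0 <= t <= 1 -> in_disc p -> in_disc q -> in_disc (seg p q (RtoC t)).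
Proof.
unfold in_disc; intros Ht Hp Hq.
apply Rle_lt_trans with (Rmax (Cmod p) (Cmod q)).
- apply seg_Cmod_le; [exact Ht|apply Rmax_l|apply Rmax_r].
- apply Rmax_lub_lt; assumption.
Qed.

Lemma analytic_Cd (f : C -> C) (z : C) : analytic f -> in_disc z -> exists l, Cd f z l.
Proof. intros H Hz; destruct (H z Hz) as [l Hl]; exists l; exact Hl. Qed.

Lemma Cd_seg_integrand (f : C -> C) (p q : C) (t : R) :
  analytic f -> in_disc p -> in_disc q -> 0 <= t <= 1 ->
  exists l, Cd (fun s => f (seg p q s) * (q - p))%C (RtoC t) l.
Proof.
intros Hf Hp Hq Ht.
destruct (analytic_Cd f _ Hf (seg_in_disc p q t Ht Hp Hq)) as [l Hl].
eexists; apply (Cd_mult (fun s => f (seg p q s)) (fun _ => (q - p)%C)).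
- apply (Cd_comp f (seg p q)); [exact Hl|apply Cd_seg].
- apply Cd_const.
Qed.

Lemma seg_int_correct (f : C -> C) (p q : C) :
  analytic f -> in_disc p -> in_disc q ->
  is_RInt (V := CR) (fun t : R => f (seg p q (RtoC t)) * (q - p))%C 0 1 (seg_int f p q).
Proof.
intros Hf Hp Hq; apply (RInt_correct (V := CR)).
apply (Cint_ex (fun s => f (seg p q s) * (q - p))%C); [lra|].
intros t Ht; apply Cd_seg_integrand; assumption.
Qed.

Lemma seg_int_FTC (F f : C -> C) (p q : C) :
  analytic f -> in_disc p -> in_disc q ->
  (forall z, in_disc z -> Cd F z (f z)) -> seg_int f p q = (F q - F p)%C.
Proof.
intros Hf Hp Hq HF; apply (is_RInt_unique (V := CR)).
replace (F q - F p)%C with (F (seg p q (RtoC 1)) - F (seg p q (RtoC 0)))%C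
  by (unfold seg; f_equal; [f_equal; ring | do 2 f_equal; ring]).
apply (Cint_FTC (fun s => F (seg p q s)) (fun s => f (seg p q s) * (q - p))%C); [lra| |].
- intros t Ht; apply (Cd_comp F (seg p q)); [|apply Cd_seg].
  apply HF, seg_in_disc; assumption.
- intros t Ht; apply Cd_seg_integrand; assumption.
Qed.

Lemma seg_int_bound (f : C -> C) (p q : C) (M : R) :
  analytic f -> in_disc p -> in_disc q ->
  (forall t, 0 <= t <= 1 -> Cmod (f (seg p q (RtoC t))) <= M) ->
  Cmod (seg_int f p q) <= M * Cmod (q - p)%C.
Proof.
intros Hf Hp Hq HM.
replace (M * Cmod (q - p)%C) with ((1 - 0) * (M * Cmod (q - p)%C)) by ring.
eapply Cint_bound; [lra| |apply seg_int_correct; eassumption].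
intros t Ht; cbv beta; rewrite Cmod_mult.
apply Rmult_le_compat_r; [apply Cmod_ge_0|apply HM, Ht].
Qed.

Lemma seg_int_minus (f g : C -> C) (p q : C) :
  analytic f -> analytic g -> in_disc p -> in_disc q ->
  seg_int (fun z => f z - g z)%C p q = (seg_int f p q - seg_int g p q)%C.
Proof.
intros Hf Hg Hp Hq; apply (is_RInt_unique (V := CR)).
apply (is_RInt_ext (V := CR) (fun t : R => f (seg p q (RtoC t)) * (q - p) - g (seg p q (RtoC t)) * (q -
  p))%C).
- intros t _; eqC; ring.
- apply Cint_minus; apply seg_int_correct; assumption.
Qed.

Lemma seg_int_rev (f : C -> C) (p q : C) :
  analytic f -> in_disc p -> in_disc q -> seg_int f q p = (- seg_int f p q)%C.
Proof.
intros Hf Hp Hq; apply (is_RInt_unique (V := CR)).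
assert (H := seg_int_correct f p q Hf Hp Hq).
apply (is_RInt_swap (V := CR)) in H.
apply (is_RInt_ext (V := CR) (fun t : R => @scal R_AbsRing CR (-1) (f (seg p q (RtoC (-1 * t + 1))) * (q
  - p))%C)).
- intros t _; rewrite RtoC_scal; eqC.
  replace (seg p q (RtoC (-1 * t + 1))) with (seg q p (RtoC t))
    by (unfold seg; rewrite RtoC_plus, RtoC_mult, RtoC_m1; ring).
  rewrite RtoC_m1; ring.
- apply (is_RInt_comp_lin (V := CR) (fun t : R => f (seg p q (RtoC t)) * (q - p))%C (-1) 1).
  replace (-1 * 0 + 1) with 1 by ring; replace (-1 * 1 + 1) with 0 by ring. exact H.
Qed.

Definition mid (p q : C) : C := ((p + q) / RtoC 2)%C.

Lemma RtoC_2_neq : RtoC 2 <> 0%C.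
Proof. intros H; injection H; lra. Qed.

Lemma mid_Cmod_le (p q : C) (m : R) : Cmod p <= m -> Cmod q <= m -> Cmod (mid p q) <= m.
Proof.
intros Hp Hq; replace (mid p q) with (seg p q (RtoC (1 / 2))).
- apply seg_Cmod_le; [lra|assumption..].
- unfold seg, mid; rewrite RtoC_div by lra; field; exact RtoC_2_neq.
Qed.

Lemma mid_in_disc (p q : C) : in_disc p -> in_disc q -> in_disc (mid p q).
Proof.
unfold in_disc; intros Hp Hq.
apply Rle_lt_trans with (Rmax (Cmod p) (Cmod q)).
- apply mid_Cmod_le; [apply Rmax_l|apply Rmax_r].
- apply Rmax_lub_lt; assumption.
Qed.

Lemma seg_int_mid (f : C -> C) (p q : C) :
  analytic f -> in_disc p -> in_disc q ->
  seg_int f p q = (seg_int f p (mid p q) + seg_int f (mid p q) q)%C.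
Proof.
intros Hf Hp Hq; assert (Hm := mid_in_disc p q Hp Hq).
set (g := fun t : R => (f (seg p q (RtoC t)) * (q - p))%C).
assert (Hg : forall a b, 0 <= a -> a <= b -> b <= 1 -> ex_RInt (V := CR) g a b).
{ intros a b Ha Hab Hb. apply (Cint_ex (fun s => f (seg p q s) * (q - p))%C); [exact Hab|].
  intros t Ht; apply Cd_seg_integrand; try assumption; lra. }
assert (H2 := RtoC_2_neq).
assert (E1 : seg_int f p (mid p q) = RInt (V := CR) g 0 (1 / 2)).
{ transitivity (RInt (V := CR) g (1 / 2 * 0 + 0) (1 / 2 * 1 + 0)); [|f_equal; lra].
  rewrite <- (RInt_comp_lin (V := CR)).
  - apply (RInt_ext (V := CR)); intros t _; rewrite RtoC_scal; unfold g; eqC.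
    replace (seg p (mid p q) (RtoC t)) with (seg p q (RtoC (1 / 2 * t + 0))).
    + rewrite RtoC_div by lra. unfold mid; field; exact H2.
    + unfold seg, mid. rewrite RtoC_plus, RtoC_mult, RtoC_div by lra. field; exact H2.
  - apply Hg; lra. }
assert (E2 : seg_int f (mid p q) q = RInt (V := CR) g (1 / 2) 1).
{ transitivity (RInt (V := CR) g (1 / 2 * 0 + 1 / 2) (1 / 2 * 1 + 1 / 2)); [|f_equal; lra].
  rewrite <- (RInt_comp_lin (V := CR)).
  - apply (RInt_ext (V := CR)); intros t _; rewrite RtoC_scal; unfold g; eqC.
    replace (seg (mid p q) q (RtoC t)) with (seg p q (RtoC (1 / 2 * t + 1 / 2))).
    + rewrite RtoC_div by lra. unfold mid; field; exact H2.
    + unfold seg, mid. rewrite RtoC_plus, RtoC_mult, RtoC_div by lra. field; exact H2.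
  - apply Hg; lra. }
rewrite E1, E2; symmetry; apply (RInt_Chasles (V := CR)); apply Hg; lra.
Qed.

(** * Goursat's theorem *)

(** The intervals of radius 2 D / 2^n around x n are nested, since the increment D / 2^n is exactly
    the loss of radius from n to n + 1. The supremum of their left ends lies in all of them. *)
Lemma geometric_increments_limit (x : nat -> R) (D : R) :
  (forall n, Rabs (x (S n) - x n) <= D / 2 ^ n) ->
  exists l, forall n, Rabs (x n - l) <= 2 * D / 2 ^ n.
Proof.
intros H.
assert (P : forall n, 0 < 2 ^ n) by (intros n; apply pow_lt; lra).
assert (HS : forall n, D / 2 ^ n = 2 * (D / 2 ^ S n)).
{ intros n; simpl; field; apply Rgt_not_eq, P. }
assert (HS2 : forall n, 2 * D / 2 ^ n = 2 * (D / 2 ^ n)) by (intros n; unfold Rdiv; ring).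
assert (D0 : forall n, 0 <= D / 2 ^ n) by (intros n; eapply Rle_trans; [apply Rabs_pos|apply H]).
set (u := fun n => x n - 2 * (D / 2 ^ n)).
set (v := fun n => x n + 2 * (D / 2 ^ n)).
assert (Hu : forall n k, u n <= u (n + k)%nat).
{ intros n k; induction k as [|k IH]; [rewrite Nat.add_0_r; lra|].
  rewrite Nat.add_succ_r; eapply Rle_trans; [exact IH|]. unfold u.
  assert (T := H (n + k)%nat); assert (T2 := HS (n + k)%nat); apply Rabs_le_between in T; lra. }
assert (Hv : forall n k, v (n + k)%nat <= v n).
{ intros n k; induction k as [|k IH]; [rewrite Nat.add_0_r; lra|].
  rewrite Nat.add_succ_r; eapply Rle_trans; [|exact IH]. unfold v.
  assert (T := H (n + k)%nat); assert (T2 := HS (n + k)%nat); apply Rabs_le_between in T; lra. }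
assert (Huv : forall n m, u n <= v m).
{ intros n m. apply Rle_trans with (u (n + m)%nat); [apply Hu|].
  apply Rle_trans with (v (m + n)%nat); [|apply Hv].
  rewrite (Nat.add_comm m n); unfold u, v; assert (T := D0 (n + m)%nat); lra. }
destruct (completeness (fun y => exists n, y = u n)) as [l [Hl1 Hl2]].
- exists (v O); intros y [n ->]; apply Huv.
- exists (u O); exists O; reflexivity.
- exists l; intros n; rewrite HS2; apply Rabs_le_between.
  assert (u n <= l) by (apply Hl1; exists n; reflexivity).
  assert (l <= v n) by (apply Hl2; intros y [m ->]; apply Huv).
  unfold u, v in *; lra.
Qed.

Lemma Im_le_Cmod (z : C) : Rabs (Im z) <= Cmod z.
Proof. eapply Rle_trans; [apply Rmax_r|apply Rmax_Cmod]. Qed.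

Lemma geometric_increments_limit_C (a : nat -> C) (D : R) :
  (forall n, Cmod (a (S n) - a n)%C <= D / 2 ^ n) ->
  exists p, forall n, Cmod (a n - p)%C <= 4 * D / 2 ^ n.
Proof.
intros H.
destruct (geometric_increments_limit (fun n => Re (a n)) D) as [x Hx].
{ intros n; eapply Rle_trans; [|apply H]; apply (re_le_Cmod (a (S n) - a n)%C). }
destruct (geometric_increments_limit (fun n => Im (a n)) D) as [y Hy].
{ intros n; eapply Rle_trans; [|apply H]; apply (Im_le_Cmod (a (S n) - a n)%C). }
exists (x, y); intros n; eapply Rle_trans; [apply Cmod_le_Re_Im|].
specialize (Hx n); specialize (Hy n).
change (Rabs (Re (a n) - x) + Rabs (Im (a n) - y) <= 4 * D / 2 ^ n).
replace (4 * D / 2 ^ n) with (2 * D / 2 ^ n + 2 * D / 2 ^ n) by (unfold Rdiv; ring); lra.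
Qed.

Definition triangle : Type := (C * C * C)%type.

Definition tri_int (f : C -> C) (T : triangle) : C :=
  let '(a, b, c) := T in (seg_int f a b + seg_int f b c + seg_int f c a)%C.

(** A closed bound m < 1, rather than membership in the open disc, survives the limit of nested
    triangles and keeps the limit point inside the disc. *)
Definition tri_in (m : R) (T : triangle) : Prop :=
  let '(a, b, c) := T in Cmod a <= m /\ Cmod b <= m /\ Cmod c <= m.

Definition tri_diam (D : R) (T : triangle) : Prop :=
  let '(a, b, c) := T in Cmod (b - a)%C <= D /\ Cmod (c - b)%C <= D /\ Cmod (a - c)%C <= D.

Definition vertex (T : triangle) : C := fst (fst T).

(** Joining the midpoints gives four triangles whose inner sides are traversed twice in opposite
    directions, so the four integrals add up to the original one and one of them has at least a
    quarter of its modulus. The displacement of the first vertex is recorded to make the vertices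
    converge. *)
Lemma tri_bisect (f : C -> C) (m D : R) (T : triangle) :
  analytic f -> m < 1 -> tri_in m T -> tri_diam D T ->
  exists T', tri_in m T' /\ tri_diam (D / 2) T' /\ Cmod (vertex T' - vertex T)%C <= D /\
    Cmod (tri_int f T) <= 4 * Cmod (tri_int f T').
Proof.
destruct T as [[a b] c]; intros Hf Hm [Ha [Hb Hc]] [H1 [H2 H3]].
assert (I : forall z, Cmod z <= m -> in_disc z) by (intros z Hz; unfold in_disc; lra).
set (p := mid a b); set (q := mid b c); set (r := mid c a).
assert (Hp := mid_Cmod_le a b m Ha Hb); assert (Hq := mid_Cmod_le b c m Hb Hc);
assert (Hr := mid_Cmod_le c a m Hc Ha); fold p q r in Hp, Hq, Hr.
assert (Hh : forall x, Cmod x <= D -> Cmod (x / RtoC 2)%C <= D / 2).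
{ intros x Hx; rewrite Cmod_div by exact RtoC_2_neq. rewrite Cmod_R, Rabs_pos_eq by lra. lra. }
assert (Hh' : forall x y, Cmod x <= D -> y = (x / RtoC 2)%C \/ y = (- (x / RtoC 2))%C -> Cmod y <= D / 2).
{ intros x y Hx [-> | ->]; [|rewrite Cmod_opp]; apply Hh, Hx. }
assert (n2 := RtoC_2_neq).
assert (D0 : 0 <= D) by (eapply Rle_trans; [apply Cmod_ge_0|exact H1]).
assert (E : tri_int f (a, b, c) =
  (tri_int f (a, p, r) + tri_int f (p, b, q) + tri_int f (r, q, c) + tri_int f (p, q, r))%C).
{ unfold tri_int.
  rewrite (seg_int_mid f a b), (seg_int_mid f b c), (seg_int_mid f c a) by auto.
  fold p q r.
  rewrite (seg_int_rev f p r), (seg_int_rev f q p), (seg_int_rev f r q) by auto; ring. }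
assert (X : forall T', Cmod (tri_int f (a, b, c)) <= 4 * Cmod (tri_int f T') -> tri_in m T' ->
  tri_diam (D / 2) T' ->
  Cmod (vertex T' - vertex (a, b, c))%C <= D -> exists T',
    tri_in m T' /\ tri_diam (D / 2) T' /\ Cmod (vertex T' - vertex (a, b, c))%C <= D /\
    Cmod (tri_int f (a, b, c)) <= 4 * Cmod (tri_int f T')).
{ intros T'; exists T'; auto. }
assert (S : Cmod (tri_int f (a, b, c)) <= Cmod (tri_int f (a, p, r)) + Cmod (tri_int f (p, b,
  q)) + Cmod (tri_int f (r, q, c)) + Cmod (tri_int f (p, q, r))).
{ rewrite E; do 2 (eapply Rle_trans; [apply Cmod_triangle|apply Rplus_le_compat_r]); apply Cmod_triangle. }
assert (V0 : Cmod (a - a)%C <= D) by (replace (a - a)%C with (RtoC 0) by ring; rewrite Cmod_0; exact D0).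
assert (Vp : Cmod (p - a)%C <= D).
{ apply Rle_trans with (D / 2); [|lra]; apply (Hh' _ _ H1); left; unfold p, mid; field; exact n2. }
assert (Vr : Cmod (r - a)%C <= D).
{ apply Rle_trans with (D / 2); [|lra]; apply (Hh' _ _ H3); right; unfold r, mid; field; exact n2. }
assert (tri_diam (D / 2) (a, p, r)).
{ split; [|split]; [apply (Hh' _ _ H1)|apply (Hh' _ _ H2)|apply (Hh' _ _ H3)]; [left|left|left];
    unfold p, q, r, mid; field; exact n2. }
assert (tri_diam (D / 2) (p, b, q)).
{ split; [|split]; [apply (Hh' _ _ H1)|apply (Hh' _ _ H2)|apply (Hh' _ _ H3)]; [left|left|left];
    unfold p, q, r, mid; field; exact n2. }
assert (tri_diam (D / 2) (r, q, c)).
{ split; [|split]; [apply (Hh' _ _ H1)|apply (Hh' _ _ H2)|apply (Hh' _ _ H3)]; [left|left|left];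
    unfold p, q, r, mid; field; exact n2. }
assert (tri_diam (D / 2) (p, q, r)).
{ split; [|split]; [apply (Hh' _ _ H3)|apply (Hh' _ _ H1)|apply (Hh' _ _ H2)]; [right|right|right];
    unfold p, q, r, mid; field; exact n2. }
destruct (Rle_dec (Cmod (tri_int f (a, b, c))) (4 * Cmod (tri_int f (a, p, r)))) as [L|L1];
  [apply (X _ L); simpl; auto|].
destruct (Rle_dec (Cmod (tri_int f (a, b, c))) (4 * Cmod (tri_int f (p, b, q)))) as [L|L2];
  [apply (X _ L); simpl; auto|].
destruct (Rle_dec (Cmod (tri_int f (a, b, c))) (4 * Cmod (tri_int f (r, q, c)))) as [L|L3];
  [apply (X _ L); simpl; auto|].
apply (X (p, q, r)); [lra|simpl; auto..].
Qed.

Lemma analytic_affine (u v : C) : analytic (fun z => u + v * z)%C.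
Proof.
intros z _; eapply Cd_ex.
apply (Cd_plus (fun _ => u)); [apply Cd_const|apply Cd_scal, Cd_id].
Qed.

Lemma tri_int_affine (u v : C) (m : R) (T : triangle) :
  m < 1 -> tri_in m T -> tri_int (fun z => u + v * z)%C T = 0%C.
Proof.
destruct T as [[a b] c]; intros Hm [Ha [Hb Hc]].
assert (I : forall z, Cmod z <= m -> in_disc z) by (intros z Hz; unfold in_disc; lra).
assert (n2 := RtoC_2_neq).
set (F := fun z => (u * z + v / RtoC 2 * (z * z))%C).
assert (HF : forall z, in_disc z -> Cd F z (u + v * z)%C).
{ intros z _; unfold F; eapply Cd_eq.
  - apply Cd_plus; [apply Cd_scal, Cd_id|].
    apply Cd_scal; apply (Cd_mult (fun z => z) (fun z => z)); apply Cd_id.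
  - field; exact n2. }
unfold tri_int.
rewrite !(seg_int_FTC F) by (auto using analytic_affine).
ring.
Qed.

Lemma tri_int_minus (f g : C -> C) (m : R) (T : triangle) :
  analytic f -> analytic g -> m < 1 -> tri_in m T ->
  tri_int (fun z => f z - g z)%C T = (tri_int f T - tri_int g T)%C.
Proof.
destruct T as [[a b] c]; intros Hf Hg Hm [Ha [Hb Hc]].
assert (I : forall z, Cmod z <= m -> in_disc z) by (intros z Hz; unfold in_disc; lra).
unfold tri_int; rewrite !seg_int_minus by auto; ring.
Qed.

Lemma analytic_minus (f g : C -> C) : analytic f -> analytic g -> analytic (fun z => f z - g z)%C.
Proof.
intros Hf Hg z Hz; destruct (Hf z Hz) as [a Ha], (Hg z Hz) as [b Hb].
eapply Cd_ex, Cd_minus; eassumption.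
Qed.

Lemma seg_dist (a x y : C) (t M : R) : 0 <= t <= 1 ->
  Cmod (x - a)%C <= M -> Cmod (y - a)%C <= M -> Cmod (seg x y (RtoC t) - a)%C <= M.
Proof.
intros Ht Hx Hy.
replace (seg x y (RtoC t) - a)%C with (seg (x - a) (y - a) (RtoC t)) by (unfold seg; ring).
apply seg_Cmod_le; assumption.
Qed.

(** The affine part of [f] at [p] has a primitive and integrates to zero, so only the remainder
    counts, along three sides of length at most [D]. *)
Lemma tri_int_local (f : C -> C) (m D eps : R) (p l : C) (T : triangle) :
  analytic f -> m < 1 -> tri_in m T -> tri_diam D T -> 0 <= eps -> 
  (forall z, Cmod (z - vertex T)%C <= D -> Cmod (f z - f p - l * (z - p))%C <= eps) ->
  Cmod (tri_int f T) <= 3 * (eps * D).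
Proof.
intros Hf Hm HT HD He H.
set (u := (f p - l * p)%C).
assert (E : tri_int f T = tri_int (fun z => f z - (u + l * z))%C T).
{ rewrite (tri_int_minus f (fun z => u + l * z)%C m) by (auto using analytic_affine).
  rewrite (tri_int_affine u l m) by auto; ring. }
rewrite E; clear E.
assert (A : analytic (fun z => f z - (u + l * z))%C).
{ apply analytic_minus; [exact Hf|apply analytic_affine]. }
destruct T as [[a b] c]; destruct HT as [Ha [Hb Hc]], HD as [H1 [H2 H3]].
assert (I : forall z, Cmod z <= m -> in_disc z) by (intros z Hz; unfold in_disc; lra).
assert (D0 : 0 <= D) by (eapply Rle_trans; [apply Cmod_ge_0|exact H1]).
unfold vertex in H; simpl in H.
assert (K : forall x y, Cmod x <= m -> Cmod y <= m -> Cmod (x - a)%C <= D -> Cmod (y - a)%C <= D ->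
  Cmod (y - x)%C <= D ->
  Cmod (seg_int (fun z => f z - (u + l * z))%C x y) <= eps * D).
{ intros x y Hx Hy Hxa Hya Hxy.
  apply Rle_trans with (eps * Cmod (y - x)%C); [|apply Rmult_le_compat_l; assumption].
  apply seg_int_bound; auto.
  intros t Ht.
  replace (f (seg x y (RtoC t)) - (u + l * seg x y (RtoC t)))%C with
    (f (seg x y (RtoC t)) - f p - l * (seg x y (RtoC t) - p))%C by (unfold u; ring).
  apply H, seg_dist; assumption. }
assert (V0 : Cmod (a - a)%C <= D) by (replace (a - a)%C with (RtoC 0) by ring; rewrite Cmod_0; exact D0).
assert (V1 : Cmod (c - a)%C <= D) by (rewrite Cmod_minus_sym; exact H3).
unfold tri_int.
eapply Rle_trans; [apply Cmod_triangle|].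
eapply Rle_trans; [apply Rplus_le_compat_r, Cmod_triangle|].
assert (K1 := K a b); assert (K2 := K b c); assert (K3 := K c a).
specialize (K1 Ha Hb V0 H1 H1); specialize (K2 Hb Hc H1 V1 H2); specialize (K3 Hc Ha V1 V0 H3).
lra.
Qed.

(** A state pairs a triangle with a bound on its sides. The invariant is a premise, so that every
    state has a successor, as dependent choice requires. *)
Definition bisect_spec (f : C -> C) (m : R) (s s' : triangle * R) : Prop :=
  tri_in m (fst s) /\ tri_diam (snd s) (fst s) ->
  tri_in m (fst s') /\ tri_diam (snd s') (fst s') /\ snd s' = snd s / 2 /\
    Cmod (vertex (fst s') - vertex (fst s))%C <= snd s /\
    Cmod (tri_int f (fst s)) <= 4 * Cmod (tri_int f (fst s')).

Theorem goursat (f : C -> C) (a b c : C) :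
  analytic f -> in_disc a -> in_disc b -> in_disc c -> tri_int f (a, b, c) = 0%C.
Proof.
intros Hf Ha Hb Hc.
set (m := Rmax (Cmod a) (Rmax (Cmod b) (Cmod c))).
assert (Hm : m < 1) by (repeat apply Rmax_lub_lt; assumption).
set (D := Rmax (Cmod (b - a)%C) (Rmax (Cmod (c - b)%C) (Cmod (a - c)%C))).
assert (T0in : tri_in m (a, b, c)).
{ split; [apply Rmax_l|]; split; (eapply Rle_trans; [|apply Rmax_r]); [apply Rmax_l|apply Rmax_r]. }
assert (T0d : tri_diam D (a, b, c)).
{ split; [apply Rmax_l|]; split; (eapply Rle_trans; [|apply Rmax_r]); [apply Rmax_l|apply Rmax_r]. }
assert (D0 : 0 <= D) by (eapply Rle_trans; [apply Cmod_ge_0|apply T0d]).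
assert (Hstep : forall s, exists s', bisect_spec f m s s').
{ intros [T d].
  destruct (classic (tri_in m T /\ tri_diam d T)) as [[H1 H2]|H].
  - destruct (tri_bisect f m d T Hf Hm H1 H2) as [T' [K1 [K2 [K3 K4]]]].
    exists (T', d / 2); intros _; auto.
  - exists (T, d); intros H'; elim H; exact H'. }
destruct (dependent_choice
  (fun s => constructive_indefinite_description _ (Hstep s)) ((a, b, c), D)) as [s [s0 Hs]].
assert (P : forall n, 0 < 2 ^ n) by (intros n; apply pow_lt; lra).
assert (Inv : forall n, tri_in m (fst (s n)) /\ tri_diam (snd (s n)) (fst (s n)) /\ snd (s n) = D / 2 ^ n).
{ induction n as [|n [I1 [I2 I3]]]; [rewrite s0; simpl; split; [exact T0in|split; [exact T0d|field]]|].
  destruct (Hs n (conj I1 I2)) as [J1 [J2 [J3 _]]].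
  split; [exact J1|split; [exact J2|]]. rewrite J3, I3; simpl; field. apply Rgt_not_eq, P. }
assert (Growth : forall n, Cmod (tri_int f (a, b, c)) <= 2 ^ n * 2 ^ n * Cmod (tri_int f (fst (s n)))).
{ induction n as [|n IH]; [rewrite s0; simpl fst; lra|].
  destruct (Inv n) as [I1 [I2 I3]]; destruct (Hs n (conj I1 I2)) as [_ [_ [_ [_ J]]]].
  eapply Rle_trans; [exact IH|].
  replace (2 ^ S n * 2 ^ S n * Cmod (tri_int f (fst (s (S n))))) with
    (2 ^ n * 2 ^ n * (4 * Cmod (tri_int f (fst (s (S n)))))) by (simpl; ring).
  apply Rmult_le_compat_l; [assert (T := P n); nra|exact J]. }
destruct (geometric_increments_limit_C (fun n => vertex (fst (s n))) D) as [p Hp].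
{ intros n; destruct (Inv n) as [I1 [I2 I3]]; destruct (Hs n (conj I1 I2)) as [_ [_ [_ [J _]]]].
  rewrite <- I3; exact J. }
(* The factor 5 is 1 + 4: a point near the n-th triangle is within D / 2^n of its first vertex,
   which is within 4 D / 2^n of the limit [p]. *)
assert (Small : forall eta, 0 < eta -> exists n, 5 * D / 2 ^ n < eta).
{ intros eta Heta.
  destruct (pow_lt_1_zero (/ 2)) with (y := eta / (5 * D + 1)) as [N HN].
  { rewrite Rabs_pos_eq; lra. }
  { apply Rdiv_lt_0_compat; lra. }
  exists N; specialize (HN N (le_n N)).
  rewrite Rabs_pos_eq in HN by (apply pow_le; lra).
  rewrite pow_inv in HN.
  apply (Rmult_lt_compat_r (5 * D + 1)) in HN; [|lra].
  unfold Rdiv in HN at 1; rewrite Rmult_assoc, Rinv_l, Rmult_1_r in HN by lra.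
  assert (0 < / 2 ^ N) by (apply Rinv_0_lt_compat, P). unfold Rdiv; nra. }
assert (Hpm : Cmod p <= m).
{ apply le_epsilon; intros eta Heta; destruct (Small eta Heta) as [n Hn].
  destruct (Inv n) as [I1 _]. specialize (Hp n); cbv beta in Hp.
  destruct (s n) as [[[x y] z] d]; simpl in *; destruct I1 as [I1 _]; unfold vertex in Hp; simpl in Hp.
  assert (T := Cmod_triangle' p x); rewrite Cmod_minus_sym in T.
  assert (0 <= D / 2 ^ n) by (apply Rdiv_le_0_compat; [exact D0|apply P]).
  unfold Rdiv in *; lra. }
assert (Hpd : in_disc p) by (unfold in_disc; lra).
destruct (analytic_Cd f p Hf Hpd) as [l Hl]; rewrite Cd_iff in Hl.
apply Cmod_eq_0, Rle_antisym; [|apply Cmod_ge_0].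
apply le_epsilon; intros eta Heta; rewrite Rplus_0_l.
(* The factor 4^n of [Growth] cancels the squared size D^2 / 4^n, leaving 3 sides times 5 eps
   D^2. *)
set (eps := eta / (15 * D * D + 1)).
assert (Heps : 0 < eps) by (apply Rdiv_lt_0_compat; nra).
destruct (Hl eps Heps) as [d [Hd Hloc]].
destruct (Small d Hd) as [n Hn].
destruct (Inv n) as [I1 [I2 I3]].
set (r := D / 2 ^ n) in *.
assert (Hr : 0 <= r) by (apply Rdiv_le_0_compat; [exact D0|apply P]).
assert (B : Cmod (tri_int f (fst (s n))) <= 3 * (eps * (5 * r) * r)).
{ rewrite I3 in I2. apply (tri_int_local f m r (eps * (5 * r)) p l); auto; [nra|].
  intros z Hz; specialize (Hp n); cbv beta in Hp.
  assert (Hzp : Cmod (z - p)%C <= 5 * r).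
  { replace (z - p)%C with ((z - vertex (fst (s n))) + (vertex (fst (s n)) - p))%C by ring.
    eapply Rle_trans; [apply Cmod_triangle|]. unfold r, Rdiv in *; lra. }
  specialize (Hloc (z - p)%C).
  replace (p + (z - p))%C with z in Hloc by ring.
  eapply Rle_trans; [apply Hloc|].
  - eapply Rle_lt_trans; [exact Hzp|]. unfold r, Rdiv in *; lra.
  - apply Rmult_le_compat_l; lra. }
eapply Rle_trans; [apply (Growth n)|].
assert (E : 2 ^ n * r = D) by (unfold r; field; apply Rgt_not_eq, P).
apply Rle_trans with (2 ^ n * 2 ^ n * (3 * (eps * (5 * r) * r))).
{ apply Rmult_le_compat_l; [assert (T := P n); nra|exact B]. }
replace (2 ^ n * 2 ^ n * (3 * (eps * (5 * r) * r))) with (eps * (15 * (2 ^ n * r) * (2 ^ n * r))) by ring.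
rewrite E.
assert (Q : eps * (15 * D * D + 1) = eta) by (unfold eps; field; nra).
nra.
Qed.

Lemma in_disc_0 : in_disc 0%C.
Proof. unfold in_disc; rewrite Cmod_0; lra. Qed.

(** On the triangle 0, z, z + h Goursat's theorem turns the increment of the integral from 0 into
    the integral over the short side, where [f] is close to [f z]. *)
Theorem primitive_exists (f : C -> C) :
  analytic f -> exists F, forall z, in_disc z -> Cd F z (f z).
Proof.
intros Hf; exists (seg_int f 0%C); intros z Hz; rewrite Cd_iff; intros eps He.
destruct (analytic_Cd f z Hf Hz) as [l Hl].
destruct (Cd_cont f z l Hl eps He) as [d [Hd Hc]].
unfold in_disc in Hz.
exists (Rmin d (1 - Cmod z)); split; [apply Rmin_glb_lt; lra|].
intros h Hh.
assert (H1 := Rlt_le_trans _ _ _ Hh (Rmin_l _ _)).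
assert (H2 := Rlt_le_trans _ _ _ Hh (Rmin_r _ _)).
assert (Hzh : in_disc (z + h)%C).
{ unfold in_disc; eapply Rle_lt_trans; [apply Cmod_triangle|]; lra. }
assert (H0 := in_disc_0).
assert (G := goursat f 0%C z (z + h)%C Hf H0 Hz Hzh); unfold tri_int in G.
rewrite (seg_int_rev f 0%C (z + h)%C) in G by assumption.
assert (E : (seg_int f 0 (z + h) - seg_int f 0 z - f z * h)%C =
  seg_int (fun y => f y - f z)%C z (z + h)%C).
{ assert (Aff : analytic (fun _ : C => f z)) by (intros y _; eapply Cd_ex, Cd_const).
  rewrite (seg_int_minus f (fun _ => f z)) by assumption.
  rewrite (seg_int_FTC (fun y => f z * y)%C (fun _ => f z)); try assumption.
  - transitivity (seg_int f z (z + h) - (seg_int f 0 z + seg_int f z (z + h) + - seg_int f 0 (z + h)) - f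
      z * h)%C; [|rewrite G; ring]; ring.
  - intros y _; eapply Cd_eq; [apply Cd_scal, Cd_id|ring]. }
rewrite E.
replace (eps * Cmod h) with (eps * Cmod (z + h - z)%C) by (do 2 f_equal; ring).
apply seg_int_bound; try assumption.
- apply analytic_minus; [exact Hf|intros y _; eapply Cd_ex, Cd_const].
- intros t Ht; left.
  replace (seg z (z + h) (RtoC t)) with (z + RtoC t * h)%C by (unfold seg; ring).
  apply Hc. rewrite Cmod_mult, Cmod_R, Rabs_pos_eq by lra.
  assert (0 <= Cmod h) by apply Cmod_ge_0. nra.
Qed.

(** * Cauchy integrals *)

Definition slope (F f : C -> C) (z y : C) : C :=
  if Ceq_dec y z then f z else ((F y - F z) / (y - z))%C.

Lemma slope_at (F f : C -> C) (z : C) : slope F f z z = f z.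
Proof. unfold slope; destruct (Ceq_dec z z) as [_|H]; [reflexivity|elim H; reflexivity]. Qed.

Lemma slope_neq (F f : C -> C) (z y : C) : y <> z -> slope F f z y = ((F y - F z) / (y - z))%C.
Proof. intros H; unfold slope; destruct (Ceq_dec y z); [contradiction|reflexivity]. Qed.

Lemma slope_mult (F f : C -> C) (z y : C) : (slope F f z y * (y - z) = F y - F z)%C.
Proof.
destruct (Ceq_dec y z) as [->|H]; [ring|].
rewrite slope_neq by exact H; field.
intros E; apply H. replace y with (y - z + z)%C by ring; rewrite E; ring.
Qed.

Lemma Cminus_neq_0 (x y : C) : x <> y -> (x - y)%C <> 0%C.
Proof. intros H E; apply H. replace x with (x - y + y)%C by ring; rewrite E; ring. Qed.

(** At [z] the derivative is half that of [f]: F (z + h) - F z - f z h - (l / 2) h^2 is the integral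
    over the segment from z to z + h of [f] minus its affine part, hence o(h^2). Elsewhere the
    quotient rule applies. The lemma is used again for w(y) / y with [w] a Schwarz function. *)
Lemma slope_analytic (F f : C -> C) (z : C) :
  analytic f -> in_disc z -> (forall y, in_disc y -> Cd F y (f y)) -> analytic (slope F f z).
Proof.
intros Hf Hz HF y Hy.
destruct (Ceq_dec y z) as [->|Hyz].
- destruct (analytic_Cd f z Hf Hz) as [l Hl].
  apply Cd_ex with (l / RtoC 2)%C; rewrite Cd_iff; intros eps He.
  assert (Hl' := Hl); rewrite Cd_iff in Hl'; destruct (Hl' eps He) as [d [Hd K]].
  unfold in_disc in Hz.
  exists (Rmin d (1 - Cmod z)); split; [apply Rmin_glb_lt; lra|].
  intros h Hh.
  assert (H1 := Rlt_le_trans _ _ _ Hh (Rmin_l _ _)).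
  assert (H2 := Rlt_le_trans _ _ _ Hh (Rmin_r _ _)).
  assert (Hh0 := Cmod_ge_0 h).
  destruct (Ceq_dec h (RtoC 0)) as [->|Hn].
  { replace (z + 0)%C with z by ring; rewrite !slope_at.
    replace (f z - f z - l / 2 * 0)%C with (RtoC 0) by ring; rewrite Cmod_0; lra. }
  assert (Hzh : in_disc (z + h)%C).
  { unfold in_disc; eapply Rle_lt_trans; [apply Cmod_triangle|]; lra. }
  assert (Hne : (z + h)%C <> z).
  { intros E; apply Hn. replace h with (z + h - z)%C by ring; rewrite E; ring. }
  rewrite slope_at, slope_neq by exact Hne.
  assert (n2 := RtoC_2_neq).
  assert (A1 := analytic_affine (f z - l * z)%C l).
  assert (E : (F (z + h) - F z - f z * h - l / 2 * (h * h))%C =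
    seg_int (fun y => f y - ((f z - l * z) + l * y))%C z (z + h)).
  { rewrite (seg_int_minus f (fun y => (f z - l * z) + l * y)%C); try assumption.
    rewrite (seg_int_FTC F f) by assumption.
    rewrite (seg_int_FTC (fun y => (f z - l * z) * y + l / RtoC 2 * (y * y))%C); try assumption.
    - field; exact n2.
    - intros x _; eapply Cd_eq.
      + apply Cd_plus; [apply Cd_scal, Cd_id|apply Cd_scal, (Cd_mult (fun x => x) (fun x => x));
          apply Cd_id].
      + field; exact n2. }
  replace ((F (z + h) - F z) / (z + h - z) - f z - l / 2 * h)%C with
    ((F (z + h) - F z - f z * h - l / 2 * (h * h)) / h)%C.
  2:{ field; repeat split; try exact n2; try exact Hn; replace (z + h - z)%C with h by ring; exact Hn. }
  assert (Hhp : 0 < Cmod h) by (apply Cmod_gt_0; exact Hn).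
  rewrite Cmod_div by exact Hn. apply Rmult_le_reg_r with (Cmod h); [exact Hhp|].
  unfold Rdiv; rewrite Rmult_assoc, Rinv_l, Rmult_1_r by lra.
  rewrite E.
  replace (eps * Cmod h * Cmod h) with (eps * Cmod h * Cmod (z + h - z)%C) by (do 2 f_equal; ring).
  apply seg_int_bound; try assumption.
  { apply analytic_minus; assumption. }
  intros t Ht.
  replace (seg z (z + h) (RtoC t)) with (z + RtoC t * h)%C by (unfold seg; ring).
  assert (Hth : Cmod (RtoC t * h)%C <= Cmod h).
  { rewrite Cmod_mult, Cmod_R, Rabs_pos_eq by lra. nra. }
  specialize (K (RtoC t * h)%C ltac:(lra)).
  replace (f (z + RtoC t * h) - (f z - l * z + l * (z + RtoC t * h)))%C with
    (f (z + RtoC t * h) - f z - l * (RtoC t * h))%C by ring.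
  eapply Rle_trans; [exact K|]. apply Rmult_le_compat_l; lra.
- assert (Hn := Cminus_neq_0 y z Hyz).
  eapply Cd_ex, Cd_ext_loc with (f := (fun x => (F x - F z) / (x - z))%C).
  + exists (Cmod (y - z)%C); split; [apply Cmod_gt_0; exact Hn|].
    intros x Hx; symmetry; apply slope_neq; intros ->.
    rewrite Cmod_minus_sym in Hx; lra.
  + apply (Cd_div (fun x => F x - F z)%C (fun x => x - z)%C); [| |exact Hn].
    * apply (Cd_minus F (fun _ => F z)); [apply HF, Hy|apply Cd_const].
    * apply (Cd_minus (fun x => x) (fun _ => z)); [apply Cd_id|apply Cd_const].
Qed.

(** The angle [s] is complex so that the rules for [Cd] apply; only real angles are integrated
    over. *)
Definition circ (rho : R) (s : C) : C := (RtoC rho * Cexp (Ci * s))%C.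

Lemma Cd_circ (rho : R) (s : C) : Cd (circ rho) s (Ci * circ rho s)%C.
Proof.
eapply Cd_eq.
- apply Cd_scal, (Cd_comp Cexp (fun s => Ci * s)%C); [apply Cd_Cexp|apply Cd_scal, Cd_id].
- unfold circ; ring.
Qed.

Lemma Cmod_circ (rho t : R) : 0 <= rho -> Cmod (circ rho (RtoC t)) = rho.
Proof.
intros H; unfold circ; rewrite Cmod_mult, Cmod_R, Rabs_pos_eq by exact H.
replace (Ci * RtoC t)%C with (0, t) by (unfold Ci, RtoC, Cmult; simpl; f_equal; ring).
unfold Cexp, Cmod; simpl; rewrite exp_0, !Rmult_1_l, !Rmult_1_r.
replace (cos t * cos t + sin t * sin t) with 1 by (assert (E := sin2_cos2 t); unfold Rsqr in E; lra).
rewrite sqrt_1; ring.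
Qed.

Lemma circ_closed (rho : R) : circ rho (RtoC (2 * PI)) = circ rho (RtoC 0).
Proof.
unfold circ; f_equal.
replace (Ci * RtoC (2 * PI))%C with (0, 2 * PI) by (unfold Ci, RtoC, Cmult; simpl; f_equal; ring).
replace (Ci * RtoC 0)%C with (0, 0) by (unfold Ci, RtoC, Cmult; simpl; f_equal; ring).
unfold Cexp; simpl; rewrite cos_2PI, sin_2PI, cos_0, sin_0; reflexivity.
Qed.

Lemma PI2_pos : 0 <= 2 * PI.
Proof. assert (H := PI_RGT_0); lra. Qed.

Lemma circ_in_disc (rho t : R) : 0 <= rho < 1 -> in_disc (circ rho (RtoC t)).
Proof. intros H; unfold in_disc; rewrite Cmod_circ; lra. Qed.

Lemma cauchy_circle (k : C -> C) (rho : R) : 0 <= rho < 1 -> analytic k ->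
  is_RInt (V := CR) (fun t => k (circ rho (RtoC t)) * (Ci * circ rho (RtoC t)))%C 0 (2 * PI) (RtoC 0).
Proof.
intros Hr Hk; destruct (primitive_exists k Hk) as [K HK].
replace (RtoC 0) with (K (circ rho (RtoC (2 * PI))) - K (circ rho (RtoC 0)))%C
  by (rewrite circ_closed; ring).
apply (Cint_FTC (fun s => K (circ rho s)) (fun s => k (circ rho s) * (Ci * circ rho s))%C);
  [exact PI2_pos| |]; intros t _.
- apply (Cd_comp K (circ rho)); [|apply Cd_circ]. apply HK, circ_in_disc, Hr.
- destruct (analytic_Cd k _ Hk (circ_in_disc rho t Hr)) as [l Hl].
  eexists; apply (Cd_mult (fun s => k (circ rho s)) (fun s => Ci * circ rho s)%C).
  + apply (Cd_comp k (circ rho)); [exact Hl|apply Cd_circ].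
  + apply Cd_scal, Cd_circ.
Qed.

(** * Differentiation of Cauchy integrals in their parameter *)

Lemma Cd_pow (f : C -> C) (z l : C) (n : nat) : Cd f z l -> exists l', Cd (fun y => (f y) ^ n)%C z l'.
Proof.
intros H; induction n as [|n [l' IH]].
- eexists; exact (Cd_const 1%C z).
- eexists; exact (Cd_mult f (fun y => (f y) ^ n)%C z _ _ H IH).
Qed.

(** Intended for a = 1 / (x - z) and b = 1 / (x - z - h), which satisfy the resolvent identity b - a
    = h a b. The constant [K] depends only on [M] and [n], so the error is uniform along the
    circle. *)
Lemma kernel_power_expansion (M : R) (n : nat) : 0 <= M -> exists K, 0 <= K /\ forall a b h : C,
  Cmod a <= M -> Cmod b <= M -> (b - a = h * a * b)%C ->
  Cmod (b ^ n - a ^ n - RtoC (INR n) * h * a ^ S n)%C <= K * (Cmod h * Cmod h).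
Proof.
intros HM; induction n as [|n [K [HK IH]]].
- exists 0; split; [lra|]; intros a b h _ _ _; simpl.
  replace (1 - 1 - RtoC 0 * h * (a * 1))%C with (RtoC 0) by ring. rewrite Cmod_0; lra.
- exists (M * K + INR (S n) * M ^ (n + 3)); split.
  { assert (0 <= INR (S n)) by apply pos_INR. assert (0 <= M ^ (n + 3)) by (apply pow_le; exact HM). nra. }
  intros a b h Ha Hb E; specialize (IH a b h Ha Hb E).
  assert (E2 : (b ^ S n - a ^ S n - RtoC (INR (S n)) * h * a ^ S (S n))%C =
    (b * (b ^ n - a ^ n - RtoC (INR n) * h * a ^ S n) + h * h * RtoC (INR (S n)) * (a * a * b * a ^ n))%C).
  { rewrite S_INR, RtoC_plus; simpl.
    transitivity (b * (b ^ n - a ^ n - INR n * h * (a * a ^ n)) + (b - a) * (a ^ n + INR n * h * (a * a ^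
      n)) - h * (a * (a * a ^ n)))%C; [ring|].
    transitivity (b * (b ^ n - a ^ n - INR n * h * (a * a ^ n)) + ((b - a) * a ^ n - h * a * b * a ^ n) +
      h * a * (b - a) * a ^ n + (b - a) * (INR n * h * (a * a ^ n)))%C; [ring|].
    rewrite E; ring. }
  rewrite E2; eapply Rle_trans; [apply Cmod_triangle|].
  rewrite !Cmod_mult, Cmod_pow, Cmod_R, (Rabs_pos_eq (INR (S n))) by apply pos_INR.
  assert (Hh := Cmod_ge_0 h). assert (Ha0 := Cmod_ge_0 a). assert (Hb0 := Cmod_ge_0 b).
  assert (P : Cmod a * Cmod a * Cmod b * Cmod a ^ n <= M ^ (n + 3)).
  { rewrite pow_add; rewrite (Rmult_comm (M ^ n)).
    apply Rmult_le_compat; [repeat apply Rmult_le_pos; assumption|apply pow_le, Ha0| |apply pow_incr; lra].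
    simpl; rewrite Rmult_1_r, <- Rmult_assoc.
    apply Rmult_le_compat; [nra|assumption| |assumption]. apply Rmult_le_compat; assumption. }
  assert (Q : Cmod b * Cmod (b ^ n - a ^ n - RtoC (INR n) * h * a ^ S n)%C <= M * (K * (Cmod h * Cmod h))).
  { apply Rmult_le_compat; try assumption; apply Cmod_ge_0. }
  assert (Q2 : Cmod h * Cmod h * INR (S n) * (Cmod a * Cmod a * Cmod b * Cmod a ^ n) <= Cmod h * Cmod h *
    INR (S n) * M ^ (n + 3)).
  { apply Rmult_le_compat_l; [|exact P]. assert (0 <= INR (S n)) by apply pos_INR. nra. }
  replace ((M * K + INR (S n) * M ^ (n + 3)) * (Cmod h * Cmod h)) with
    (M * (K * (Cmod h * Cmod h)) + Cmod h * Cmod h * INR (S n) * M ^ (n + 3)) by ring.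
  lra.
Qed.

(** Since the quadratic error is uniform in [t], integrating it leaves an error of at most (b - a) K
    |h|^2. *)
Lemma Cd_RInt_param (k : C -> R -> C) (k' : R -> C) (a b d K : R) (z : C) :
  a <= b -> 0 < d -> 0 <= K ->
  (forall h t, Cmod h < d -> a <= t <= b ->
     Cmod (k (z + h)%C t - k z t - h * k' t)%C <= K * (Cmod h * Cmod h)) ->
  (forall h, Cmod h < d -> ex_RInt (V := CR) (k (z + h)%C) a b) ->
  ex_RInt (V := CR) k' a b ->
  Cd (fun y => RInt (V := CR) (k y) a b) z (RInt (V := CR) k' a b).
Proof.
intros Hab Hd HK Hk Hex Hex'; rewrite Cd_iff; intros eps He.
set (q := (b - a) * K + 1).
assert (Hq : 0 < q) by (unfold q; nra).
exists (Rmin d (eps / q)); split; [apply Rmin_glb_lt; [exact Hd|apply Rdiv_lt_0_compat; assumption]|].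
intros h Hh.
assert (H1 := Rlt_le_trans _ _ _ Hh (Rmin_l _ _)).
assert (H2 := Rlt_le_trans _ _ _ Hh (Rmin_r _ _)).
assert (I1 := RInt_correct (V := CR) _ _ _ (Hex h H1)).
assert (I2 : is_RInt (V := CR) (k z) a b (RInt (V := CR) (k z) a b)).
{ apply (RInt_correct (V := CR)). replace z with (z + 0)%C by ring. apply Hex; rewrite Cmod_0; exact Hd. }
assert (I3 := Cint_scal _ _ _ h _ (RInt_correct (V := CR) _ _ _ Hex')).
assert (I := Cint_minus _ _ _ _ _ _ (Cint_minus _ _ _ _ _ _ I1 I2) I3).
rewrite (Cmult_comm (RInt (V := CR) k' a b)).
eapply Rle_trans; [apply (Cint_bound _ a b (K * (Cmod h * Cmod h)) _ Hab (fun t Ht => Hk h t H1 Ht) I)|].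
assert (Hh0 := Cmod_ge_0 h).
apply (Rmult_lt_compat_r q) in H2; [|exact Hq].
unfold Rdiv in H2; rewrite Rmult_assoc, Rinv_l, Rmult_1_r in H2 by lra.
unfold q in H2. nra.
Qed.

Lemma ex_RInt_C_bounded (g : R -> C) (a b : R) :
  a <= b -> ex_RInt (V := CR) g a b -> exists M, 0 <= M /\ forall t, a <= t <= b -> Cmod (g t) <= M.
Proof.
intros Hab [l H].
assert (H1 := is_RInt_fct_extend_fst (U := R_NormedModule) (V := R_NormedModule) g a b l H).
assert (H2 := is_RInt_fct_extend_snd (U := R_NormedModule) (V := R_NormedModule) g a b l H).
destruct (ex_RInt_ub _ a b (ex_intro _ _ H1)) as [u1 U1].
destruct (ex_RInt_ub _ a b (ex_intro _ _ H2)) as [u2 U2].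
rewrite Rmin_left, Rmax_right in U1, U2 by exact Hab.
assert (B : forall t, a <= t <= b -> Cmod (g t) <= u1 + u2).
{ intros t Ht; eapply Rle_trans; [apply Cmod_le_Re_Im|].
  apply Rplus_le_compat; [exact (U1 t Ht)|exact (U2 t Ht)]. }
exists (u1 + u2); split; [|exact B].
eapply Rle_trans; [apply Cmod_ge_0|apply (B a); lra].
Qed.

(** The factor 1 / (2 pi i) is left out; it reappears as [/ tau]. With the power of the kernel as a
    parameter, a single lemma yields derivatives of every order. *)
Definition cauchy_int (G : C -> C) (rho : R) (n : nat) (z : C) : C :=
  RInt (V := CR) (fun t => G (circ rho (RtoC t)) * (Ci * circ rho (RtoC t)) * (/ (circ rho (RtoC t) - z))
    ^ n)%C
    0 (2 * PI).

Lemma circ_minus_bound (rho t : R) (z : C) : 0 <= rho -> rho - Cmod z <= Cmod (circ rho (RtoC t) - z)%C.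
Proof. intros H; eapply Rle_trans; [|apply Cmod_triangle']; rewrite Cmod_circ by exact H; lra. Qed.

Lemma circ_minus_neq (rho t : R) (z : C) : Cmod z < rho -> (circ rho (RtoC t) - z)%C <> 0%C.
Proof.
intros H; apply Cmod_gt_0. assert (T := Cmod_ge_0 z).
eapply Rlt_le_trans; [|apply circ_minus_bound]; lra.
Qed.

Lemma cauchy_int_correct (G : C -> C) (rho : R) (n : nat) (z : C) :
  analytic G -> Cmod z < rho -> rho < 1 ->
  is_RInt (V := CR) (fun t => G (circ rho (RtoC t)) * (Ci * circ rho (RtoC t)) * (/ (circ rho (RtoC t) -
    z)) ^ n)%C
    0 (2 * PI) (cauchy_int G rho n z).
Proof.
intros HG Hz Hr; assert (Hz0 := Cmod_ge_0 z).
apply (RInt_correct (V := CR)).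
apply (Cint_ex (fun s => G (circ rho s) * (Ci * circ rho s) * (/ (circ rho s - z)) ^ n)%C);
  [exact PI2_pos|].
intros t _.
destruct (analytic_Cd G _ HG (circ_in_disc rho t ltac:(lra))) as [l Hl].
destruct (Cd_pow (fun s => / (circ rho s - z))%C (RtoC t) _ n
  (Cd_inv (fun s => circ rho s - z)%C _ _ (Cd_minus (circ rho) (fun _ => z) _ _ _ (Cd_circ rho (RtoC t))
    (Cd_const z _))
    (circ_minus_neq rho t z Hz))) as [l' Hl'].
eexists; apply (Cd_mult (fun s => G (circ rho s) * (Ci * circ rho s))%C (fun s => (/ (circ rho s - z)) ^
  n)%C); [|exact Hl'].
apply (Cd_mult (fun s => G (circ rho s)) (fun s => Ci * circ rho s)%C).
- apply (Cd_comp G (circ rho)); [exact Hl|apply Cd_circ].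
- apply Cd_scal, Cd_circ.
Qed.

Lemma Cd_cauchy_int (G : C -> C) (rho : R) (n : nat) (z : C) :
  analytic G -> Cmod z < rho -> rho < 1 ->
  Cd (cauchy_int G rho n) z (RtoC (INR n) * cauchy_int G rho (S n) z)%C.
Proof.
intros HG Hz Hr; assert (Hz0 := Cmod_ge_0 z).
set (d := (rho - Cmod z) / 2).
assert (Hd : 0 < d) by (unfold d; lra).
assert (J := Cint_scal _ _ _ (RtoC (INR n)) _ (cauchy_int_correct G rho (S n) z HG Hz Hr)).
rewrite <- (is_RInt_unique (V := CR) _ _ _ _ J).
assert (Hzh : forall h, Cmod h < d -> Cmod (z + h)%C < rho /\ d <= rho - Cmod (z + h)%C).
{ intros h Hh; assert (T := Cmod_triangle z h); unfold d in *; lra. }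
assert (Bd : exists B, 0 <= B /\ forall t, 0 <= t <= 2 * PI ->
  Cmod (G (circ rho (RtoC t)) * (Ci * circ rho (RtoC t)))%C <= B).
{ apply ex_RInt_C_bounded; [exact PI2_pos|].
  eexists; apply (is_RInt_ext (V := CR)) with (2 := cauchy_int_correct G rho 0 z HG Hz Hr).
  intros t _; simpl; eqC; ring. }
destruct Bd as [B [HB0 HB]].
assert (Hid : 0 <= / d) by (left; apply Rinv_0_lt_compat, Hd).
destruct (kernel_power_expansion (/ d) n Hid) as [K [HK Hker]].
apply (Cd_RInt_param
  (fun z t => G (circ rho (RtoC t)) * (Ci * circ rho (RtoC t)) * (/ (circ rho (RtoC t) - z)) ^ n)%C _ 0
    (2 * PI) d (B * K)).
- exact PI2_pos.
- exact Hd.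
- nra.
- intros h t Hh Ht; destruct (Hzh h Hh) as [Hzh1 Hzh2].
  set (g := (G (circ rho (RtoC t)) * (Ci * circ rho (RtoC t)))%C).
  set (a := (/ (circ rho (RtoC t) - z))%C); set (b := (/ (circ rho (RtoC t) - (z + h)))%C).
  assert (Na := circ_minus_neq rho t z Hz); assert (Nb := circ_minus_neq rho t (z + h) Hzh1).
  replace (g * b ^ n - g * a ^ n - h * (RtoC (INR n) * (g * a ^ S n)))%C with
    (g * (b ^ n - a ^ n - RtoC (INR n) * h * a ^ S n))%C by ring.
  rewrite Cmod_mult, Rmult_assoc.
  apply Rmult_le_compat; try apply Cmod_ge_0; [apply HB, Ht|].
  apply Hker.
  + unfold a; rewrite Cmod_inv by exact Na; apply Rinv_le_contravar; [exact Hd|].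
    eapply Rle_trans; [|apply circ_minus_bound; lra]; unfold d; lra.
  + unfold b; rewrite Cmod_inv by exact Nb; apply Rinv_le_contravar; [exact Hd|].
    eapply Rle_trans; [|apply circ_minus_bound; lra]; lra.
  + unfold a, b; field; split; assumption.
- intros h Hh; destruct (Hzh h Hh) as [Hzh1 Hzh2]; eexists; apply cauchy_int_correct; assumption.
- eexists; exact J.
Qed.

(** * Schwarz-type lemmas *)

Definition tau : C := (RtoC (2 * PI) * Ci)%C.

Lemma tau_neq_0 : tau <> 0%C.
Proof.
assert (P := PI_RGT_0).
apply Cmod_gt_0; unfold tau; rewrite Cmod_mult, Cmod_Ci, Cmod_R, Rabs_pos_eq by lra; lra.
Qed.

Lemma Cint_const (a b : R) (c : C) : is_RInt (V := CR) (fun _ => c) a b (RtoC (b - a) * c)%C.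
Proof.
assert (I := is_RInt_const (V := CR) a b c). rewrite RtoC_scal in I; exact I.
Qed.

(** The derivative in [z] has the kernel of power 2, which has a primitive along the closed circle
    and so integrates to zero. The integral is therefore constant on the segment from 0 to [z], and
    at 0 the integrand is the constant [Ci]. *)
Lemma cauchy_int_1 (rho : R) (z : C) : Cmod z < rho -> rho < 1 -> cauchy_int (fun _ => 1%C) rho 1 z = tau.
Proof.
intros Hz Hr; assert (Hz0 := Cmod_ge_0 z).
assert (A1 : analytic (fun _ : C => 1%C)) by (intros y _; eapply Cd_ex, Cd_const).
assert (Z2 : forall y, Cmod y < rho -> cauchy_int (fun _ => 1%C) rho 2 y = 0%C).
{ intros y Hy; apply (is_RInt_unique (V := CR)).
  set (P := fun s => (- / (circ rho s - y))%C).
  replace (RtoC 0) with (P (RtoC (2 * PI)) - P (RtoC 0))%C by (unfold P; rewrite circ_closed; ring).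
  apply (Cint_FTC P (fun s => 1 * (Ci * circ rho s) * (/ (circ rho s - y)) ^ 2)%C); [exact PI2_pos| |];
    intros t _; assert (N := circ_minus_neq rho t y Hy);
    assert (D := Cd_inv (fun s => circ rho s - y)%C _ _ (Cd_minus (circ rho) (fun _ => y) _ _ _ (Cd_circ
      rho (RtoC t)) (Cd_const y _)) N).
  - apply Cd_ext with (fun s => (- (1)) * / (circ rho s - y))%C; [intros s; unfold P; ring|].
    eapply Cd_eq; [apply Cd_scal, D|]. simpl; field; exact N.
  - destruct (Cd_pow _ _ _ 2 D) as [l Hl]; eexists.
    apply (Cd_mult (fun s => 1 * (Ci * circ rho s))%C); [apply Cd_scal, Cd_scal, Cd_circ|exact Hl]. }
assert (N0 : cauchy_int (fun _ => 1%C) rho 1 (RtoC 0) = tau).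
{ apply (is_RInt_unique (V := CR)).
  apply (is_RInt_ext (V := CR) (fun _ => Ci)).
  - intros t _; eqC; simpl. assert (N := circ_minus_neq rho t (RtoC 0)).
    rewrite Cmod_0 in N; specialize (N ltac:(lra)).
    replace (circ rho t - 0)%C with (circ rho t) in * by ring; field; exact N.
  - assert (I := Cint_const 0 (2 * PI) Ci).
    rewrite Rminus_0_r in I; exact I. }
rewrite <- N0.
assert (Hs : forall t, 0 <= t <= 1 -> Cmod (RtoC t * z)%C < rho).
{ intros t Ht; rewrite Cmod_mult, Cmod_R, Rabs_pos_eq by lra; nra. }
assert (I := Cint_FTC (fun s => cauchy_int (fun _ => 1%C) rho 1 (s * z))%C (fun _ => RtoC 0) 0 1
  ltac:(lra)).
assert (I2 := Cint_const 0 1 (RtoC 0)).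
assert (E : (cauchy_int (fun _ => 1) rho 1 (RtoC 1 * z) - cauchy_int (fun _ => 1) rho 1 (RtoC 0 * z))%C =
  (RtoC (1 - 0) * RtoC 0)%C).
{ rewrite <- (is_RInt_unique (V := CR) _ _ _ _ I2). symmetry; apply (is_RInt_unique (V := CR)), I.
  - intros t Ht; eapply Cd_eq.
    + apply (Cd_comp (cauchy_int (fun _ => 1%C) rho 1) (fun s => s * z)%C).
      * apply Cd_cauchy_int; [exact A1|apply Hs, Ht|exact Hr].
      * apply (Cd_mult (fun s => s) (fun _ => z)); [apply Cd_id|apply Cd_const].
    + rewrite Z2 by (apply Hs, Ht); ring.
  - intros t _; eexists; apply Cd_const. }
replace (RtoC 1 * z)%C with z in E by ring. replace (RtoC 0 * z)%C with (RtoC 0) in E by ring.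
replace (cauchy_int (fun _ => 1%C) rho 1 z) with
  (cauchy_int (fun _ => 1) rho 1 z - cauchy_int (fun _ => 1) rho 1 0 + cauchy_int (fun _ => 1) rho 1 0)%C
    by ring.
rewrite E; ring.
Qed.

Lemma cauchy_formula (F f : C -> C) (rho : R) (z : C) :
  analytic f -> (forall y, in_disc y -> Cd F y (f y)) -> Cmod z < rho -> rho < 1 ->
  cauchy_int F rho 1 z = (F z * tau)%C.
Proof.
intros Hf HF Hz Hr; assert (Hz0 := Cmod_ge_0 z).
assert (HzD : in_disc z) by (unfold in_disc; lra).
assert (AF : analytic F) by (intros y Hy; eapply Cd_ex, HF, Hy).
assert (A1 : analytic (fun _ : C => 1%C)) by (intros y _; eapply Cd_ex, Cd_const).
assert (I := cauchy_circle (slope F f z) rho ltac:(lra) (slope_analytic F f z Hf HzD HF)).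
assert (I1 := Cint_scal _ _ _ (F z) _ (cauchy_int_correct _ rho 1 z A1 Hz Hr)).
assert (J := is_RInt_plus (V := CR) _ _ _ _ _ _ I I1).
rewrite <- (cauchy_int_1 rho z Hz Hr).
replace (F z * cauchy_int (fun _ => 1) rho 1 z)%C with (RtoC 0 + F z * cauchy_int (fun _ => 1) rho 1 z)%C
  by ring.
apply (is_RInt_unique (V := CR)).
eapply (is_RInt_ext (V := CR)); [|exact J].
intros t _; cbv beta.
assert (N := circ_minus_neq rho t z Hz).
assert (S := slope_mult F f z (circ rho (RtoC t))).
change (@eq C (slope F f z (circ rho t) * (Ci * circ rho t) + F z * (1 * (Ci * circ rho t) * (/ (circ rho
  t - z)) ^ 1))%C
 (F (circ rho t) * (Ci * circ rho t) * (/ (circ rho t - z)) ^ 1)%C).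
replace (F (circ rho t)) with (slope F f z (circ rho t) * (circ rho t - z) + F z)%C by (rewrite S; ring).
simpl; field; exact N.
Qed.

Lemma analytic_derive (f : C -> C) : analytic f -> analytic (C_derive f).
Proof.
intros Hf z Hz; destruct (primitive_exists f Hf) as [F HF].
assert (AF : analytic F) by (intros y Hy; eapply Cd_ex, HF, Hy).
assert (Hz0 := Cmod_ge_0 z); unfold in_disc in Hz.
set (rho := (1 + Cmod z) / 2).
assert (Hr : rho < 1) by (unfold rho; lra).
assert (Nbd : forall (P : C -> Prop), (forall y, Cmod y < rho -> P y) ->
  forall x, Cmod x < rho -> exists d, 0 < d /\ forall y, Cmod (y - x)%C < d -> P y).
{ intros P HP x Hx; exists (rho - Cmod x); split; [lra|]; intros y Hy; apply HP.
  assert (T := Cmod_triangle (y - x)%C x). replace (y - x + x)%C with y in T by ring. lra. }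
assert (n1 := tau_neq_0).
(* Cauchy's formula for [F] is differentiated step by step; uniqueness of derivatives identifies the
   results with [f] and [C_derive f], and one more step differentiates the latter. *)
assert (E0 : forall y, Cmod y < rho -> (/ tau * cauchy_int F rho 1 y)%C = F y).
{ intros y Hy; rewrite (cauchy_formula F f) by assumption; field; exact n1. }
assert (Dn : forall n y, Cmod y < rho -> Cd (fun x => / tau * cauchy_int F rho n x)%C y
  (/ tau * (RtoC (INR n) * cauchy_int F rho (S n) y))%C).
{ intros n y Hy; apply Cd_scal, Cd_cauchy_int; assumption. }
assert (E1 : forall y, Cmod y < rho -> (/ tau * cauchy_int F rho 2 y)%C = f y).
{ intros y Hy; apply (Cd_unique F y); [|apply HF; unfold in_disc; lra].
  eapply Cd_eq; [eapply Cd_ext_loc; [apply Nbd; [exact E0|exact Hy]|apply Dn, Hy]|].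
  simpl; ring. }
assert (E2 : forall y, Cmod y < rho -> (RtoC 2 * (/ tau * cauchy_int F rho 3 y))%C = C_derive f y).
{ intros y Hy; apply (Cd_unique f y); [|apply Cd_C_derive, Hf; unfold in_disc; lra].
  eapply Cd_eq; [eapply Cd_ext_loc; [apply Nbd; [exact E1|exact Hy]|apply Dn, Hy]|].
  replace (INR 2) with 2 by (simpl; lra). ring. }
assert (Hzr : Cmod z < rho) by (unfold rho; lra).
eapply Cd_ex, Cd_ext_loc; [apply Nbd; [exact E2|exact Hzr]|apply Cd_scal, Dn, Hzr].
Qed.

(** A maximum principle for the centre only; other points are first moved to the centre by a Moebius
    map. *)
Lemma mean_value_bound (F : C -> C) (rho M : R) :
  analytic F -> 0 < rho < 1 -> (forall y, Cmod y = rho -> Cmod (F y) <= M) -> Cmod (F 0%C) <= M.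
Proof.
intros HF Hr HM; assert (P := PI_RGT_0).
assert (H0 : Cmod (RtoC 0) < rho) by (rewrite Cmod_0; lra).
assert (E := cauchy_formula F (C_derive F) rho (RtoC 0) (analytic_derive F HF)
  (fun y Hy => Cd_C_derive F y (HF y Hy)) H0 (proj2 Hr)).
assert (I := cauchy_int_correct F rho 1 (RtoC 0) HF H0 (proj2 Hr)).
assert (B : Cmod (cauchy_int F rho 1 (RtoC 0)) <= (2 * PI - 0) * M).
{ eapply Cint_bound; [exact PI2_pos| |exact I].
  intros t _; cbv beta.
  assert (N := circ_minus_neq rho t (RtoC 0) H0).
  replace (F (circ rho t) * (Ci * circ rho t) * (/ (circ rho t - 0)) ^ 1)%C with (F (circ rho t) * Ci)%C
    by (replace (circ rho t - 0)%C with (circ rho t) in * by ring; simpl; field; exact N).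
  rewrite Cmod_mult, Cmod_Ci, Rmult_1_r. apply HM, Cmod_circ; lra. }
rewrite E, Cmod_mult in B. unfold tau in B.
rewrite Cmod_mult, Cmod_Ci, Cmod_R, Rabs_pos_eq in B by lra.
apply Rmult_le_reg_r with (2 * PI); lra.
Qed.

(** * Blaschke quotients and Moebius maps of the disc *)

Lemma Cmod_sqr (z : C) : Cmod z * Cmod z = Re z * Re z + Im z * Im z.
Proof. assert (E := Cmod2_alt z); simpl in E; lra. Qed.

Lemma blaschke_identity (a b : C) :
  Cmod (1 - Cconj a * b)%C * Cmod (1 - Cconj a * b)%C - Cmod (b - a)%C * Cmod (b - a)%C =
  (1 - Cmod a * Cmod a) * (1 - Cmod b * Cmod b).
Proof.
rewrite !Cmod_sqr; destruct a as [a1 a2], b as [b1 b2]; unfold Cconj, Re, Im; simpl; ring.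
Qed.

Lemma blaschke_denominator (a b : C) : Cmod a * Cmod b < 1 -> (1 - Cconj a * b)%C <> 0%C.
Proof.
intros H E.
assert (E1 : (Cconj a * b)%C = 1%C).
{ replace (Cconj a * b)%C with (1 - (1 - Cconj a * b))%C by ring; rewrite E; ring. }
assert (E2 : Cmod (Cconj a * b)%C = 1) by (rewrite E1; apply Cmod_1).
rewrite Cmod_mult, Cmod_conj in E2; lra.
Qed.

Lemma blaschke_le (a b : C) : Cmod a < 1 -> Cmod b <= 1 ->
  Cmod ((b - a) / (1 - Cconj a * b))%C <= 1.
Proof.
intros Ha Hb; assert (Ha0 := Cmod_ge_0 a); assert (Hb0 := Cmod_ge_0 b).
assert (N : (1 - Cconj a * b)%C <> 0%C) by (apply blaschke_denominator; nra).
assert (Np : 0 < Cmod (1 - Cconj a * b)%C) by (apply Cmod_gt_0; exact N).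
rewrite Cmod_div by exact N. apply Rmult_le_reg_r with (Cmod (1 - Cconj a * b)%C); [exact Np|].
unfold Rdiv; rewrite Rmult_assoc, Rinv_l by lra.
assert (I := blaschke_identity a b); assert (H0 := Cmod_ge_0 (b - a)%C).
assert (0 <= (1 - Cmod a * Cmod a) * (1 - Cmod b * Cmod b)) by (apply Rmult_le_pos; nra).
nra.
Qed.

Definition moebius (a y : C) : C := ((y + a) / (1 + Cconj a * y))%C.

Lemma moebius_denominator (a y : C) : in_disc a -> in_disc y -> (1 + Cconj a * y)%C <> 0%C.
Proof.
unfold in_disc; intros Ha Hy; assert (Ha0 := Cmod_ge_0 a); assert (Hy0 := Cmod_ge_0 y).
replace (1 + Cconj a * y)%C with (1 - Cconj a * - y)%C by ring.
apply blaschke_denominator; rewrite Cmod_opp; nra.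
Qed.

Lemma moebius_identity (a y : C) : in_disc a -> in_disc y ->
  (1 - Cmod (moebius a y) * Cmod (moebius a y)) * (Cmod (1 + Cconj a * y)%C * Cmod (1 + Cconj a * y)%C) =
  (1 - Cmod a * Cmod a) * (1 - Cmod y * Cmod y).
Proof.
intros Ha Hy; assert (N := moebius_denominator a y Ha Hy).
assert (Np : 0 < Cmod (1 + Cconj a * y)%C) by (apply Cmod_gt_0; exact N).
assert (I := blaschke_identity (- a) y).
replace (y - - a)%C with (y + a)%C in I by ring.
replace (Cconj (- a) * y)%C with (- (Cconj a * y))%C in I
  by (destruct a as [u v], y as [p q]; unfold Cconj; apply injective_projections; simpl; ring).
replace (1 - - (Cconj a * y))%C with (1 + Cconj a * y)%C in I by ring.
rewrite Cmod_opp in I; rewrite <- I.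
unfold moebius; rewrite Cmod_div by exact N; field; lra.
Qed.

Lemma moebius_in_disc (a y : C) : in_disc a -> in_disc y -> in_disc (moebius a y).
Proof.
intros Ha Hy; assert (I := moebius_identity a y Ha Hy).
assert (N := moebius_denominator a y Ha Hy).
assert (Np : 0 < Cmod (1 + Cconj a * y)%C) by (apply Cmod_gt_0; exact N).
unfold in_disc in *; assert (Ha0 := Cmod_ge_0 a); assert (Hy0 := Cmod_ge_0 y);
  assert (Hm0 := Cmod_ge_0 (moebius a y)).
assert (0 < (1 - Cmod a * Cmod a) * (1 - Cmod y * Cmod y)) by (apply Rmult_lt_0_compat; nra).
rewrite <- I in H; set (m := Cmod (moebius a y)) in *.
destruct (Rlt_dec m 1) as [|Hm]; [assumption|exfalso].
set (P := Cmod (1 + Cconj a * y)%C * Cmod (1 + Cconj a * y)%C) in *.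
assert (HP : 0 < P) by (unfold P; nra). assert (1 - m * m <= 0) by nra. nra.
Qed.

Lemma Cd_moebius (a y : C) : in_disc a -> in_disc y ->
  Cd (moebius a) y ((1 - Cconj a * a) / ((1 + Cconj a * y) * (1 + Cconj a * y)))%C.
Proof.
intros Ha Hy; assert (N := moebius_denominator a y Ha Hy).
eapply Cd_eq.
- apply (Cd_div (fun y => y + a)%C (fun y => 1 + Cconj a * y)%C); [| |exact N].
  + apply (Cd_plus (fun y => y) (fun _ => a)); [apply Cd_id|apply Cd_const].
  + apply (Cd_plus (fun _ => 1%C)); [apply Cd_const|apply Cd_scal, Cd_id].
- field; exact N.
Qed.

Lemma moebius_0 (a : C) : moebius a 0%C = a.
Proof.
unfold moebius; replace (1 + Cconj a * 0)%C with (RtoC 1) by ring.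
replace (0 + a)%C with a by ring. field.
Qed.

Lemma analytic_comp (f g : C -> C) :
  analytic f -> analytic g -> (forall z, in_disc z -> in_disc (g z)) -> analytic (fun z => f (g z)).
Proof.
intros Hf Hg Hd z Hz; destruct (Hg z Hz) as [b Hb], (Hf (g z) (Hd z Hz)) as [a Ha].
eapply Cd_ex; apply (Cd_comp f g); [exact Ha|exact Hb].
Qed.

(** The derivative is the value at 0 of G(y) / y, which is at most 1 / rho on the circle of radius
    rho; then rho tends to 1. *)
Lemma Cd_at_0_bound (G : C -> C) (l : C) :
  analytic G -> (forall z, in_disc z -> Cmod (G z) <= 1) -> G 0%C = 0%C -> Cd G 0%C l -> Cmod l <= 1.
Proof.
intros HG HB G0 Hl.
assert (E : l = slope G (C_derive G) 0 0).
{ rewrite slope_at; apply (Cd_unique G (RtoC 0)); [exact Hl|apply Cd_C_derive, HG, in_disc_0]. }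
assert (A := slope_analytic G (C_derive G) (RtoC 0) (analytic_derive G HG) in_disc_0
  (fun y Hy => Cd_C_derive G y (HG y Hy))).
assert (K : forall rho, 0 < rho < 1 -> Cmod l * rho <= 1).
{ intros rho Hr.
  assert (M : Cmod l <= / rho).
  { rewrite E; apply (mean_value_bound _ rho); [exact A|exact Hr|].
    intros y Hy.
    assert (N : y <> 0%C) by (apply Cmod_gt_0; lra).
    rewrite slope_neq by exact N.
    rewrite G0. replace ((G y - 0) / (y - 0))%C with (G y / y)%C.
    2:{ replace (y - 0)%C with y by ring; field; exact N. }
    rewrite Cmod_div by exact N; rewrite Hy.
    rewrite <- (Rmult_1_l (/ rho)). apply Rmult_le_compat_r; [left; apply Rinv_0_lt_compat; lra|].
    apply HB; unfold in_disc; lra. }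
  apply (Rmult_le_compat_r rho) in M; [|lra]. rewrite Rinv_l in M; lra. }
destruct (Rle_dec (Cmod l) 1) as [|H]; [assumption|exfalso].
assert (H1 : 1 < Cmod l) by lra.
(* For this radius |l| rho = (|l| + 1) / 2, which exceeds 1. *)
assert (K2 := K ((1 + / Cmod l) / 2)).
assert (Hi : / Cmod l < 1) by (rewrite <- Rinv_1; apply Rinv_lt_contravar; lra).
assert (Hi0 : 0 < / Cmod l) by (apply Rinv_0_lt_compat; lra).
specialize (K2 ltac:(lra)).
assert (Cmod l * / Cmod l = 1) by (apply Rinv_r; lra). nra.
Qed.

(** Values of modulus 1 are allowed, as w(y) / y takes them when [w] is a rotation. The Blaschke
    denominators could then vanish, so the inequality is proved for c phi with c < 1, and c tends to
    1. For c phi, Moebius maps on both sides move [z] and the value at [z] to 0. *)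
Lemma schwarz_pick (phi : C -> C) (z l : C) :
  analytic phi -> (forall y, in_disc y -> Cmod (phi y) <= 1) -> in_disc z -> Cd phi z l ->
  Cmod l * (1 - Cmod z * Cmod z) <= 1 - Cmod (phi z) * Cmod (phi z).
Proof.
intros Hphi HB Hz Hl.
assert (Hz0 := Cmod_ge_0 z); assert (Hp0 := Cmod_ge_0 (phi z)); assert (Hpz := HB z Hz).
assert (K : forall c, 0 < c < 1 ->
  c * (Cmod l * (1 - Cmod z * Cmod z)) <= 1 - c * Cmod (phi z) * (c * Cmod (phi z))).
{ intros c Hc.
  set (g := fun y => (RtoC c * phi y)%C).
  assert (Hg : forall y, in_disc y -> Cmod (g y) <= c).
  { intros y Hy; unfold g; rewrite Cmod_mult, Cmod_R, Rabs_pos_eq by lra.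
    assert (T := HB y Hy); assert (T0 := Cmod_ge_0 (phi y)); nra. }
  assert (Ag : analytic g).
  { intros y Hy; destruct (analytic_Cd phi y Hphi Hy) as [d Hd]; eapply Cd_ex, Cd_scal, Hd. }
  set (G := fun y => ((g (moebius z y) - g z) / (1 - Cconj (g z) * g (moebius z y)))%C).
  assert (Hgz := Hg z Hz); assert (Hgz0 := Cmod_ge_0 (g z)).
  assert (Den : forall y, in_disc y -> (1 - Cconj (g z) * g (moebius z y))%C <> 0%C).
  { intros y Hy; apply blaschke_denominator.
    assert (T := Hg _ (moebius_in_disc z y Hz Hy)); assert (T0 := Cmod_ge_0 (g (moebius z y))); nra. }
  assert (DG : forall y d, in_disc y -> Cd g (moebius z y) d ->
    Cd G y (((d * ((1 - Cconj z * z) / ((1 + Cconj z * y) * (1 + Cconj z * y)))) * (1 - Cconj (g z) * g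
      (moebius z y)) -
      (g (moebius z y) - g z) * (- (Cconj (g z) * (d * ((1 - Cconj z * z) / ((1 + Cconj z * y) * (1 +
        Cconj z * y)))))))
      / ((1 - Cconj (g z) * g (moebius z y)) * (1 - Cconj (g z) * g (moebius z y))))%C).
  { intros y d Hy Hd.
    assert (Dg := Cd_comp g (moebius z) y d _ Hd (Cd_moebius z y Hz Hy)).
    apply (Cd_div (fun y => g (moebius z y) - g z)%C (fun y => 1 - Cconj (g z) * g (moebius z y))%C);
      [| |apply Den, Hy].
    - eapply Cd_eq; [apply (Cd_minus (fun y => g (moebius z y)) (fun _ => g z));
        [exact Dg|apply Cd_const]|ring].
    - eapply Cd_eq; [apply (Cd_minus (fun _ => 1%C)); [apply Cd_const|apply Cd_scal, Dg]|ring]. }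
  assert (Lb : Cmod ((RtoC c * l) * (1 - Cconj z * z) / (1 - Cconj (g z) * g z))%C <= 1).
  { apply (Cd_at_0_bound G).
    - intros y Hy; destruct (analytic_Cd g _ Ag (moebius_in_disc z y Hz Hy)) as [d Hd].
      eapply Cd_ex, DG; [exact Hy|exact Hd].
    - intros y Hy; apply blaschke_le; [lra|].
      assert (T := Hg _ (moebius_in_disc z y Hz Hy)); lra.
    - unfold G; rewrite moebius_0. replace (g z - g z)%C with (RtoC 0) by ring. unfold Cdiv; ring.
    - assert (D0 := Den _ in_disc_0); rewrite moebius_0 in D0.
      eapply Cd_eq; [apply (DG (RtoC 0) (RtoC c * l)%C in_disc_0)|].
      + rewrite moebius_0; apply Cd_scal, Hl.
      + rewrite moebius_0. replace (1 + Cconj z * 0)%C with (RtoC 1) by ring. field.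
        exact D0. }
  assert (Rc : forall w, (1 - Cconj w * w)%C = RtoC (1 - Cmod w * Cmod w)).
  { intros w; rewrite Cmod_sqr; destruct w as [u v]; unfold Cconj, Re, Im, RtoC;
    apply injective_projections; simpl; ring. }
  rewrite !Rc in Lb.
  assert (Eg : Cmod (g z) = c * Cmod (phi z)).
  { unfold g; rewrite Cmod_mult, Cmod_R, Rabs_pos_eq by lra; reflexivity. }
  rewrite <- Eg.
  assert (Q : 0 < 1 - Cmod (g z) * Cmod (g z)) by nra.
  unfold in_disc in Hz.
  rewrite Cmod_div in Lb by (intros E; injection E; lra).
  rewrite !Cmod_mult, !Cmod_R, (Rabs_pos_eq c), (Rabs_pos_eq (1 - Cmod z * Cmod z)),
    (Rabs_pos_eq (1 - Cmod (g z) * Cmod (g z))) in Lb by nra.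
  apply (Rmult_le_compat_r (1 - Cmod (g z) * Cmod (g z))) in Lb; [|lra].
  unfold Rdiv in Lb; rewrite Rmult_assoc, Rinv_l in Lb by lra. lra. }
set (A := Cmod l * (1 - Cmod z * Cmod z)) in *.
set (p := Cmod (phi z)) in *.
destruct (Rle_dec A (1 - p * p)) as [|Hn]; [assumption|exfalso].
assert (A0 : 0 <= A) by (apply Rmult_le_pos; [apply Cmod_ge_0|unfold in_disc in Hz; nra]).
set (e := A - (1 - p * p)).
assert (He : 0 < e) by (unfold e; lra).
(* With c = 1 - eta, [K] bounds the excess [e] by eta (A + 2), which this choice makes at most e /
   2. *)
set (eta := Rmin (1 / 2) (e / (2 * (A + 2)))).
assert (H1 : 0 < eta) by (apply Rmin_glb_lt; [lra|apply Rdiv_lt_0_compat; lra]).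
assert (H2 : eta <= 1 / 2) by apply Rmin_l.
assert (H3 : eta * (2 * (A + 2)) <= e).
{ assert (T : eta <= e / (2 * (A + 2))) by apply Rmin_r.
  apply (Rmult_le_compat_r (2 * (A + 2))) in T; [|lra].
  unfold Rdiv in T; rewrite Rmult_assoc, Rinv_l in T by lra; lra. }
specialize (K (1 - eta) ltac:(lra)).
assert (p * p <= 1) by nra. unfold e in H3. nra.
Qed.

(** The quotient w(x) / x is at most 1 / |x|, and a Moebius map taking 0 to [z] sends circles near
    the unit circle to curves where |x| is close to 1. The bound at the centre then gives the claim
    at [z]. *)
Lemma schwarz_slope (w : C -> C) (z : C) :
  analytic w -> (forall y, in_disc y -> in_disc (w y)) -> w 0%C = 0%C -> in_disc z ->
  Cmod (slope w (C_derive w) 0%C z) <= 1.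
Proof.
intros Hw HB w0 Hz.
set (phi := slope w (C_derive w) 0%C).
assert (A : analytic phi) by (exact (slope_analytic w (C_derive w) (RtoC 0) (analytic_derive w Hw) in_disc_0
  (fun y Hy => Cd_C_derive w y (Hw y Hy)))).
assert (Am : analytic (fun y => phi (moebius z y))).
{ apply analytic_comp; [exact A| |intros y Hy; apply moebius_in_disc; assumption].
  intros y Hy; eapply Cd_ex, Cd_moebius; assumption. }
assert (Hz' := Hz); unfold in_disc in Hz'; assert (Hz0 := Cmod_ge_0 z).
set (m := Cmod (phi z)); assert (Hm0 : 0 <= m) by apply Cmod_ge_0.
destruct (Rle_dec m 1) as [|Hn]; [assumption|exfalso].
set (q := (1 - Cmod z) * (1 - Cmod z)).
assert (Hq : 0 < q) by (unfold q; nra).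
(* On the circle of radius [rho] the image under the Moebius map stays within [1 - rho^2] of the
   unit circle, up to the constant [q]. *)
assert (K : forall rho, 0 < rho < 1 -> 1 - rho * rho < q -> m * m * (1 - (1 - rho * rho) / q) <= 1).
{ intros rho Hr Hrq.
  set (s := 1 - (1 - rho * rho) / q).
  assert (Es : (1 - s) * q = 1 - rho * rho) by (unfold s; field; lra).
  assert (Hs : 0 < s) by nra.
  assert (Hsq : 0 < sqrt s) by (apply sqrt_lt_R0, Hs).
  assert (M : m <= / sqrt s).
  { unfold m; rewrite <- (moebius_0 z); apply (mean_value_bound (fun y => phi (moebius z y)) rho);
      [exact Am|exact Hr|].
    intros y Hy; assert (Hyd : in_disc y) by (unfold in_disc; lra).
    set (x := moebius z y).
    assert (Hxd : in_disc x) by (apply moebius_in_disc; assumption).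
    assert (I := moebius_identity z y Hz Hyd); fold x in I; rewrite Hy in I.
    assert (Dq : 1 - Cmod z <= Cmod (1 + Cconj z * y)%C).
    { assert (T := Cmod_triangle' (RtoC 1) (- (Cconj z * y))%C).
      rewrite Cmod_1, Cmod_opp, Cmod_mult, Cmod_conj, Hy in T.
      replace (1 - - (Cconj z * y))%C with (1 + Cconj z * y)%C in T by ring. nra. }
    assert (Dq2 : q <= Cmod (1 + Cconj z * y)%C * Cmod (1 + Cconj z * y)%C) by (unfold q; nra).
    assert (Hx0 := Cmod_ge_0 x); unfold in_disc in Hxd.
    assert (Sx : s <= Cmod x * Cmod x).
    { assert (0 <= 1 - Cmod x * Cmod x) by nra.
      assert ((1 - Cmod x * Cmod x) * q <= (1 - s) * q); [|nra].
      rewrite Es. apply Rle_trans with ((1 - Cmod z * Cmod z) * (1 - rho * rho)); [rewrite <- I; nra|].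
      assert (0 <= 1 - rho * rho) by nra. nra. }
    assert (Sx2 : sqrt s <= Cmod x).
    { rewrite <- (sqrt_square (Cmod x)) by exact Hx0. apply sqrt_le_1_alt, Sx. }
    assert (Nx : x <> 0%C) by (apply Cmod_gt_0; lra).
    unfold phi; rewrite slope_neq, w0 by exact Nx.
    replace ((w x - 0) / (x - 0))%C with (w x / x)%C.
    2:{ replace (x - 0)%C with x by ring; field; exact Nx. }
    rewrite Cmod_div by exact Nx.
    assert (Hwx : Cmod (w x) <= 1) by (left; apply HB; exact Hxd).
    assert (/ Cmod x <= / sqrt s) by (apply Rinv_le_contravar; assumption).
    assert (0 <= / Cmod x) by (left; apply Rinv_0_lt_compat; lra).
    assert (T0 := Cmod_ge_0 (w x)). unfold Rdiv; nra. }
  assert (M2 : m * sqrt s <= 1).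
  { apply (Rmult_le_compat_r (sqrt s)) in M; [|lra]. rewrite Rinv_l in M; lra. }
  rewrite <- (sqrt_sqrt s) by lra.
  assert (0 <= m * sqrt s) by nra.
  replace (m * m * (sqrt s * sqrt s)) with ((m * sqrt s) * (m * sqrt s)) by ring. nra. }
(* Here [e] is 1 - rho^2; the last bound makes m^2 e / q at most (m^2 - 1) / 2, so that [K]
   contradicts m > 1. *)
set (e := Rmin (1 / 2) (Rmin (q / 2) (q * (m * m - 1) / (2 * (m * m))))).
assert (Hmm : 0 < m * m - 1) by nra.
assert (e0 : 0 < e).
{ repeat apply Rmin_glb_lt; [lra|lra|]. apply Rdiv_lt_0_compat; [apply Rmult_lt_0_compat; assumption|nra]. }
assert (e1 : e <= 1 / 2) by apply Rmin_l.
assert (e2 : e <= q / 2) by (eapply Rle_trans; [apply Rmin_r|apply Rmin_l]).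
assert (e3 : e <= q * (m * m - 1) / (2 * (m * m))) by (eapply Rle_trans; [apply Rmin_r|apply Rmin_r]).
assert (R2 : sqrt (1 - e) * sqrt (1 - e) = 1 - e) by (apply sqrt_sqrt; lra).
assert (R0 : 0 < sqrt (1 - e)) by (apply sqrt_lt_R0; lra).
specialize (K (sqrt (1 - e))). rewrite R2 in K.
assert (R1 : sqrt (1 - e) < 1) by nra.
specialize (K (conj R0 R1) ltac:(lra)).
replace (1 - (1 - e)) with e in K by ring.
assert (e4 : m * m * (e / q) <= (m * m - 1) / 2).
{ apply (Rmult_le_compat_l (m * m / q)) in e3; [|apply Rdiv_le_0_compat; [nra|exact Hq]].
  replace (m * m / q * (q * (m * m - 1) / (2 * (m * m)))) with ((m * m - 1) / 2) in e3 by (field; split;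
    nra).
  unfold Rdiv in *; lra. }
lra.
Qed.

Lemma schwarz (w : C -> C) (z : C) :
  analytic w -> (forall y, in_disc y -> in_disc (w y)) -> w 0%C = 0%C -> in_disc z -> Cmod (w z) <= Cmod z.
Proof.
intros Hw HB w0 Hz.
assert (S := schwarz_slope w z Hw HB w0 Hz).
assert (E := slope_mult w (C_derive w) 0%C z); rewrite w0 in E.
replace (w z) with (slope w (C_derive w) 0 z * (z - 0))%C by (rewrite E; ring).
rewrite Cmod_mult. replace (z - 0)%C with z by ring.
assert (T := Cmod_ge_0 z); nra.
Qed.

(** With w = z phi one has z w' - w = z^2 phi', and the Schwarz-Pick inequality for phi, multiplied
    by |z|^2, is the claim. *)
Lemma dieudonne (w : C -> C) (z : C) :
  analytic w -> (forall y, in_disc y -> in_disc (w y)) -> w 0%C = 0%C -> in_disc z ->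
  Cmod (z * C_derive w z - w z)%C * (1 - Cmod z * Cmod z) <= Cmod z * Cmod z - Cmod (w z) * Cmod (w z).
Proof.
intros Hw HB w0 Hz.
set (phi := slope w (C_derive w) 0%C).
assert (A : analytic phi) by (exact (slope_analytic w (C_derive w) (RtoC 0) (analytic_derive w Hw) in_disc_0
  (fun y Hy => Cd_C_derive w y (Hw y Hy)))).
assert (E : forall y, w y = (phi y * y)%C).
{ intros y; assert (E := slope_mult w (C_derive w) 0%C y); rewrite w0 in E.
  replace (w y) with (w y - 0)%C by ring; rewrite <- E; unfold phi; ring. }
destruct (analytic_Cd phi z A Hz) as [l Hl].
assert (P := schwarz_pick phi z l A (fun y Hy => schwarz_slope w y Hw HB w0 Hy) Hz Hl).
assert (D : C_derive w z = (l * z + phi z)%C).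
{ apply (Cd_unique w z); [apply Cd_C_derive, Hw, Hz|].
  apply Cd_ext with (fun y => phi y * y)%C; [intros y; symmetry; apply E|].
  eapply Cd_eq; [apply (Cd_mult phi (fun y => y)); [exact Hl|apply Cd_id]|ring]. }
rewrite D, (E z).
replace (z * (l * z + phi z) - phi z * z)%C with (z * z * l)%C by ring.
rewrite !Cmod_mult.
assert (T := Cmod_ge_0 z). nra.
Qed.

(** * Square root, sine and its inverse *)

(** Continuity comes from the factorisation of a difference of squares: principal roots have
    nonnegative real part, so the sum of the two roots keeps a real part of at least Re (Csqrt
    z). *)
Lemma Cd_Csqrt (z : C) : 0 < Re (Csqrt z) -> Cd Csqrt z (/ (RtoC 2 * Csqrt z))%C.
Proof.
intros Hp.
assert (N : Csqrt z <> 0%C) by (intros E; rewrite E in Hp; simpl in Hp; lra).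
apply (Cd_local_inverse (fun y => y * y)%C).
- intros eps He; exists (eps * Re (Csqrt z)); split; [nra|]; intros h Hh.
  assert (E : ((Csqrt (z + h) - Csqrt z) * (Csqrt (z + h) + Csqrt z))%C = h).
  { transitivity (Csqrt (z + h) * Csqrt (z + h) - Csqrt z * Csqrt z)%C; [ring|rewrite !Csqrt_sqr; ring]. }
  assert (L : Re (Csqrt z) <= Cmod (Csqrt (z + h) + Csqrt z)%C).
  { eapply Rle_trans; [|eapply Rle_trans; [apply Rle_abs|apply re_le_Cmod]].
    assert (0 <= Re (Csqrt (z + h)%C)) by apply sqrt_pos.
    change (Re (Csqrt z) <= Re (Csqrt (z + h)%C) + Re (Csqrt z)); lra. }
  rewrite <- E, Cmod_mult in Hh.
  assert (T := Cmod_ge_0 (Csqrt (z + h) - Csqrt z)%C). nra.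
- exists 1; split; [lra|]; intros h _; apply Csqrt_sqr.
- eapply Cd_eq; [apply (Cd_mult (fun y => y) (fun y => y)); apply Cd_id|cbv beta; ring].
- apply Cmult_neq_0; [exact RtoC_2_neq|exact N].
Qed.

(** * The complex sine and its inverse in elliptic coordinates *)

Definition Ccos (z : C) : C := ((Cexp (Ci * z) + Cexp (- (Ci * z))) / RtoC 2)%C.

Lemma Ci_neq_0 : Ci <> 0%C.
Proof. intros E; injection E; lra. Qed.

Lemma Cd_Csin (z : C) : Cd Csin z (Ccos z).
Proof.
assert (D1 : Cd (fun y => Ci * y)%C z Ci) by (eapply Cd_eq; [apply Cd_scal, Cd_id|ring]).
assert (D2 : Cd (fun y => - (Ci * y))%C z (- Ci)%C).
{ apply Cd_ext with (fun y => - Ci * y)%C; [intros y; ring|eapply Cd_eq; [apply Cd_scal, Cd_id|ring]]. }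
assert (D : Cd (fun y => / (RtoC 2 * Ci) * (Cexp (Ci * y) - Cexp (- (Ci * y))))%C z
  (/ (RtoC 2 * Ci) * (Cexp (Ci * z) * Ci - Cexp (- (Ci * z)) * - Ci))%C).
{ apply Cd_scal, (Cd_minus (fun y => Cexp (Ci * y)) (fun y => Cexp (- (Ci * y)))%C);
    [exact (Cd_comp Cexp _ z _ _ (Cd_Cexp _) D1)|exact (Cd_comp Cexp _ z _ _ (Cd_Cexp _) D2)]. }
eapply Cd_eq; [eapply Cd_ext; [|exact D]|].
- intros y; unfold Csin, Cdiv; ring.
- unfold Ccos; field; exact Ci_neq_0.
Qed.

Lemma Csin_pair (x y : R) : Csin (x, y) = (sin x * cosh y, cos x * sinh y).
Proof.
assert (E1 : (Ci * (x, y))%C = (- y, x)) by (unfold Ci, Cmult; simpl; f_equal; ring).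
assert (E : (Cexp ((- y)%R, x) - Cexp (- ((- y)%R, x)))%C =
  Cmult (sin x * cosh y, cos x * sinh y) (Cmult (RtoC 2) Ci)).
{ unfold Cexp, Copp, Cminus, Cplus, Cmult, Ci, RtoC, Re, Im; simpl.
  rewrite Ropp_involutive, cos_neg, sin_neg; unfold cosh, sinh, Copp; simpl; f_equal; field. }
unfold Csin; rewrite E1, E; field; exact Ci_neq_0.
Qed.

Lemma Re_Ccos (x y : R) : Re (Ccos (x, y)) = cos x * cosh y.
Proof.
assert (E1 : (Ci * (x, y))%C = (- y, x)) by (unfold Ci, Cmult; simpl; f_equal; ring).
unfold Ccos; rewrite E1.
unfold Cexp, Copp, Cdiv, Cinv, Cplus, Cmult, RtoC, Re, Im; simpl.
rewrite Ropp_involutive, cos_neg; unfold cosh; field.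
Qed.

Lemma cosh_sqr (y : R) : cosh y * cosh y = 1 + sinh y * sinh y.
Proof.
unfold cosh, sinh.
assert (E : exp y * exp (- y) = 1) by (rewrite <- exp_plus, Rplus_opp_r; apply exp_0).
nra.
Qed.

Lemma cosh_ge_1 (y : R) : 1 <= cosh y.
Proof.
assert (E := cosh_sqr y).
assert (0 < cosh y) by (unfold cosh; assert (A := exp_pos y); assert (B := exp_pos (- y)); lra).
assert (0 <= sinh y * sinh y) by nra. nra.
Qed.

Lemma sin_sqr (x : R) : sin x * sin x + cos x * cos x = 1.
Proof. exact (sin2_cos2 x). Qed.

Definition asin_arg (u : C) : R := (Cmod (u + 1)%C - Cmod (u - 1)%C) / 2.

(* In elliptic coordinates [u = sin (x + i y)] one has [|u + 1| = cosh y + sin x] and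
   [|u - 1| = cosh y - sin x]. *)
Definition Casin (u : C) : C :=
  (asin (asin_arg u), arcsinh (Im u / sqrt (1 - asin_arg u * asin_arg u))).

Lemma Cmod_eq_sqr (z : C) (r : R) : 0 <= r -> Re z * Re z + Im z * Im z = r * r -> Cmod z = r.
Proof.
intros Hr E; rewrite <- Cmod_sqr in E.
assert (T := Cmod_ge_0 z); nra.
Qed.

Lemma asin_arg_Csin (x y : R) : asin_arg (Csin (x, y)) = sin x.
Proof.
assert (C1 := cosh_ge_1 y); assert (C2 := cosh_sqr y); assert (S1 := SIN_bound x); assert (S2 := sin_sqr x).
unfold asin_arg; rewrite Csin_pair.
rewrite (Cmod_eq_sqr _ (cosh y + sin x)), (Cmod_eq_sqr _ (cosh y - sin x)).
- field.
- lra.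
- unfold Cminus, Cplus, Copp, RtoC, Re, Im; simpl.
  replace (cos x * sinh y + - 0) with (cos x * sinh y) by ring.
  replace (cos x * sinh y * (cos x * sinh y)) with ((1 - sin x * sin x) * (cosh y * cosh y - 1))
    by (rewrite C2, <- S2; ring). ring.
- lra.
- unfold Cminus, Cplus, Copp, RtoC, Re, Im; simpl.
  replace (cos x * sinh y + 0) with (cos x * sinh y) by ring.
  replace (cos x * sinh y * (cos x * sinh y)) with ((1 - sin x * sin x) * (cosh y * cosh y - 1))
    by (rewrite C2, <- S2; ring). ring.
Qed.

Lemma Casin_Csin (x y : R) : - (PI / 2) < x < PI / 2 -> Casin (Csin (x, y)) = (x, y).
Proof.
intros Hx; unfold Casin; rewrite asin_arg_Csin, asin_sin by lra.
assert (Hc : 0 < cos x) by (apply cos_gt_0; lra).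
replace (1 - sin x * sin x) with (cos x * cos x) by (rewrite <- (sin_sqr x); ring).
rewrite sqrt_square by lra.
rewrite Csin_pair; simpl Im.
replace (cos x * sinh y / cos x) with (sinh y) by (field; lra).
rewrite arcsinh_sinh; reflexivity.
Qed.

Lemma asin_arg_mult (u : C) : asin_arg u * ((Cmod (u + 1)%C + Cmod (u - 1)%C) / 2) = Re u.
Proof.
assert (P1 := Cmod_sqr (u + 1)%C); assert (P2 := Cmod_sqr (u - 1)%C).
unfold asin_arg.
replace ((Cmod (u + 1)%C - Cmod (u - 1)%C) / 2 * ((Cmod (u + 1)%C + Cmod (u - 1)%C) / 2)) with
  ((Cmod (u + 1)%C * Cmod (u + 1)%C - Cmod (u - 1)%C * Cmod (u - 1)%C) / 4) by field.
rewrite P1, P2; destruct u as [a b]; simpl; field.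
Qed.

(** Let X and Y be half the difference and half the sum of the distances to -1 and 1. Then X Y = Re
    u and (1 - X^2) (Y^2 - 1) = (Im u)^2, the equations satisfied by the sine and the hyperbolic
    cosine of the coordinates. *)
Lemma Csin_Casin (u : C) : -1 < asin_arg u < 1 -> Csin (Casin u) = u.
Proof.
intros HX; unfold Casin; rewrite Csin_pair.
set (X := asin_arg u) in *.
set (Y := (Cmod (u + 1)%C + Cmod (u - 1)%C) / 2).
assert (P1 := Cmod_sqr (u + 1)%C); assert (P2 := Cmod_sqr (u - 1)%C).
assert (T1 := Cmod_ge_0 (u + 1)%C); assert (T2 := Cmod_ge_0 (u - 1)%C).
assert (E1 : X * Y = Re u) by apply asin_arg_mult.
assert (E2 : (1 - X * X) * (Y * Y - 1) = Im u * Im u).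
{ assert (E : X * X + Y * Y = 1 + Re u * Re u + Im u * Im u).
  { unfold X, Y, asin_arg.
    replace ((Cmod (u + 1)%C - Cmod (u - 1)%C) / 2 * ((Cmod (u + 1)%C - Cmod (u - 1)%C) / 2) +
      (Cmod (u + 1)%C + Cmod (u - 1)%C) / 2 * ((Cmod (u + 1)%C + Cmod (u - 1)%C) / 2)) with
      ((Cmod (u + 1)%C * Cmod (u + 1)%C + Cmod (u - 1)%C * Cmod (u - 1)%C) / 2) by field.
    rewrite P1, P2; destruct u as [a b]; simpl; field. }
  rewrite <- E1 in E. nra. }
assert (HY : 0 <= Y) by (unfold Y; lra).
assert (Hq : 0 < 1 - X * X) by nra.
assert (Hs : 0 < sqrt (1 - X * X)) by (apply sqrt_lt_R0, Hq).
assert (Es : sqrt (1 - X * X) * sqrt (1 - X * X) = 1 - X * X) by (apply sqrt_sqrt; lra).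
set (t := Im u / sqrt (1 - X * X)).
assert (Et : t * t = Y * Y - 1).
{ unfold t. replace (Im u / sqrt (1 - X * X) * (Im u / sqrt (1 - X * X))) with
    (Im u * Im u / (sqrt (1 - X * X) * sqrt (1 - X * X))) by (field; lra).
  rewrite Es, <- E2; field; lra. }
rewrite sin_asin, sinh_arcsinh, cos_asin by lra.
replace (X²) with (X * X) by reflexivity.
assert (Ec : cosh (arcsinh t) = Y).
{ assert (C1 := cosh_sqr (arcsinh t)); rewrite sinh_arcsinh in C1.
  assert (C2 := cosh_ge_1 (arcsinh t)). nra. }
rewrite Ec, E1. unfold t.
replace (sqrt (1 - X * X) * (Im u / sqrt (1 - X * X))) with (Im u) by (field; lra).
destruct u; reflexivity.
Qed.

(** Each distance to a focus is 1-Lipschitz. The domain condition -1 < asin_arg u < 1 is therefore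
    open. *)
Lemma asin_arg_lipschitz (u h : C) : Rabs (asin_arg (u + h)%C - asin_arg u) <= Cmod h.
Proof.
unfold asin_arg.
assert (K : forall a, Rabs (Cmod (u + h + a)%C - Cmod (u + a)%C) <= Cmod h).
{ intros a; apply Rabs_le.
  assert (T1 := Cmod_triangle' (u + h + a)%C (u + a)%C).
  assert (T2 := Cmod_triangle' (u + a)%C (u + h + a)%C).
  replace (u + h + a - (u + a))%C with h in T1 by ring.
  replace (u + a - (u + h + a))%C with (- h)%C in T2 by ring.
  rewrite Cmod_opp in T2; lra. }
assert (K1 := K 1%C); assert (K2 := K (- (1))%C).
apply Rabs_le_between in K1; apply Rabs_le_between in K2; apply Rabs_le.
unfold Cminus; lra.
Qed.

Lemma Casin_continuous (u : C) : -1 < asin_arg u < 1 ->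
  forall eps, 0 < eps -> exists r, 0 < r /\ forall h, Cmod h < r -> Cmod (Casin (u + h) - Casin u)%C < eps.
Proof.
intros HX eps He.
assert (CX : continuous (U := R_UniformSpace) (fun v : C => asin_arg v) u).
{ intros P [d HP]. apply (locally_C u). exists d; intros y Hy; apply HP.
  change (Rabs (asin_arg y - asin_arg u) < d); change (Cmod (y - u)%C < d) in Hy.
  replace y with (u + (y - u))%C at 1 by ring.
  eapply Rle_lt_trans; [apply asin_arg_lipschitz|exact Hy]. }
assert (C1 : continuous (U := R_UniformSpace) (fun v : C => asin (asin_arg v)) u).
{ apply (continuous_comp (fun v : C => asin_arg v) asin); [exact CX|].
  apply continuity_pt_filterlim, derivable_continuous_pt, derivable_pt_asin; exact HX. }
assert (C2 : continuous (U := R_UniformSpace) (fun v : C => arcsinh (Im v / sqrt (1 - asin_arg v *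
  asin_arg v))) u).
{ apply (continuous_comp (fun v : C => Im v / sqrt (1 - asin_arg v * asin_arg v)) arcsinh).
  - apply (continuous_mult (K := R_AbsRing) (fun v : C => Im v) (fun v => / sqrt (1 - asin_arg v *
      asin_arg v))).
    + apply (continuous_snd (U := R_UniformSpace) (V := R_UniformSpace)).
    + apply (continuous_comp (fun v : C => sqrt (1 - asin_arg v * asin_arg v)) Rinv).
      * apply (continuous_comp (fun v : C => 1 - asin_arg v * asin_arg v) sqrt); [|apply continuous_sqrt].
        apply (continuous_minus (V := R_NormedModule) (fun _ => 1)); [apply continuous_const|].
        apply (continuous_mult (K := R_AbsRing)); exact CX.
      * apply continuous_Rinv, Rgt_not_eq, sqrt_lt_R0; nra.
  - apply continuity_pt_filterlim, derivable_continuous_pt.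
    eexists; apply derivable_pt_lim_arcsinh. }
assert (B : forall g : C -> R, continuous (U := R_UniformSpace) g u ->
  exists r, 0 < r /\ forall h, Cmod h < r -> Rabs (g (u + h)%C - g u) < eps / 2).
{ intros g Hg.
  assert (L : locally (g u) (fun y => Rabs (y - g u) < eps / 2)).
  { exists (mkposreal (eps / 2) ltac:(lra)); intros y Hy; exact Hy. }
  assert (L2 := Hg _ L). apply (locally_C u) in L2. destruct L2 as [d Hd].
  exists d; split; [apply cond_pos|]; intros h Hh; apply Hd.
  change (Cmod (u + h - u)%C < d). replace (u + h - u)%C with h by ring; exact Hh. }
destruct (B _ C1) as [r1 [Hr1 K1]]; destruct (B _ C2) as [r2 [Hr2 K2]].
exists (Rmin r1 r2); split; [apply Rmin_glb_lt; assumption|]; intros h Hh.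
specialize (K1 h (Rlt_le_trans _ _ _ Hh (Rmin_l _ _)));
  specialize (K2 h (Rlt_le_trans _ _ _ Hh (Rmin_r _ _))).
eapply Rle_lt_trans; [apply Cmod_le_Re_Im|].
assert (T := Rplus_lt_compat _ _ _ _ K1 K2).
replace (eps / 2 + eps / 2) with eps in T by field; exact T.
Qed.

Lemma PI2_gt_1 : 1 < PI / 2.
Proof. assert (H := PI2_1); lra. Qed.

Lemma in_disc_Re (z : C) : in_disc z -> -1 < Re z < 1.
Proof.
intros H; unfold in_disc in H; assert (T := re_le_Cmod z); apply Rabs_le_between in T; lra.
Qed.

Lemma Casin_Csin_disc (z : C) : in_disc z -> Casin (Csin z) = z.
Proof.
intros Hz; assert (T := in_disc_Re z Hz); assert (P := PI2_gt_1).
destruct z as [x y]; simpl in T; apply Casin_Csin; lra.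
Qed.

Lemma Cd_Casin (z : C) : in_disc z -> exists l, Cd Casin (Csin z) l.
Proof.
intros Hz; assert (T := in_disc_Re z Hz); assert (P := PI2_gt_1).
assert (HX : -1 < asin_arg (Csin z) < 1).
{ destruct z as [x y]; simpl in T; rewrite asin_arg_Csin.
  split; [replace (-1) with (sin (- (PI / 2))) by (rewrite sin_neg, sin_PI2; ring)|rewrite <- sin_PI2];
    apply sin_increasing_1; lra. }
exists (/ Ccos z)%C; apply (Cd_local_inverse Csin).
- apply Casin_continuous, HX.
- set (X := asin_arg (Csin z)) in *.
  exists (Rmin (1 - X) (1 + X)); split; [apply Rmin_glb_lt; lra|]; intros h Hh.
  assert (H1 := Rlt_le_trans _ _ _ Hh (Rmin_l _ _)); assert (H2 := Rlt_le_trans _ _ _ Hh (Rmin_r _ _)).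
  apply Csin_Casin. assert (L := asin_arg_lipschitz (Csin z) h); fold X in L.
  apply Rabs_le_between in L; lra.
- rewrite Casin_Csin_disc by exact Hz; apply Cd_Csin.
- intros E; destruct z as [x y]; simpl in T.
  assert (E2 := Re_Ccos x y); rewrite E in E2; simpl in E2.
  assert (0 < cos x) by (apply cos_gt_0; lra). assert (C1 := cosh_ge_1 y). nra.
Qed.

(** * Elementary inequalities for circular and hyperbolic functions *)

Lemma nonneg_from_derivative (f f' : R -> R) :
  (forall x, derivable_pt_lim f x (f' x)) -> (forall x, 0 <= x -> 0 <= f' x) -> 0 <= f 0 ->
  forall x, 0 <= x -> 0 <= f x.
Proof.
intros Hd Hp H0 x Hx.
destruct (MVT_gen f 0 x f') as [c [Hc E]].
- intros y _; apply is_derive_Reals, Hd.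
- intros y _; apply derivable_continuous_pt; eexists; apply Hd.
- rewrite Rmin_left, Rmax_right in Hc by exact Hx.
  assert (T := Hp c (proj1 Hc)). nra.
Qed.

(** Integrating cosh >= 1 three times gives the successive Taylor bounds. *)
Lemma sinh_ge_cubic (x : R) : 0 <= x -> x + x ^ 3 / 6 <= sinh x.
Proof.
assert (S : forall x, derivable_pt_lim sinh x (cosh x)) by apply derivable_pt_lim_sinh.
assert (Cc : forall x, derivable_pt_lim cosh x (sinh x)) by apply derivable_pt_lim_cosh.
assert (D1 : forall x, 0 <= x -> 0 <= sinh x - x).
{ apply (nonneg_from_derivative (fun x => sinh x - x) (fun x => cosh x - 1)).
  - intros y; apply derivable_pt_lim_minus; [apply S|apply derivable_pt_lim_id].
  - intros y _; assert (T := cosh_ge_1 y); lra.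
  - rewrite sinh_0; lra. }
assert (D2 : forall x, 0 <= x -> 0 <= cosh x - (1 + x ^ 2 / 2)).
{ apply (nonneg_from_derivative (fun x => cosh x - (1 + x ^ 2 / 2)) (fun x => sinh x - x));
    [|exact D1|rewrite cosh_0; lra].
  intros y; apply derivable_pt_lim_minus; [apply Cc|].
  apply is_derive_Reals; auto_derive; [exact I|field]. }
assert (D3 : forall x, 0 <= x -> 0 <= sinh x - (x + x ^ 3 / 6)).
{ apply (nonneg_from_derivative (fun x => sinh x - (x + x ^ 3 / 6)) (fun x => cosh x - (1 + x ^ 2 / 2)));
    [|exact D2|rewrite sinh_0; lra].
  intros y; apply derivable_pt_lim_minus; [apply S|]. apply is_derive_Reals; auto_derive; [exact I|field]. }
intros Hx; specialize (D3 x Hx); lra.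
Qed.

(** The half-argument formula reduces the bound, for either sign of [x], to |sinh (x / 2)| >= |x /
    2|. *)
Lemma cosh_ge_quadratic (x : R) : 1 + x ^ 2 / 2 <= cosh x.
Proof.
assert (E : cosh x = 1 + 2 * (sinh (x / 2) * sinh (x / 2))).
{ unfold cosh, sinh. replace x with (x / 2 + x / 2) at 1 by field.
  replace (- x) with (- (x / 2) + - (x / 2)) by field. rewrite !exp_plus.
  assert (E : exp (x / 2) * exp (- (x / 2)) = 1) by (rewrite <- exp_plus, Rplus_opp_r; apply exp_0). nra. }
rewrite E.
assert (Q : (x / 2) * (x / 2) <= sinh (x / 2) * sinh (x / 2)).
{ destruct (Rle_dec 0 (x / 2)) as [H|H].
  - assert (T := sinh_ge_cubic (x / 2) H). assert (0 <= (x / 2) ^ 3) by (apply pow_le, H). nra.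
  - assert (T := sinh_ge_cubic (- (x / 2)) ltac:(lra)).
    assert (0 <= (- (x / 2)) ^ 3) by (apply pow_le; lra).
    assert (sinh (- (x / 2)) = - sinh (x / 2)) by (unfold sinh; rewrite Ropp_involutive; field). nra. }
simpl in *; lra.
Qed.

Lemma cos_ge_quadratic (x : R) : 0 <= x -> 1 - x ^ 2 / 2 <= cos x.
Proof.
assert (S : forall x, derivable_pt_lim sin x (cos x)) by apply derivable_pt_lim_sin.
assert (Cc : forall x, derivable_pt_lim cos x (- sin x)) by apply derivable_pt_lim_cos.
assert (D1 : forall x, 0 <= x -> 0 <= x - sin x).
{ apply (nonneg_from_derivative (fun x => x - sin x) (fun x => 1 - cos x)).
  - intros y; apply derivable_pt_lim_minus; [apply derivable_pt_lim_id|apply S].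
  - intros y _; assert (T := COS_bound y); lra.
  - rewrite sin_0; lra. }
assert (D2 : forall x, 0 <= x -> 0 <= cos x - (1 - x ^ 2 / 2)).
{ apply (nonneg_from_derivative (fun x => cos x - (1 - x ^ 2 / 2)) (fun x => x - sin x));
    [|exact D1|rewrite cos_0; lra].
  intros y. replace (y - sin y) with (- sin y - (- y)) by ring.
  apply derivable_pt_lim_minus; [apply Cc|]. apply is_derive_Reals; auto_derive; [exact I|field]. }
intros Hx; specialize (D2 x Hx); lra.
Qed.

Lemma sin_ge_cubic (x : R) : 0 <= x -> x - x ^ 3 / 6 <= sin x.
Proof.
assert (D3 : forall x, 0 <= x -> 0 <= sin x - (x - x ^ 3 / 6)).
{ apply (nonneg_from_derivative (fun x => sin x - (x - x ^ 3 / 6)) (fun x => cos x - (1 - x ^ 2 / 2))).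
  - intros y; apply derivable_pt_lim_minus; [apply derivable_pt_lim_sin|].
    apply is_derive_Reals; auto_derive; [exact I|field].
  - intros y Hy; assert (T := cos_ge_quadratic y Hy); lra.
  - rewrite sin_0; lra. }
intros Hx; specialize (D3 x Hx); lra.
Qed.

Lemma sin_le_id (x : R) : 0 <= x -> sin x <= x.
Proof.
intros Hx.
assert (T := nonneg_from_derivative (fun x => x - sin x) (fun x => 1 - cos x)).
assert (0 <= x - sin x); [|lra].
apply T; [|intros y _; assert (C1 := COS_bound y); lra|rewrite sin_0; lra|exact Hx].
intros y; apply derivable_pt_lim_minus; [apply derivable_pt_lim_id|apply derivable_pt_lim_sin].
Qed.

Lemma sin_1_bounds : 0.8414709 <= sin 1 <= 0.841471.
Proof.
assert (P := PI2_gt_1).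
(* These are the Taylor sums of degrees 11 and 13. *)
assert (B := sin_bound 1 2 ltac:(lra) ltac:(lra)).
unfold sin_approx, sin_term in B.
(* Factorials are expanded as products of reals, so that 13! never appears as a unary numeral. *)
assert (F : forall n, INR (Factorial.fact (S n)) = (INR n + 1) * INR (Factorial.fact n)).
{ intros n; change (Factorial.fact (S n)) with (S n * Factorial.fact n)%nat; rewrite mult_INR, S_INR;
    reflexivity. }
cbn [sum_f_R0 Nat.add Nat.mul] in B.
rewrite !F in B.
cbn [Factorial.fact] in B; rewrite !pow1 in B; cbn [pow INR Nat.add Nat.mul] in B; lra.
Qed.

Lemma cos_1_le : cos 1 <= 0.54031.
Proof.
assert (E := sin_sqr 1); assert (B := sin_1_bounds).
assert (P := PI2_gt_1). assert (0 < cos 1) by (apply cos_gt_0; lra). nra.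
Qed.

(** * The criterion for starlikeness *)

Lemma sinh_cosh_Rabs (y : R) : sinh y * sinh y = sinh (Rabs y) * sinh (Rabs y) /\ cosh y = cosh (Rabs y).
Proof.
unfold Rabs; destruct (Rcase_abs y) as [_|_]; [|split; reflexivity].
unfold sinh, cosh; rewrite Ropp_involutive; split; field.
Qed.

(** With t = 1 - a, the factor cosh b gains at least t - t^2 / 2 while sin a loses about t cos 1.
    The gain wins to first order because sin 1 > cos 1; the numerical bounds absorb the higher terms
    for t <= 0.2. *)
Lemma sin_cosh_ge_sin_1 (a b : R) : 0.8 <= a <= 1 -> 1 <= a * a + b * b -> sin 1 <= sin a * cosh b.
Proof.
intros Ha Hab; assert (P := PI2_gt_1).
set (t := 1 - a); assert (Ht : 0 <= t <= 0.2) by (unfold t; lra).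
assert (Hs : 0 < sin a) by (apply sin_gt_0; lra).
assert (E : sin a = sin 1 * cos t - cos 1 * sin t).
{ replace a with (1 - t) by (unfold t; ring). rewrite sin_minus; ring. }
assert (C1 := cos_ge_quadratic t (proj1 Ht)); assert (S1 := sin_le_id t (proj1 Ht)).
assert (B1 := sin_1_bounds); assert (B2 := cos_1_le).
assert (B3 : 0 < cos 1) by (apply cos_gt_0; lra).
assert (L1 : sin 1 * (1 - t ^ 2 / 2) - cos 1 * t <= sin a).
{ rewrite E. assert (sin 1 * (1 - t ^ 2 / 2) <= sin 1 * cos t) by (apply Rmult_le_compat_l; lra).
  assert (cos 1 * sin t <= cos 1 * t) by (apply Rmult_le_compat_l; lra). lra. }
assert (L2 : 1 + t - t ^ 2 / 2 <= cosh b).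
{ assert (T := cosh_ge_quadratic b). unfold t in *. nra. }
assert (L0 : 0 <= 1 + t - t ^ 2 / 2) by nra.
apply Rle_trans with (sin a * (1 + t - t ^ 2 / 2)); [|apply Rmult_le_compat_l; lra].
apply Rle_trans with ((sin 1 * (1 - t ^ 2 / 2) - cos 1 * t) * (1 + t - t ^ 2 / 2));
  [|apply Rmult_le_compat_r; assumption].
set (s := sin 1) in *; set (c := cos 1) in *.
replace ((s * (1 - t ^ 2 / 2) - c * t) * (1 + t - t ^ 2 / 2)) with
  (s + t * (s * (1 - t - t ^ 2 / 2 + t ^ 3 / 4) - c * (1 + t - t ^ 2 / 2))) by field.
assert (Q1 : 0.78 <= 1 - t - t ^ 2 / 2 + t ^ 3 / 4).
{ assert (0 <= t ^ 3) by (apply pow_le; lra). nra. }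
assert (Q2 : 1 + t - t ^ 2 / 2 <= 1.2) by nra.
assert (s * 0.78 <= s * (1 - t - t ^ 2 / 2 + t ^ 3 / 4)) by (apply Rmult_le_compat_l; lra).
assert (c * (1 + t - t ^ 2 / 2) <= c * 1.2) by (apply Rmult_le_compat_l; lra).
nra.
Qed.

(** The right side is |sin (a + i b)|^2. In terms of A = a^2 and B = b^2 the cubic Taylor bounds
    become polynomials, and B >= 1 - A. *)
Lemma sin_sinh_sqr_ge (a b : R) : 0 <= a <= 0.8 -> 0 <= b -> 1 <= a * a + b * b ->
  0.9 <= sin a * sin a + sinh b * sinh b.
Proof.
intros Ha Hb Hab.
assert (S1 := sin_ge_cubic a (proj1 Ha)); assert (S2 := sinh_ge_cubic b Hb).
assert (T1 : (a - a ^ 3 / 6) * (a - a ^ 3 / 6) <= sin a * sin a).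
{ assert (0 <= a - a ^ 3 / 6) by (simpl; nra). apply Rmult_le_compat; assumption. }
assert (T2 : (b + b ^ 3 / 6) * (b + b ^ 3 / 6) <= sinh b * sinh b).
{ assert (0 <= b + b ^ 3 / 6) by (assert (0 <= b ^ 3) by (apply pow_le, Hb); lra).
  apply Rmult_le_compat; assumption. }
set (A := a * a) in *; set (B := b * b) in *.
assert (HA : 0 <= A <= 0.64) by (unfold A; nra).
assert (HB : 1 - A <= B) by lra.
replace ((a - a ^ 3 / 6) * (a - a ^ 3 / 6)) with (A - A * A / 3 + A * A * A / 36) in T1 by (unfold A;
  field).
replace ((b + b ^ 3 / 6) * (b + b ^ 3 / 6)) with (B + B * B / 3 + B * B * B / 36) in T2 by (unfold B;
  field).
assert (0 <= A * A * A) by (apply Rmult_le_pos; nra).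
assert (0 <= B * B * B) by (apply Rmult_le_pos; nra).
assert ((1 - A) * (1 - A) <= B * B) by (apply Rmult_le_compat; lra).
nra.
Qed.

(** If the preimage x + i y were outside the disc, then either |x| > 0.8, and the real part of [u]
    would reach sin 1, or |x| <= 0.8, and |u|^2 would reach 0.9. *)
Lemma sin_image_contains (u : C) :
  Rabs (Re u) < sin 1 -> Cmod u * Cmod u < 0.9 -> exists z, in_disc z /\ u = Csin z.
Proof.
intros Hre Hmod; assert (B1 := sin_1_bounds); assert (P := PI2_gt_1).
set (X := asin_arg u).
set (Y := (Cmod (u + 1)%C + Cmod (u - 1)%C) / 2).
assert (HY : 1 <= Y).
{ unfold Y; assert (T := Cmod_triangle (u + 1)%C (- (u - 1))%C); rewrite Cmod_opp in T.
  replace (u + 1 + - (u - 1))%C with (RtoC 2) in T by (apply injective_projections; simpl; ring).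
  rewrite Cmod_R, Rabs_pos_eq in T by lra; lra. }
assert (E1 : X * Y = Re u) by apply asin_arg_mult.
(* Because |X| Y = |Re u| < sin 1 < 1 <= Y. *)
assert (HX : -1 < X < 1).
{ apply Rabs_def2 in Hre. rewrite <- E1 in Hre. nra. }
assert (E := Csin_Casin u HX).
exists (Casin u); split; [|symmetry; exact E].
unfold Casin in *; fold X in E |- *.
set (y := arcsinh (Im u / sqrt (1 - X * X))) in *.
assert (Hx := asin_bound_lt X HX).
set (x := asin X) in *.
rewrite Csin_pair in E.
set (a := Rabs x); set (b := Rabs y).
assert (Ha0 : 0 <= a) by apply Rabs_pos; assert (Hb0 : 0 <= b) by apply Rabs_pos.
assert (Ha : a < PI / 2) by (apply Rabs_def1; lra).
destruct (sinh_cosh_Rabs y) as [Ey1 Ey2]; fold b in Ey1, Ey2.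
assert (Sa0 : 0 <= sin a) by (apply sin_ge_0; lra).
assert (Es : Rabs (sin x) = sin a).
{ unfold a; destruct (Rle_dec 0 x) as [H|H].
  - rewrite !(Rabs_pos_eq x) by exact H. apply Rabs_pos_eq, sin_ge_0; lra.
  - rewrite (Rabs_left x) by lra. rewrite sin_neg. apply Rabs_left, sin_lt_0_var; lra. }
assert (Cb := cosh_ge_1 b).
assert (R1 : sin a * cosh b < sin 1).
{ rewrite <- E in Hre; simpl in Hre. rewrite Rabs_mult, Es, Ey2, (Rabs_pos_eq (cosh b)) in Hre by lra.
  exact Hre. }
assert (R2 : sin a * sin a + sinh b * sinh b < 0.9).
{ rewrite Cmod_sqr, <- E in Hmod; simpl in Hmod.
  assert (Ess : sin a * sin a = sin x * sin x) by (rewrite <- Es, <- Rabs_mult; apply Rabs_pos_eq; nra).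
  rewrite Ess, <- Ey1. assert (C1 := cosh_sqr y); assert (S1 := sin_sqr x).
  replace (sin x * sin x + sinh y * sinh y) with (sin x * cosh y * (sin x * cosh y) + cos x * sinh y *
    (cos x * sinh y)); [exact Hmod|].
  replace (sin x * cosh y * (sin x * cosh y)) with (sin x * sin x * (cosh y * cosh y)) by ring.
  rewrite C1. transitivity (sin x * sin x + (sin x * sin x + cos x * cos x) * (sinh y * sinh y));
    [ring|rewrite S1; ring]. }
assert (Hab : a * a + b * b < 1).
{ destruct (Rlt_dec (a * a + b * b) 1) as [|Hn]; [assumption|exfalso].
  assert (Hn' : 1 <= a * a + b * b) by lra.
  assert (a1 : a < 1).
  { destruct (Rlt_dec a 1) as [|Hn1]; [assumption|exfalso].
    assert (sin 1 <= sin a) by (apply sin_incr_1; lra). nra. }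
  destruct (Rle_dec a 0.8) as [H|H].
  - assert (T := sin_sinh_sqr_ge a b (conj Ha0 H) Hb0 Hn'); lra.
  - assert (T := sin_cosh_ge_sin_1 a b ltac:(lra) Hn'); lra. }
unfold in_disc.
assert (T := Cmod_ge_0 (x, y)); assert (S := Cmod_sqr (x, y)); simpl in S.
assert (Ea : a * a = x * x) by (unfold a; rewrite <- Rabs_mult; apply Rabs_pos_eq; nra).
assert (Eb : b * b = y * y) by (unfold b; rewrite <- Rabs_mult; apply Rabs_pos_eq; nra).
nra.
Qed.

(** A real value forces cos x sinh y = 0 with cos x > 0, so the argument is real and exceeds -1.
    This is what makes the radii sharp. *)
Lemma sin_image_real (c : R) (z : C) : in_disc z -> RtoC c = Csin z -> - sin 1 < c.
Proof.
intros Hz E; assert (T := in_disc_Re z Hz); assert (P := PI2_gt_1).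
destruct z as [x y]; simpl in T; rewrite Csin_pair in E; injection E as E1 E2.
assert (0 < cos x) by (apply cos_gt_0; lra).
assert (S0 : sinh y = 0) by nra.
assert (C1 := cosh_sqr y); assert (C2 := cosh_ge_1 y); rewrite S0 in C1.
assert (C3 : cosh y = 1) by nra.
rewrite E1, C3, Rmult_1_r, <- sin_neg. apply sin_increasing_1; lra.
Qed.

Lemma Csin_0 : Csin 0%C = 0%C.
Proof. change (RtoC 0) with ((0, 0) : C). rewrite Csin_pair, sin_0, sinh_0; f_equal; ring. Qed.

Lemma Cd_ext_disc (f g : C -> C) (z l : C) :
  in_disc z -> (forall y, in_disc y -> f y = g y) -> Cd f z l -> Cd g z l.
Proof.
intros Hz E; apply Cd_ext_loc; exists (1 - Cmod z); unfold in_disc in *; split; [lra|].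
intros y Hy; apply E.
assert (T := Cmod_triangle (y - z)%C z). replace (y - z + z)%C with y in T by ring; lra.
Qed.

(** * Reduction of the radius to a pointwise condition *)

Definition schwarz_map (w : C -> C) : Prop :=
  analytic w /\ (forall z, in_disc z -> in_disc (w z)) /\ w 0%C = 0%C.

(** Here 1 + u is z f' / f with the singularity at 0 removed; the product form of the equation is
    meaningful at 0 as well. *)
Definition starlike_data (f u : C -> C) : Prop :=
  classA f /\ analytic u /\ u 0%C = 0%C /\
  (forall z, in_disc z -> z <> 0%C -> f z <> 0%C) /\
  (forall z, in_disc z -> z * C_derive f z = f z * (1 + u z))%C.

Lemma RtoC_neq_0 (r : R) : r <> 0 -> RtoC r <> 0%C.
Proof. intros H E; injection E; exact H. Qed.

Lemma Cd_scale_arg (f : C -> C) (r : R) (z l : C) :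
  Cd f (RtoC r * z)%C l -> Cd (fun y => f (RtoC r * y))%C z (l * RtoC r)%C.
Proof.
intros H; apply (Cd_comp f (fun y => RtoC r * y)%C); [exact H|].
eapply Cd_eq; [apply Cd_scal, Cd_id|ring].
Qed.

Lemma Cd_dilate (f : C -> C) (r : R) (z l : C) :
  0 < r -> Cd f (RtoC r * z)%C l -> Cd (dilate r f) z l.
Proof.
intros Hr H; assert (N : RtoC r <> 0%C) by (apply RtoC_neq_0; lra).
apply Cd_ext with (fun y => / RtoC r * f (RtoC r * y))%C.
- intros y; unfold dilate, Cdiv; ring.
- eapply Cd_eq; [apply Cd_scal, Cd_scale_arg, H|field; exact N].
Qed.

Lemma scale_in_disc (r : R) (z : C) : 0 < r <= 1 -> in_disc z -> Cmod (RtoC r * z)%C < r.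
Proof.
unfold in_disc; intros Hr Hz; rewrite Cmod_mult, Cmod_R, Rabs_pos_eq by lra; nra.
Qed.

Lemma classA_dilate (f : C -> C) (r : R) : 0 < r <= 1 -> classA f -> classA (dilate r f).
Proof.
intros Hr [Af [f0 f1]]; assert (N : RtoC r <> 0%C) by (apply RtoC_neq_0; lra).
split; [|split].
- intros z Hz; assert (T := scale_in_disc r z Hr Hz).
  eapply Cd_ex, Cd_dilate; [lra|apply Cd_C_derive, Af; unfold in_disc; lra].
- unfold dilate; replace (RtoC r * RtoC 0)%C with (RtoC 0) by ring; rewrite f0; field; exact N.
- apply is_C_derive_unique, Cd_dilate; [lra|].
  replace (RtoC r * RtoC 0)%C with (RtoC 0) by ring; rewrite <- f1; apply Cd_C_derive, Af, in_disc_0.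
Qed.

(** For the converse direction the Schwarz function is [Casin] composed with the dilated [u]:
    pointwise membership in the image of the disc makes it analytic and sends it into the disc. *)
Lemma starlike_dilate_iff (f u : C -> C) (r : R) : starlike_data f u -> 0 < r <= 1 ->
  (starlike_sin (dilate r f) <-> forall z, Cmod z < r -> exists y, in_disc y /\ u z = Csin y).
Proof.
intros [Cf [Au [u0 [Hn He]]]] Hr; assert (N : RtoC r <> 0%C) by (apply RtoC_neq_0; lra).
assert (Dd : forall z, Cmod (RtoC r * z)%C < 1 -> C_derive (dilate r f) z = C_derive f (RtoC r * z)%C).
{ intros z Hz; apply is_C_derive_unique, Cd_dilate; [lra|]; apply Cd_C_derive, (proj1 Cf), Hz. }
assert (Q : forall z, in_disc z -> z <> 0%C -> dilate r f z <> 0%C /\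
  (z * C_derive (dilate r f) z / dilate r f z)%C = (1 + u (RtoC r * z))%C).
{ intros z Hz Hz0; assert (T := scale_in_disc r z Hr Hz).
  assert (Hd : in_disc (RtoC r * z)%C) by (unfold in_disc; lra).
  assert (Fn : f (RtoC r * z)%C <> 0%C) by (apply Hn; [exact Hd|apply Cmult_neq_0; assumption]).
  rewrite Dd by exact Hd.
  assert (E := He _ Hd); unfold dilate; split.
  - intros E0; apply Fn. replace (f (r * z)%C) with (f (r * z) / r * r)%C by (field; exact N).
    rewrite E0; ring.
  - transitivity (RtoC r * z * C_derive f (RtoC r * z) / f (RtoC r * z))%C; [field; split; assumption|].
    rewrite E; field; exact Fn. }
split.
- intros [_ [h [Hh [Ah [w [Aw [Dw [w0 E]]]]]]]] z Hz.
  destruct (Ceq_dec z (RtoC 0)) as [->|Hz0].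
  { exists (RtoC 0); split; [apply in_disc_0|rewrite u0, Csin_0; reflexivity]. }
  set (y := (z / RtoC r)%C).
  assert (Ey : (RtoC r * y)%C = z) by (unfold y; field; exact N).
  assert (Hy : in_disc y).
  { unfold in_disc, y; rewrite Cmod_div by exact N; rewrite Cmod_R, Rabs_pos_eq by lra.
    apply Rmult_lt_reg_r with r; [lra|]; unfold Rdiv; rewrite Rmult_assoc, Rinv_l by lra; lra. }
  assert (Hy0 : y <> 0%C) by (intros E0; apply Hz0; rewrite <- Ey, E0; ring).
  exists (w y); split; [apply Dw, Hy|].
  destruct (Hh y Hy Hy0) as [_ E1]; destruct (Q y Hy Hy0) as [_ E2].
  rewrite E, E2, Ey in E1 by exact Hy; unfold phi_sin in E1.
  replace (u z) with (1 + u z - 1)%C by ring; rewrite <- E1; ring.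
- intros K; split; [apply classA_dilate; [exact Hr|exact Cf]|].
  exists (fun z => 1 + u (RtoC r * z))%C; split.
  { intros z Hz Hz0; destruct (Q z Hz Hz0) as [Q1 Q2]; split; [exact Q1|symmetry; exact Q2]. }
  assert (Aur : forall z, in_disc z -> exists l, Cd (fun z => u (RtoC r * z))%C z l).
  { intros z Hz; assert (T := scale_in_disc r z Hr Hz).
    destruct (analytic_Cd u (RtoC r * z)%C Au) as [l Hl]; [unfold in_disc; lra|].
    eexists; apply Cd_scale_arg, Hl. }
  split.
  { intros z Hz; destruct (Aur z Hz) as [l Hl]; eapply Cd_ex.
    apply (Cd_plus (fun _ => 1%C)); [apply Cd_const|exact Hl]. }
  exists (fun z => Casin (u (RtoC r * z)))%C; split; [|split; [|split]].
  + intros z Hz; destruct (Aur z Hz) as [l Hl].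
    destruct (K _ (scale_in_disc r z Hr Hz)) as [y [Hy Ey]].
    destruct (Cd_Casin y Hy) as [l' Hl']; rewrite <- Ey in Hl'.
    eapply Cd_ex, (Cd_comp Casin (fun z => u (RtoC r * z))%C); [exact Hl'|exact Hl].
  + intros z Hz; destruct (K _ (scale_in_disc r z Hr Hz)) as [y [Hy Ey]].
    rewrite Ey, Casin_Csin_disc by exact Hy; exact Hy.
  + replace (RtoC r * RtoC 0)%C with (RtoC 0) by ring.
    rewrite u0; rewrite <- Csin_0 at 1; apply Casin_Csin_disc, in_disc_0.
  + intros z Hz; destruct (K _ (scale_in_disc r z Hr Hz)) as [y [Hy Ey]].
    unfold phi_sin; rewrite Ey, Casin_Csin_disc by exact Hy; reflexivity.
Qed.

(** The open disc whose radius is the supremum of the admissible numbers is the union of the smaller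
    ones, and the pointwise condition passes to this union. The supremum is therefore admissible. *)
Lemma rho_exists (f u : C -> C) (R0 : R) : starlike_data f u -> 0 < R0 <= 1 ->
  (forall z, Cmod z < R0 -> exists y, in_disc y /\ u z = Csin y) ->
  exists rho, is_rho starlike_sin f rho /\ R0 <= rho.
Proof.
intros Hf HR HK.
assert (A0 : admissible starlike_sin f R0).
{ split; [exact HR|]; intros r Hr. apply (starlike_dilate_iff f u r Hf); [lra|].
  intros z Hz; apply HK; lra. }
destruct (completeness (admissible starlike_sin f)) as [rho [H1 H2]].
- exists 1; intros x [Hx _]; lra.
- exists R0; exact A0.
- assert (HRr : R0 <= rho) by (apply H1, A0).
  assert (Hr1 : rho <= 1) by (apply H2; intros x [Hx _]; lra).
  exists rho; split; [|exact HRr]; split; [|intros x Hx; apply H1, Hx].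
  split; [lra|]; intros r Hr.
  apply (starlike_dilate_iff f u r Hf); [lra|]; intros z Hz.
  assert (Ex : exists x, admissible starlike_sin f x /\ Cmod z < x).
  { apply NNPP; intros Hno.
    assert (Hub : rho <= Cmod z); [|lra].
    apply H2; intros x Hx; apply Rnot_lt_le; intros Hlt; apply Hno; exists x; split; assumption. }
  destruct Ex as [x [[Hx1 Hx2] Hzx]].
  assert (S := Hx2 x ltac:(lra)).
  exact (proj1 (starlike_dilate_iff f u x Hf Hx1) S z Hzx).
Qed.

(** The second hypothesis caps the infimum: were rho_f of the given function larger than [R0], a
    point -t between the two radii would carry a real value at most -sin 1, which sin does not take
    on the disc. *)
Lemma is_radius_intro (M : (C -> C) -> Prop) (R0 : R) : 0 < R0 < 1 ->
  (forall f, M f -> exists u, starlike_data f u /\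
     forall z, Cmod z < R0 -> exists y, in_disc y /\ u z = Csin y) ->
  (exists f, M f /\ forall u, starlike_data f u -> forall t, R0 < t < 1 ->
     exists c, u (RtoC (- t)) = RtoC c /\ c <= - sin 1) ->
  is_radius starlike_sin M R0.
Proof.
intros HR HM [f0 [Hf0 Hext]]; split.
- intros f Hf; destruct (HM f Hf) as [u [Hu HK]].
  destruct (rho_exists f u R0 Hu ltac:(lra) HK) as [rho [Hrho _]]; exists rho; exact Hrho.
- split.
  + intros x [f [Hf Hx]]; destruct (HM f Hf) as [u [Hu HK]]; simpl.
    destruct (rho_exists f u R0 Hu ltac:(lra) HK) as [rho [[Hrho _] Hle]].
    eapply Rle_trans; [exact Hle|apply Hx, Hrho].
  + intros b Hb; destruct (HM f0 Hf0) as [u [Hu HK]].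
    destruct (rho_exists f0 u R0 Hu ltac:(lra) HK) as [rho [Hrho Hle]].
    assert (T := Hb rho (ex_intro _ f0 (conj Hf0 Hrho))).
    replace R0 with rho; [exact T|].
    apply Rle_antisym; [|exact Hle]; apply Rnot_lt_le; intros Hlt.
    destruct Hrho as [[Hr Ha] _].
    assert (S := Ha rho ltac:(lra)).
    assert (S1 := proj1 (starlike_dilate_iff f0 u rho Hu Hr) S).
    set (t := (R0 + rho) / 2).
    destruct (S1 (RtoC (- t))) as [y [Hy Ey]].
    { rewrite Cmod_R, Rabs_Ropp, Rabs_pos_eq; unfold t; lra. }
    destruct (Hext u Hu t) as [c [Ec Hc]]; [unfold t; lra|].
    rewrite Ec in Ey; assert (Q := sin_image_real c y Hy Ey); lra.
Qed.

(** * Logarithmic derivatives *)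

(** This describes the derivative of log phi without choosing a branch of the logarithm. *)
Definition log_derivative (phi L : C -> C) : Prop :=
  forall y, in_disc y -> phi y <> 0%C /\ Cd phi y (phi y * L y)%C.

Definition log_term (L w : C -> C) (z : C) : C := (z * C_derive w z * L (w z))%C.

Lemma log_derivative_analytic (phi L : C -> C) : log_derivative phi L -> analytic phi.
Proof. intros H z Hz; eapply Cd_ex, H, Hz. Qed.

Lemma log_derivative_subord (phi L h : C -> C) : log_derivative phi L -> subord h phi ->
  exists w, schwarz_map w /\ forall z, in_disc z ->
    h z <> 0%C /\ Cd h z (h z * (C_derive w z * L (w z)))%C.
Proof.
intros HL [Ah [w [Aw [Dw [w0 E]]]]]; exists w; split; [split; [exact Aw|split; assumption]|].
intros z Hz; destruct (HL (w z) (Dw z Hz)) as [N D]; rewrite E by exact Hz; split; [exact N|].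
apply Cd_ext_disc with (fun z => phi (w z)); [exact Hz|intros y Hy; symmetry; apply E, Hy|].
eapply Cd_eq; [apply (Cd_comp phi w); [exact D|apply Cd_C_derive, Aw, Hz]|ring].
Qed.

Lemma classT_starlike_data (phi psi Lphi Lpsi f : C -> C) :
  log_derivative phi Lphi -> log_derivative psi Lpsi -> classT phi psi f ->
  exists u w1 w2 w3, starlike_data f u /\ schwarz_map w1 /\ schwarz_map w2 /\ schwarz_map w3 /\
    forall z, in_disc z -> u z = (log_term Lphi w1 z + log_term Lphi w2 z + log_term Lpsi w3 z)%C.
Proof.
intros Hphi Hpsi [Cf [g [p [Cg [Sp [[h1 [Q1 S1]] [h2 [Q2 S2]]]]]]]].
destruct (log_derivative_subord _ _ _ Hphi S1) as [w1 [W1 D1]].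
destruct (log_derivative_subord _ _ _ Hphi S2) as [w2 [W2 D2]].
destruct (log_derivative_subord _ _ _ Hpsi Sp) as [w3 [W3 D3]].
set (F := fun z => (h1 z * h2 z * p z)%C).
set (T := fun z => (C_derive w1 z * Lphi (w1 z) + C_derive w2 z * Lphi (w2 z) + C_derive w3 z * Lpsi (w3
  z))%C).
assert (NF : forall z, in_disc z -> F z <> 0%C).
{ intros z Hz; repeat apply Cmult_neq_0; [apply D1|apply D2|apply D3]; exact Hz. }
assert (DF : forall z, in_disc z -> Cd F z (F z * T z)%C).
{ intros z Hz; destruct (D1 z Hz) as [_ E1], (D2 z Hz) as [_ E2], (D3 z Hz) as [_ E3].
  eapply Cd_eq; [apply (Cd_mult (fun z => h1 z * h2 z)%C p); [apply Cd_mult; eassumption|exact E3]|].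
  unfold F, T; ring. }
assert (Ef : forall z, in_disc z -> (z * F z)%C = f z).
{ intros z Hz; destruct (Ceq_dec z (RtoC 0)) as [->|Hz0].
  - destruct Cf as [_ [f0 _]]; rewrite f0; ring.
  - destruct (Q1 z Hz Hz0) as [N1 E1], (Q2 z Hz Hz0) as [N2 E2]; unfold F.
    rewrite E1, E2. field. split; [|split]; [| |exact N1].
    + intros E; apply N2; rewrite E; ring.
    + intros E; apply N2; rewrite E; ring. }
assert (Af : analytic F) by (intros z Hz; eapply Cd_ex, DF, Hz).
assert (Dder : forall z, in_disc z -> C_derive F z = (F z * T z)%C)
  by (intros z Hz; apply is_C_derive_unique, DF, Hz).
(* The quotient F' / F is preferred to [T]: its analyticity follows from that of [F] and F', with no
   regularity asked of [Lphi] and [Lpsi]. *)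
exists (fun z => z * (C_derive F z / F z))%C, w1, w2, w3.
assert (Eu : forall z, in_disc z -> (z * (C_derive F z / F z))%C = (z * T z)%C).
{ intros z Hz; rewrite Dder by exact Hz; field; apply NF, Hz. }
split; [|split; [exact W1|split; [exact W2|split; [exact W3|]]]].
- split; [exact Cf|split; [|split; [ring|split]]].
  + intros z Hz; destruct (analytic_Cd _ z (analytic_derive F Af) Hz) as [l Hl].
    eapply Cd_ex, (Cd_mult (fun z => z)); [apply Cd_id|].
    apply Cd_div; [exact Hl|apply DF, Hz|apply NF, Hz].
  + intros z Hz Hz0; rewrite <- Ef by exact Hz; apply Cmult_neq_0; [exact Hz0|apply NF, Hz].
  + intros z Hz; rewrite Eu by exact Hz.
    assert (D : C_derive f z = (F z + z * (F z * T z))%C).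
    { apply is_C_derive_unique, Cd_ext_disc with (fun z => z * F z)%C; [exact Hz|exact Ef|].
      eapply Cd_eq; [apply (Cd_mult (fun z => z) F); [apply Cd_id|apply DF, Hz]|cbv beta; ring]. }
    rewrite D, <- Ef by exact Hz; ring.
- intros z Hz; rewrite Eu by exact Hz; unfold T, log_term; ring.
Qed.

Lemma subord_refl (phi : C -> C) : analytic phi -> subord phi phi.
Proof.
intros H; split; [exact H|]; exists (fun z => z); split; [|split; [|split]]; auto.
intros z _; eapply Cd_ex, Cd_id.
Qed.

Lemma classA_id_mult (F : C -> C) : analytic F -> F 0%C = 1%C -> classA (fun z => z * F z)%C.
Proof.
intros AF F0; split; [|split].
- intros z Hz; destruct (AF z Hz) as [l Hl].
  eapply Cd_ex, (Cd_mult (fun z => z) F); [apply Cd_id|exact Hl].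
- ring.
- destruct (AF _ in_disc_0) as [l Hl]. apply is_C_derive_unique.
  eapply Cd_eq; [apply (Cd_mult (fun z => z) F); [apply Cd_id|exact Hl]|cbv beta; rewrite F0; ring].
Qed.

Lemma analytic_mult (f g : C -> C) : analytic f -> analytic g -> analytic (fun z => f z * g z)%C.
Proof.
intros Hf Hg z Hz; destruct (Hf z Hz) as [a Ha], (Hg z Hz) as [b Hb].
eapply Cd_ex, Cd_mult; eassumption.
Qed.

(* The extremal function takes every Schwarz function to be the identity. *)
Lemma classT_extremal (phi psi Lphi Lpsi : C -> C) :
  log_derivative phi Lphi -> log_derivative psi Lpsi -> phi 0%C = 1%C -> psi 0%C = 1%C ->
  exists f, classT phi psi f /\ forall u, starlike_data f u -> forall z, in_disc z -> z <> 0%C ->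
    u z = (z * (RtoC 2 * Lphi z + Lpsi z))%C.
Proof.
intros Hphi Hpsi phi0 psi0.
assert (Aphi := log_derivative_analytic _ _ Hphi); assert (Apsi := log_derivative_analytic _ _ Hpsi).
set (G := fun z => (psi z * phi z)%C).
set (F := fun z => (G z * phi z)%C).
assert (AG : analytic G) by (apply analytic_mult; assumption).
assert (AF : analytic F) by (apply analytic_mult; assumption).
assert (NG : forall z, in_disc z -> G z <> 0%C).
{ intros z Hz; apply Cmult_neq_0; [apply Hpsi|apply Hphi]; exact Hz. }
exists (fun z => z * F z)%C; split.
- split; [apply classA_id_mult; [exact AF|unfold F, G; rewrite phi0, psi0; ring]|].
  exists (fun z => z * G z)%C, psi; split; [|split; [apply subord_refl, Apsi|split]].
  + apply classA_id_mult; [exact AG|unfold G; rewrite phi0, psi0; ring].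
  + exists phi; split; [|apply subord_refl, Aphi].
    intros z Hz Hz0; assert (N := NG z Hz); split; [apply Cmult_neq_0; assumption|].
    unfold F; field; split; assumption.
  + exists phi; split; [|apply subord_refl, Aphi].
    intros z Hz Hz0; assert (N := proj1 (Hpsi z Hz)); split; [apply Cmult_neq_0; assumption|].
    unfold G; field; split; assumption.
- intros u [_ [_ [_ [Hn He]]]] z Hz Hz0.
  assert (N := Hn z Hz Hz0); assert (E := He z Hz).
  destruct (Hphi z Hz) as [_ Dphi], (Hpsi z Hz) as [_ Dpsi].
  assert (D : C_derive (fun z => z * F z)%C z = (F z * (1 + z * (RtoC 2 * Lphi z + Lpsi z)))%C).
  { apply is_C_derive_unique; eapply Cd_eq.
    - apply (Cd_mult (fun z => z) F); [apply Cd_id|].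
      apply (Cd_mult G phi); [apply (Cd_mult psi phi); eassumption|exact Dphi].
    - unfold F, G; ring. }
  rewrite D in E.
  replace (u z) with (z * F z * (1 + u z) / (z * F z) - 1)%C by (field; split; [|exact Hz0]; intros F0;
    apply N; rewrite F0; ring).
  rewrite <- E; field; split; [|exact Hz0]; intros F0; apply N; rewrite F0; ring.
Qed.

(** * The three logarithmic derivatives and the bounds on their terms *)

Definition L_exp (_ : C) : C := 1%C.
Definition L_sqrt (y : C) : C := (/ (RtoC 2 * (1 + y)))%C.
Definition L_lune (y : C) : C := (/ Csqrt (1 + y * y))%C.

Lemma log_derivative_exp : log_derivative Cexp L_exp.
Proof.
intros y _; split; [apply Cexp_neq_0|].
eapply Cd_eq; [apply Cd_Cexp|unfold L_exp; ring].
Qed.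

Lemma Csqrt_neq_0 (z : C) : 0 < Re (Csqrt z) -> Csqrt z <> 0%C.
Proof. intros H E; rewrite E in H; simpl in H; lra. Qed.

Lemma Re_Csqrt_one_plus (y : C) : in_disc y -> 0 < Re (Csqrt (1 + y)%C).
Proof.
intros Hy; apply Re_Csqrt_gt0; left; assert (T := in_disc_Re y Hy).
change (0 < 1 + Re y); lra.
Qed.

Lemma sqr_in_disc (y : C) : in_disc y -> in_disc (y * y)%C.
Proof. unfold in_disc; intros Hy; rewrite Cmod_mult; assert (T := Cmod_ge_0 y); nra. Qed.

Lemma log_derivative_sqrt : log_derivative phi_sqrt L_sqrt.
Proof.
intros y Hy; assert (P := Re_Csqrt_one_plus y Hy); assert (N := Csqrt_neq_0 _ P).
split; [exact N|].
assert (D : Cd (fun y => 1 + y)%C y 1%C).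
{ eapply Cd_eq; [apply (Cd_plus (fun _ => 1%C)); [apply Cd_const|apply Cd_id]|ring]. }
eapply Cd_eq; [apply (Cd_comp Csqrt (fun y => 1 + y)%C); [apply Cd_Csqrt, P|exact D]|].
(* The third occurrence of 1 + y is the one outside the roots; as the square of the root it makes
   both sides rational in that root. *)
unfold L_sqrt, phi_sqrt; rewrite <- (Csqrt_sqr (1 + y)) at 3; field; exact N.
Qed.

Lemma log_derivative_lune : log_derivative phi_lune L_lune.
Proof.
intros y Hy; assert (P := Re_Csqrt_one_plus _ (sqr_in_disc y Hy)); assert (N := Csqrt_neq_0 _ P).
assert (S := Csqrt_sqr (1 + y * y)).
split.
(* A zero would make the root equal to -y, hence 1 + y^2 = y^2. *)
- intros E; unfold phi_lune in E.
  assert (E1 : Csqrt (1 + y * y) = (- y)%C).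
  { replace (Csqrt (1 + y * y)) with (y + Csqrt (1 + y * y) - y)%C by ring; rewrite E; ring. }
  rewrite E1 in S.
  assert (E2 : RtoC 1 = RtoC 0).
  { replace (RtoC 1) with (1 + y * y - y * y)%C by ring; rewrite <- S; ring. }
  injection E2; lra.
- assert (D : Cd (fun y => 1 + y * y)%C y (RtoC 2 * y)%C).
  { eapply Cd_eq; [apply (Cd_plus (fun _ => 1%C));
      [apply Cd_const|apply (Cd_mult (fun y => y) (fun y => y)); apply Cd_id]|].
    cbv beta; ring. }
  eapply Cd_eq; [apply (Cd_plus (fun y => y)); [apply Cd_id|apply (Cd_comp Csqrt (fun y => 1 + y * y)%C);
    [apply Cd_Csqrt, P|exact D]]|].
  unfold L_lune, phi_lune; field; exact N.
Qed.

Lemma schwarz_map_bounds (w : C -> C) (z : C) : schwarz_map w -> in_disc z ->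
  Cmod (w z) <= Cmod z /\
  Cmod (z * C_derive w z - w z)%C * (1 - Cmod z * Cmod z) <= Cmod z * Cmod z - Cmod (w z) * Cmod (w z) /\
  Cmod (z * C_derive w z)%C <= Cmod (z * C_derive w z - w z)%C + Cmod (w z).
Proof.
intros [A [D W0]] Hz; split; [apply schwarz; assumption|split; [apply dieudonne; assumption|]].
assert (T := Cmod_triangle (z * C_derive w z - w z)%C (w z)).
replace (z * C_derive w z - w z + w z)%C with (z * C_derive w z)%C in T by ring; exact T.
Qed.

(* The hypothesis on [z] says [|z| <= sqrt 2 - 1]; beyond that the identity is no longer extremal. *)
Lemma schwarz_map_derivative_bound (w : C -> C) (z : C) : schwarz_map w ->
  Cmod z * Cmod z + 2 * Cmod z <= 1 -> Cmod (z * C_derive w z)%C <= Cmod z.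
Proof.
intros Hw Hr; assert (Hr0 := Cmod_ge_0 z).
assert (Hz : in_disc z) by (unfold in_disc; nra).
destruct (schwarz_map_bounds w z Hw Hz) as [B1 [B2 B3]].
assert (Hw0 := Cmod_ge_0 (w z)).
set (r := Cmod z) in *; set (q := Cmod (w z)) in *; set (d := Cmod (z * C_derive w z - w z)%C) in *.
(* The left side is at most r^2 - q^2 + q (1 - r^2), which increases in q up to (1 - r^2) / 2. By
   hypothesis that is at least r, and at q = r the value is r (1 - r^2). *)
assert (K : (d + q) * (1 - r * r) <= r * (1 - r * r)) by nra.
assert (0 < 1 - r * r) by (unfold in_disc in Hz; fold r in Hz; nra).
apply Rmult_le_reg_r in K; lra.
Qed.

Lemma log_term_exp_bound (w : C -> C) (z : C) : schwarz_map w ->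
  Cmod z * Cmod z + 2 * Cmod z <= 1 -> Cmod (log_term L_exp w z) <= Cmod z.
Proof.
intros Hw Hr; unfold log_term, L_exp; rewrite Cmult_1_r; apply schwarz_map_derivative_bound; assumption.
Qed.

(** With r = |z| and q = |w z|, r (1 + r) (1 - q) exceeds r^2 - q^2 + q (1 - r^2) by (r - q) (1 - q)
    >= 0. The factor 1 - q then cancels against |1 + w| >= 1 - q, so no restriction on [z]
    arises. *)
Lemma log_term_sqrt_bound (w : C -> C) (z : C) : schwarz_map w -> in_disc z ->
  Cmod (log_term L_sqrt w z) <= Cmod z / (2 * (1 - Cmod z)).
Proof.
intros Hw Hz; assert (Hr0 := Cmod_ge_0 z).
destruct (schwarz_map_bounds w z Hw Hz) as [B1 [B2 B3]].
assert (Hw0 := Cmod_ge_0 (w z)); unfold in_disc in Hz.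
assert (N : 1 - Cmod (w z) <= Cmod (1 + w z)%C).
{ assert (T := Cmod_triangle' (RtoC 1) (- w z)%C). rewrite Cmod_1, Cmod_opp in T.
  replace (1 - - w z)%C with (1 + w z)%C in T by ring; exact T. }
assert (N0 : (1 + w z)%C <> 0%C) by (apply Cmod_gt_0; lra).
unfold log_term, L_sqrt.
rewrite Cmod_mult, Cmod_inv by (apply Cmult_neq_0; [exact RtoC_2_neq|exact N0]).
rewrite (Cmod_mult (RtoC 2)), Cmod_R, Rabs_pos_eq by lra.
set (r := Cmod z) in *; set (q := Cmod (w z)) in *; set (d := Cmod (z * C_derive w z - w z)%C) in *.
set (m := Cmod (1 + w z)%C) in *; set (v := Cmod (z * C_derive w z)%C) in *.
assert (K : v * (1 - r) <= r * (1 - q)).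
{ assert (K1 : (d + q) * (1 - r * r) <= (r * (1 + r)) * (1 - q)) by nra.
  assert (K2 : (d + q) * (1 - r) * (1 + r) <= r * (1 - q) * (1 + r)) by nra.
  apply Rmult_le_reg_r in K2; nra. }
apply Rmult_le_reg_r with (2 * m * (2 * (1 - r))); [apply Rmult_lt_0_compat; lra|].
replace (v * / (2 * m) * (2 * m * (2 * (1 - r)))) with (2 * (v * (1 - r))) by (field; lra).
replace (r / (2 * (1 - r)) * (2 * m * (2 * (1 - r)))) with (2 * (r * m)) by (field; lra).
nra.
Qed.

Lemma Cmod_Csqrt_sqr (z : C) : Cmod (Csqrt z) * Cmod (Csqrt z) = Cmod z.
Proof. rewrite <- Cmod_mult, Csqrt_sqr; reflexivity. Qed.

Lemma one_plus_sqr_ge (y : C) : 1 - Cmod y * Cmod y <= Cmod (1 + y * y)%C.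
Proof.
assert (T := Cmod_triangle' (RtoC 1) (- (y * y))%C). rewrite Cmod_1, Cmod_opp, Cmod_mult in T.
replace (1 - - (y * y))%C with (1 + y * y)%C in T by ring; exact T.
Qed.

(** A coarse bound r / sqrt(1 - r^2) on the modulus, meant for the second condition of
    [sin_image_contains]; it is too large to keep the sum of three terms below sin 1. *)
Lemma log_term_lune_bound (w : C -> C) (z : C) : schwarz_map w ->
  Cmod z * Cmod z + 2 * Cmod z <= 1 ->
  Cmod (log_term L_lune w z) * Cmod (log_term L_lune w z) * (1 - Cmod z * Cmod z) <= Cmod z * Cmod z.
Proof.
intros Hw Hr; assert (Hr0 := Cmod_ge_0 z).
assert (Hz : in_disc z) by (unfold in_disc; nra).
destruct (schwarz_map_bounds w z Hw Hz) as [B1 _].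
assert (Hwd : in_disc (w z)) by (apply Hw, Hz).
assert (N := Csqrt_neq_0 _ (Re_Csqrt_one_plus _ (sqr_in_disc _ Hwd))).
assert (V := schwarz_map_derivative_bound w z Hw Hr).
unfold log_term, L_lune; rewrite Cmod_mult, Cmod_inv by exact N.
assert (S := Cmod_Csqrt_sqr (1 + w z * w z)); assert (L := one_plus_sqr_ge (w z)).
assert (Np : 0 < Cmod (Csqrt (1 + w z * w z))) by (apply Cmod_gt_0; exact N).
assert (Hv0 := Cmod_ge_0 (z * C_derive w z)%C); assert (Hw0 := Cmod_ge_0 (w z)).
set (r := Cmod z) in *; set (q := Cmod (w z)) in *; set (s := Cmod (Csqrt (1 + w z * w z))) in *.
set (v := Cmod (z * C_derive w z)%C) in *.
apply Rmult_le_reg_r with (s * s); [nra|].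
replace (v * / s * (v * / s) * (1 - r * r) * (s * s)) with (v * v * (1 - r * r)) by (field; lra).
unfold in_disc in Hz; fold r in Hz.
assert (v * v <= r * r) by nra.
assert (1 - r * r <= s * s) by nra.
assert (0 <= 1 - r * r) by nra.
apply Rmult_le_compat; nra.
Qed.

(* With [q = x + i y], the hypothesis becomes [(x^2 + y^2)^2 <= rho^4 |1 - q^2|^2]. *)
Lemma Re_over_sqrt_bound (y S : C) (rho : R) : Cmod y <= rho -> rho * rho * (rho * rho) * 4 <= 1 ->
  S <> 0%C -> (S * S)%C = (1 + y * y)%C ->
  Re (y / S)%C * Re (y / S)%C * (1 + rho * rho) <= rho * rho.
Proof.
intros Hy Hrho HS E; assert (Hy0 := Cmod_ge_0 y).
set (q := (y / S)%C).
assert (Eq : (q * q)%C = (y * y * (1 - q * q))%C).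
{ assert (E' : (1 - q * q)%C = (/ (S * S))%C).
  { unfold q; replace (1 - y / S * (y / S))%C with ((S * S - y * y) / (S * S))%C by (field; exact HS).
    rewrite E; replace (1 + y * y - y * y)%C with (RtoC 1) by ring. rewrite <- E; field; exact HS. }
  rewrite E'; unfold q; field; exact HS. }
assert (M : Cmod (q * q)%C <= rho * rho * Cmod (1 - q * q)%C).
{ rewrite Eq at 1; rewrite !Cmod_mult; apply Rmult_le_compat_r; [apply Cmod_ge_0|nra]. }
assert (M2 : Cmod (q * q)%C * Cmod (q * q)%C <= (rho * rho) * (rho * rho) * (Cmod (1 - q * q)%C * Cmod (1
  - q * q)%C)).
{ assert (T := Cmod_ge_0 (q * q)%C). 
  replace ((rho * rho) * (rho * rho) * (Cmod (1 - q * q)%C * Cmod (1 - q * q)%C)) with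
    ((rho * rho * Cmod (1 - q * q)%C) * (rho * rho * Cmod (1 - q * q)%C)) by ring.
  apply Rmult_le_compat; assumption. }
rewrite !Cmod_sqr in M2.
destruct q as [a b]; simpl in M2 |- *.
set (X := a * a) in *; set (Y := b * b).
assert (HX : 0 <= X) by (unfold X; nra); assert (HY : 0 <= Y) by (unfold Y; nra).
set (p := rho * rho) in *.
assert (Hp : 0 <= p) by (unfold p; nra).
assert (M3 : (X + Y) * (X + Y) <= p * p * (1 - 2 * X + 2 * Y + (X + Y) * (X + Y))).
{ unfold X, Y in *; nra. }
destruct (Rle_dec (X * (1 + p)) p) as [|Hn]; [assumption|exfalso].
assert (Hp4 : p <= 1 / 2) by nra.
assert (K : 0 < X * (1 + p) - p) by lra.
(* Read as a polynomial in Y. Its constant term X^2 - p^2 (1 - X)^2 factors and is positive when X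
   (1 + p) > p; the other coefficients are then nonnegative because p <= 1 / 2. *)
assert (Fact : (X * (1 + p) - p) * (X * (1 - p) + p) + Y * (2 * X * (1 - p * p) - 2 * p * p) + Y * Y * (1
  - p * p) <= 0) by nra.
assert (P1 : 0 <= Y * Y * (1 - p * p)) by (apply Rmult_le_pos; nra).
assert (P2 : 0 <= 2 * X * (1 - p * p) - 2 * p * p).
{ assert (p * (1 - p) <= X * (1 + p) * (1 - p)) by (apply Rmult_le_compat_r; lra). nra. }
assert (P3 : 0 <= Y * (2 * X * (1 - p * p) - 2 * p * p)) by (apply Rmult_le_pos; assumption).
assert (P4 : 0 < X * (1 - p) + p) by nra.
assert (0 < (X * (1 + p) - p) * (X * (1 - p) + p)) by (apply Rmult_lt_0_compat; assumption).
lra.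
Qed.

(** * The radii *)

Lemma sqrt_quotient_sqr (r : R) : 0 <= r ->
  let a := r / sqrt (1 + r * r) in 0 <= a <= r /\ a * a * (1 + r * r) = r * r.
Proof.
intros Hr a.
assert (H1 : 1 <= sqrt (1 + r * r)) by (rewrite <- sqrt_1 at 1; apply sqrt_le_1_alt; nra).
assert (H2 : sqrt (1 + r * r) * sqrt (1 + r * r) = 1 + r * r) by (apply sqrt_sqrt; nra).
split; [split|].
- apply Rdiv_le_0_compat; lra.
- apply Rmult_le_reg_r with (sqrt (1 + r * r)); [lra|]; unfold a, Rdiv;
    rewrite Rmult_assoc, Rinv_l by lra; nra.
- unfold a; rewrite <- H2 at 3; field; lra.
Qed.

(** Splitting z w' as w + (z w' - w), the first part contributes at most b = q / sqrt(1 + q^2) to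
    the real part, and Dieudonne's lemma bounds the second by a multiple of r^2 - q^2. For r <= 0.3
    that is at most a - b, with a = r / sqrt(1 + r^2). *)
Lemma log_term_lune_Re_bound (w : C -> C) (z : C) : schwarz_map w -> Cmod z <= 0.3 ->
  Rabs (Re (log_term L_lune w z)) <= Cmod z / sqrt (1 + Cmod z * Cmod z).
Proof.
intros Hw Hr; assert (Hr0 := Cmod_ge_0 z).
assert (Hz : in_disc z) by (unfold in_disc; lra).
destruct (schwarz_map_bounds w z Hw Hz) as [B1 [B2 _]].
assert (Hwd : in_disc (w z)) by (apply Hw, Hz).
assert (N := Csqrt_neq_0 _ (Re_Csqrt_one_plus _ (sqr_in_disc _ Hwd))).
assert (Hw0 := Cmod_ge_0 (w z)).
assert (Hd0 := Cmod_ge_0 (z * C_derive w z - w z)%C).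
assert (Np : 0 < Cmod (Csqrt (1 + w z * w z))) by (apply Cmod_gt_0; exact N).
assert (S := Cmod_Csqrt_sqr (1 + w z * w z)); assert (L := one_plus_sqr_ge (w z)).
assert (Hq2 : 0 <= Cmod (w z) * Cmod (w z) <= 0.09) by (split; nra).
assert (X := Re_over_sqrt_bound (w z) (Csqrt (1 + w z * w z)) (Cmod (w z)) (Rle_refl _) ltac:(nra) N
  (Csqrt_sqr _)).
set (x := Re (w z / Csqrt (1 + w z * w z))%C) in *.
set (e := ((z * C_derive w z - w z) / Csqrt (1 + w z * w z))%C).
assert (E : log_term L_lune w z = (w z / Csqrt (1 + w z * w z) + e)%C).
{ unfold log_term, L_lune, e; field; exact N. }
assert (RE : Rabs (Re (log_term L_lune w z)) <= Rabs x + Cmod e).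
{ rewrite E; change (Rabs (x + Re e) <= Rabs x + Cmod e).
  eapply Rle_trans; [apply Rabs_triang|]; apply Rplus_le_compat_l, re_le_Cmod. }
eapply Rle_trans; [exact RE|].
assert (Ee : Cmod e * Cmod (Csqrt (1 + w z * w z)) = Cmod (z * C_derive w z - w z)%C).
{ unfold e; rewrite Cmod_div by exact N; field; lra. }
assert (He0 := Cmod_ge_0 e).
destruct (sqrt_quotient_sqr (Cmod z) Hr0) as [[Ha0 Ha] Ea].
destruct (sqrt_quotient_sqr (Cmod (w z)) Hw0) as [[Hb0 Hb] Eb].
set (a := Cmod z / sqrt (1 + Cmod z * Cmod z)) in *.
set (b := Cmod (w z) / sqrt (1 + Cmod (w z) * Cmod (w z))) in *.
set (r := Cmod z) in *; set (q := Cmod (w z)) in *; set (s := Cmod (Csqrt (1 + w z * w z))) in *.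
set (d := Cmod (z * C_derive w z - w z)%C) in *; set (m := Cmod e) in *.
assert (Hx : Rabs x <= b).
{ assert (Ex : Rabs x * Rabs x = x * x) by (rewrite <- Rabs_mult; apply Rabs_pos_eq; nra).
  assert (Hx0 := Rabs_pos x). rewrite <- Ex in X. nra. }
assert (Hq : q * q <= 0.09) by nra. assert (Hrr : r * r <= 0.09) by nra.
assert (Hs : 0.91 <= s) by nra.
assert (D1 : m * 0.82 <= r * r - q * q).
{ assert (m * 0.91 <= d) by nra. nra. }
(* This writes a - b as (r^2 - q^2) / k with k <= 0.72, whereas [D1] bounds [m] by (r^2 - q^2) /
   0.82. *)
assert (D2 : (a - b) * ((a + b) * ((1 + r * r) * (1 + q * q))) = r * r - q * q).
{ replace ((a - b) * ((a + b) * ((1 + r * r) * (1 + q * q)))) with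
    (a * a * (1 + r * r) * (1 + q * q) - b * b * (1 + q * q) * (1 + r * r)) by ring.
  rewrite Ea, Eb; ring. }
assert (K0 : 1 <= (1 + r * r) * (1 + q * q) <= 1.2) by (split; nra).
assert (K1 : 0 <= (a + b) * ((1 + r * r) * (1 + q * q)) <= 0.72).
{ split; [apply Rmult_le_pos; lra|]. apply Rle_trans with (0.6 * 1.2); [apply Rmult_le_compat; lra|lra]. }
set (k := (a + b) * ((1 + r * r) * (1 + q * q))) in *.
destruct (Rle_dec m (a - b)) as [|Hn]; [lra|exfalso].
(* Comparing 0.72 with 0.82 is a contradiction only for m > 0; the case m = 0 is excluded by b <= a,
   which follows from q <= r. *)
assert (0 < m).
{ destruct (Rle_dec m 0); [|lra]. assert (0 < b - a) by lra. assert (q * q <= r * r) by nra. 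
  assert (b <= a); [|lra]. 
  destruct (Rle_dec b a); [assumption|exfalso].
  assert (b * b <= a * a); [|nra].
  assert (b * b * (1 + q * q) * (1 + r * r) <= a * a * (1 + r * r) * (1 + q * q)); [rewrite Ea, Eb; nra|].
  apply Rmult_le_reg_r with ((1 + r * r) * (1 + q * q)); lra. }
nra.
Qed.

(** The disc of radius sin 1 satisfies both conditions of [sin_image_contains], as (sin 1)^2 <
    0.9. *)
Lemma sin_image_small (u : C) (c : R) : Cmod u <= c -> c < sin 1 -> exists y, in_disc y /\ u = Csin y.
Proof.
intros Hu Hc; assert (B := sin_1_bounds); assert (H0 := Cmod_ge_0 u); assert (T := re_le_Cmod u).
apply sin_image_contains; [lra|nra].
Qed.

Lemma Cmod_sum3_le (a b c : C) (x y z : R) :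
  Cmod a <= x -> Cmod b <= y -> Cmod c <= z -> Cmod (a + b + c)%C <= x + y + z.
Proof.
intros Ha Hb Hc; assert (T1 := Cmod_triangle (a + b) c); assert (T2 := Cmod_triangle a b); lra.
Qed.

Lemma phi_sqrt_0 : phi_sqrt 0%C = 1%C.
Proof.
unfold phi_sqrt; replace (1 + 0)%C with (RtoC 1) by ring.
unfold Csqrt; rewrite Cmod_1; simpl; destruct (Rle_dec 0 0); [|lra].
replace ((1 + 1) / 2) with 1 by field; replace ((1 - 1) / 2) with 0 by field.
rewrite sqrt_1, sqrt_0; reflexivity.
Qed.

Lemma Csqrt_nonneg (x : R) : 0 <= x -> Csqrt (RtoC x) = RtoC (sqrt x).
Proof.
intros Hx; unfold Csqrt; rewrite Cmod_R, Rabs_pos_eq by exact Hx; simpl.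
destruct (Rle_dec 0 0); [|lra].
replace ((x + x) / 2) with x by field; replace ((x - x) / 2) with 0 by field.
rewrite sqrt_0; reflexivity.
Qed.

Lemma phi_lune_0 : phi_lune 0%C = 1%C.
Proof.
unfold phi_lune; replace (1 + 0 * 0)%C with (RtoC 1) by ring.
rewrite Csqrt_nonneg, sqrt_1 by lra; ring.
Qed.

Lemma neg_real_in_disc (t : R) : 0 < t < 1 -> in_disc (RtoC (- t)) /\ RtoC (- t) <> 0%C.
Proof.
intros Ht; split; [unfold in_disc; rewrite Cmod_R, Rabs_Ropp, Rabs_pos_eq; lra|apply RtoC_neq_0; lra].
Qed.

Lemma L_sqrt_real (t : R) : t < 1 -> L_sqrt (RtoC (- t)) = RtoC (/ (2 * (1 - t))).
Proof.
intros Ht; unfold L_sqrt. rewrite <- RtoC_plus, <- RtoC_mult, <- RtoC_inv by lra. do 2 f_equal; ring.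
Qed.

Lemma L_lune_real (t : R) : L_lune (RtoC (- t)) = RtoC (/ sqrt (1 + t * t)).
Proof.
unfold L_lune; rewrite <- RtoC_mult, <- RtoC_plus.
replace (1 + - t * - t) with (1 + t * t) by ring.
rewrite Csqrt_nonneg by nra.
rewrite RtoC_inv; [reflexivity|]. apply Rgt_not_eq, sqrt_lt_R0; nra.
Qed.

(** The two hypotheses locate [R0] at the crossing of the extremal bound with sin 1. The bound 0.4
    guarantees r^2 + 2 r <= 1, as the exponential terms require. *)
Lemma radius_T1 (R0 : R) : 0 < R0 < 0.4 ->
  (forall r, 0 <= r < R0 -> 2 * r + r / (2 * (1 - r)) < sin 1) ->
  (forall t, R0 < t < 1 -> sin 1 <= 2 * t + t / (2 * (1 - t))) ->
  is_radius starlike_sin classT1 R0.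
Proof.
intros HR Hlt Hge; apply is_radius_intro; [lra| |].
- intros f Hf.
  destruct (classT_starlike_data _ _ _ _ f log_derivative_exp log_derivative_sqrt Hf)
    as [u [w1 [w2 [w3 [Hu [W1 [W2 [W3 E]]]]]]]].
  exists u; split; [exact Hu|]; intros z Hz; assert (H0 := Cmod_ge_0 z).
  apply sin_image_small with (2 * Cmod z + Cmod z / (2 * (1 - Cmod z))); [|apply Hlt; lra].
  assert (Hd : in_disc z) by (unfold in_disc; lra).
  rewrite E by exact Hd.
  replace (2 * Cmod z) with (Cmod z + Cmod z) by ring.
  apply Cmod_sum3_le; [apply log_term_exp_bound|apply log_term_exp_bound|apply log_term_sqrt_bound];
    try assumption; nra.
- destruct (classT_extremal _ _ _ _ log_derivative_exp log_derivative_sqrt Cexp_0 phi_sqrt_0) as [f [Hf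
    Hu]].
  exists f; split; [exact Hf|]; intros u Du t Ht.
  destruct (neg_real_in_disc t ltac:(lra)) as [D1 D2].
  exists (- (2 * t + t / (2 * (1 - t)))); split; [|assert (T := Hge t Ht); lra].
  rewrite (Hu u Du _ D1 D2), L_sqrt_real by lra; unfold L_exp.
  rewrite <- RtoC_mult, <- RtoC_plus, <- RtoC_mult; f_equal; field; lra.
Qed.

Lemma radius_T2 (R0 : R) : 0 < R0 < 0.4 ->
  (forall r, 0 <= r < R0 -> r / (1 - r) + r < sin 1) ->
  (forall t, R0 < t < 1 -> sin 1 <= t / (1 - t) + t) ->
  is_radius starlike_sin classT2 R0.
Proof.
intros HR Hlt Hge; apply is_radius_intro; [lra| |].
- intros f Hf.
  destruct (classT_starlike_data _ _ _ _ f log_derivative_sqrt log_derivative_exp Hf)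
    as [u [w1 [w2 [w3 [Hu [W1 [W2 [W3 E]]]]]]]].
  exists u; split; [exact Hu|]; intros z Hz; assert (H0 := Cmod_ge_0 z).
  apply sin_image_small with (Cmod z / (1 - Cmod z) + Cmod z); [|apply Hlt; lra].
  assert (Hd : in_disc z) by (unfold in_disc; lra).
  rewrite E by exact Hd.
  replace (Cmod z / (1 - Cmod z)) with (Cmod z / (2 * (1 - Cmod z)) + Cmod z / (2 * (1 - Cmod z)))
    by (field; lra).
  apply Cmod_sum3_le; [apply log_term_sqrt_bound|apply log_term_sqrt_bound|apply log_term_exp_bound];
    try assumption; nra.
- destruct (classT_extremal _ _ _ _ log_derivative_sqrt log_derivative_exp phi_sqrt_0 Cexp_0) as [f [Hf
    Hu]].
  exists f; split; [exact Hf|]; intros u Du t Ht.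
  destruct (neg_real_in_disc t ltac:(lra)) as [D1 D2].
  exists (- (t / (1 - t) + t)); split; [|assert (T := Hge t Ht); lra].
  rewrite (Hu u Du _ D1 D2), L_sqrt_real by lra; unfold L_exp.
  rewrite <- RtoC_mult, <- RtoC_plus, <- RtoC_mult; f_equal; field; lra.
Qed.

Lemma radius_T3 (R0 : R) : 0 < R0 < 0.3 ->
  (forall r, 0 <= r < R0 -> 3 * (r / sqrt (1 + r * r)) < sin 1) ->
  (forall t, R0 < t < 1 -> sin 1 <= 3 * (t / sqrt (1 + t * t))) ->
  is_radius starlike_sin classT3 R0.
Proof.
intros HR Hlt Hge; apply is_radius_intro; [lra| |].
- intros f Hf.
  destruct (classT_starlike_data _ _ _ _ f log_derivative_lune log_derivative_lune Hf)
    as [u [w1 [w2 [w3 [Hu [W1 [W2 [W3 E]]]]]]]].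
  exists u; split; [exact Hu|]; intros z Hz; assert (H0 := Cmod_ge_0 z).
  assert (Hd : in_disc z) by (unfold in_disc; lra).
  apply sin_image_contains; rewrite E by exact Hd.
  + assert (T1 := log_term_lune_Re_bound w1 z W1 ltac:(lra)).
    assert (T2 := log_term_lune_Re_bound w2 z W2 ltac:(lra)).
    assert (T3 := log_term_lune_Re_bound w3 z W3 ltac:(lra)).
    assert (K := Hlt (Cmod z) ltac:(lra)).
    set (x1 := log_term L_lune w1 z) in *; set (x2 := log_term L_lune w2 z) in *;
      set (x3 := log_term L_lune w3 z) in *.
    change (Rabs (Re x1 + Re x2 + Re x3) < sin 1).
    assert (U1 := Rabs_triang (Re x1 + Re x2) (Re x3)); assert (U2 := Rabs_triang (Re x1) (Re x2)); lra.
  (* The constant comes from 0.3 / sqrt 0.91 < 0.315, and (3 times 0.315)^2 < 0.9. *)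
  + assert (K : forall w, schwarz_map w -> Cmod (log_term L_lune w z) <= 0.315).
    { intros w Hw; assert (T := log_term_lune_bound w z Hw ltac:(nra)).
      assert (T0 := Cmod_ge_0 (log_term L_lune w z)).
      set (v := Cmod (log_term L_lune w z)) in *; set (r := Cmod z) in *.
      assert (r * r <= 0.09) by nra. nra. }
    assert (S := Cmod_sum3_le _ _ _ _ _ _ (K w1 W1) (K w2 W2) (K w3 W3)).
    assert (S0 := Cmod_ge_0 (log_term L_lune w1 z + log_term L_lune w2 z + log_term L_lune w3 z)%C). nra.
- destruct (classT_extremal _ _ _ _ log_derivative_lune log_derivative_lune phi_lune_0 phi_lune_0) as [f
    [Hf Hu]].
  exists f; split; [exact Hf|]; intros u Du t Ht.
  destruct (neg_real_in_disc t ltac:(lra)) as [D1 D2].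
  exists (- (3 * (t / sqrt (1 + t * t)))); split; [|assert (T := Hge t Ht); lra].
  rewrite (Hu u Du _ D1 D2), L_lune_real.
  rewrite <- RtoC_mult, <- RtoC_plus, <- RtoC_mult; f_equal; unfold Rdiv; ring.
Qed.

Lemma sqrt_bounds (x a b : R) : 0 <= a -> 0 <= b -> a * a <= x <= b * b -> a <= sqrt x <= b.
Proof.
intros Ha Hb [H1 H2]; split.
- rewrite <- (sqrt_square a) by exact Ha; apply sqrt_le_1_alt, H1.
- rewrite <- (sqrt_square b) by exact Hb; apply sqrt_le_1_alt, H2.
Qed.

Theorem corollary3p5 :
  (let R1 := (5 + 2 * sin 1 - sqrt (25 - 12 * sin 1 + 4 * (sin 1) ^ 2)) / 8 in
   is_radius starlike_sin classT1 R1 /\ Rabs (R1 - 0.308961) <= 0.0000005) /\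
  (let R2 := (2 + sin 1 - sqrt (4 + (sin 1) ^ 2)) / 2 in
   is_radius starlike_sin classT2 R2 /\ Rabs (R2 - 0.335831) <= 0.0000005) /\
  (let R3 := sin 1 / sqrt (9 - (sin 1) ^ 2) in
   is_radius starlike_sin classT3 R3 /\ Rabs (R3 - 0.292221) <= 0.0000005).
Proof.
assert (B := sin_1_bounds); set (s := sin 1) in *.
split; [|split]; intros R0.
- set (q := sqrt (25 - 12 * s + 4 * s ^ 2)) in *.
  assert (Q : q * q = 25 - 12 * s + 4 * s ^ 2) by (apply sqrt_sqrt; nra).
  assert (Qb : 4.2112516 <= q <= 4.2112521) by (apply sqrt_bounds; [lra|lra|split; nra]).
  assert (RB : Rabs (R0 - 0.308961) <= 0.0000005) by (apply Rabs_le; unfold R0; lra).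
  split; [|exact RB]; apply Rabs_le_between in RB.
  apply radius_T1; [lra| |].
  (* Clearing denominators leaves the sign of 4 r^2 - (5 + 2 s) r + 2 s, with discriminant q^2 and
     smaller root [R0]; the larger root lies beyond 1. The second radius is treated alike with r^2 -
     (2 + s) r + s. *)
  + intros r Hr; fold s.
    apply Rmult_lt_reg_r with (2 * (1 - r)); [lra|].
    replace ((2 * r + r / (2 * (1 - r))) * (2 * (1 - r))) with (4 * r * (1 - r) + r) by (field; lra).
    assert (q < 5 + 2 * s - 8 * r) by (unfold R0 in Hr; lra). nra.
  + intros t Ht; fold s.
    apply Rmult_le_reg_r with (2 * (1 - t)); [lra|].
    replace ((2 * t + t / (2 * (1 - t))) * (2 * (1 - t))) with (4 * t * (1 - t) + t) by (field; lra).
    assert (5 + 2 * s - 8 * t < q) by (unfold R0 in Ht; lra). nra.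
- set (q := sqrt (4 + s ^ 2)) in *.
  assert (Q : q * q = 4 + s ^ 2) by (apply sqrt_sqrt; nra).
  assert (Qb : 2.1698094 <= q <= 2.1698098) by (apply sqrt_bounds; [lra|lra|split; nra]).
  assert (RB : Rabs (R0 - 0.335831) <= 0.0000005) by (apply Rabs_le; unfold R0; lra).
  split; [|exact RB]; apply Rabs_le_between in RB.
  apply radius_T2; [lra| |].
  + intros r Hr; fold s.
    apply Rmult_lt_reg_r with (1 - r); [lra|].
    replace ((r / (1 - r) + r) * (1 - r)) with (r + r * (1 - r)) by (field; lra).
    assert (q < 2 + s - 2 * r) by (unfold R0 in Hr; lra). nra.
  + intros t Ht; fold s.
    apply Rmult_le_reg_r with (1 - t); [lra|].
    replace ((t / (1 - t) + t) * (1 - t)) with (t + t * (1 - t)) by (field; lra).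
    assert (2 + s - 2 * t < q) by (unfold R0 in Ht; lra). nra.
- set (q := sqrt (9 - s ^ 2)) in *.
  assert (Q : q * q = 9 - s ^ 2) by (apply sqrt_sqrt; nra).
  assert (Qb : 2.8795704 <= q <= 2.879571) by (apply sqrt_bounds; [lra|lra|split; nra]).
  assert (ER : R0 * q = s) by (unfold R0; field; lra).
  assert (RB : Rabs (R0 - 0.292221) <= 0.0000005) by (apply Rabs_le; nra).
  split; [|exact RB]; apply Rabs_le_between in RB.
  (* The condition 3 r < s sqrt(1 + r^2) squares to r^2 (9 - s^2) < s^2, which becomes an equality
     at [R0]. *)
  assert (ER2 : R0 * R0 * (9 - s ^ 2) = s ^ 2).
  { transitivity (R0 * q * (R0 * q)); [rewrite <- Q; ring|rewrite ER; ring]. }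
  assert (Sq : forall r, 0 <= r -> 0 < sqrt (1 + r * r) /\ sqrt (1 + r * r) * sqrt (1 + r * r) = 1 + r * r).
  { intros r Hr; split; [apply sqrt_lt_R0; nra|apply sqrt_sqrt; nra]. }
  apply radius_T3; [lra| |].
  + intros r Hr; fold s; destruct (Sq r ltac:(lra)) as [P E].
    apply Rmult_lt_reg_r with (sqrt (1 + r * r)); [exact P|].
    replace (3 * (r / sqrt (1 + r * r)) * sqrt (1 + r * r)) with (3 * r) by (field; lra).
    assert (r * r < R0 * R0) by nra.
    apply Rsqr_incrst_0; [unfold Rsqr|lra|nra].
    replace (s * sqrt (1 + r * r) * (s * sqrt (1 + r * r))) with (s ^ 2 * (1 + r * r))
      by (set (k := sqrt (1 + r * r)) in *; rewrite <- E; ring). nra.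
  + intros t Ht; fold s; destruct (Sq t ltac:(lra)) as [P E].
    apply Rmult_le_reg_r with (sqrt (1 + t * t)); [exact P|].
    replace (3 * (t / sqrt (1 + t * t)) * sqrt (1 + t * t)) with (3 * t) by (field; lra).
    assert (R0 * R0 < t * t) by nra.
    apply Rsqr_incr_0; [unfold Rsqr|nra|lra].
    replace (s * sqrt (1 + t * t) * (s * sqrt (1 + t * t))) with (s ^ 2 * (1 + t * t))
      by (set (k := sqrt (1 + t * t)) in *; rewrite <- E; ring). nra.
Qed.
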